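(* The linear relation $\mathrm{T}$ is self-adjoint in $\mathcal{H}(\mathbb{R})$.
   Context: Let $\omega$ be a real-valued Borel measure on $\mathbb{R}$ and $\upsilon$ a non-negative Borel measure on $\mathbb{R}$ (both locally finite; so $\omega$ is a signed measure assigning finite values to bounded Borel sets). The superscript $^\ast$ on numbers and functions denotes complex conjugation. Let $\mathcal{H}_{\mathrm{loc}}(\mathbb{R})=H^1_{\mathrm{loc}}(\mathbb{R})\times L^2_{\mathrm{loc}}(\mathbb{R};\upsilon)$, where $H^1_{\mathrm{loc}}(\mathbb{R})$ consists of locally absolutely continuous functions with locally square integrable derivative; components of $f\in\mathcal{H}_{\mathrm{loc}}(\mathbb{R})$ are denoted $f_1,f_2$. The linear relation $\mathrm{T}_{\mathrm{loc}}$ consists of all pairs $(f,g)\in\mathcal{H}_{\mathrm{loc}}(\mathbb{R})\times\mathcal{H}_{\mathrm{loc}}(\mathbb{R})$ such that $-f_1''+\frac14 f_1=\omega g_1+\upsilon g_2$ in the sense of distributions and $f_2=g_1$ almost everywhere with respect to $\upsilon$. $\mathcal{H}(\mathbb{R})=H^1(\mathbb{R})\times L^2(\mathbb{R};\upsilon)$ is the Hilbert space with scalar product $$\langle f,g\rangle_{\mathcal{H}(\mathbb{R})}=\frac14\int_{\mathbb{R}} f_1g_1^\ast\,dx+\int_{\mathbb{R}} f_1'(g_1')^\ast\,dx+\int_{\mathbb{R}} f_2g_2^\ast\,d\upsilon .$$ The linear relation $\mathrm{T}$ in $\mathcal{H}(\mathbb{R})$ is $\mathrm{T}=\{\mathbf{f}\in\mathrm{T}_{\mathrm{loc}}:\mathbf{f}\in\mathcal{H}(\mathbb{R})\times\mathcal{H}(\mathbb{R})\}$.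 The adjoint of a linear relation $\mathrm{S}$ in a Hilbert space is $\mathrm{S}^\ast=\{(u,v):\langle u,k\rangle=\langle v,h\rangle\text{ for all }(h,k)\in\mathrm{S}\}$; $\mathrm{S}$ is self-adjoint if $\mathrm{S}=\mathrm{S}^\ast$. *)

(* Defs.v *)
From HB Require Import structures.
From mathcomp Require Import all_boot all_order all_algebra.
From mathcomp Require Import all_classical all_reals all_analysis.
From mathcomp Require Import complex.

Set Implicit Arguments.
Unset Strict Implicit.
Unset Printing Implicit Defensive.

Import Order.TTheory GRing.Theory Num.Theory.
Import numFieldNormedType.Exports.

Local Open Scope classical_set_scope.
Local Open Scope ring_scope.
Local Open Scope complex_scope.

(* MathComp-Analysis integrates extended-real functions and differentiates
   maps into normed modules over the domain field, so for maps into [R[i]]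
   integrals, derivatives and measurability are taken on real and imaginary
   parts. *)

Definition Cintegral d (T : measurableType d) (R : realType)
    (mu : {measure set T -> \bar R}) (f : T -> R[i]) : R[i] :=
  Complex (\int[mu]_x complex.Re (f x)) (\int[mu]_x complex.Im (f x)).

Definition Cmeasurable d (T : measurableType d) (R : realType)
    (D : set T) (f : T -> R[i]) : Prop :=
  measurable_fun D (fun x => complex.Re (f x)) /\
  measurable_fun D (fun x => complex.Im (f x)).

(* [Re z ^+ 2 + Im z ^+ 2] is [|z|^2]. *)
Definition square_integrable d (T : measurableType d) (R : realType)
    (mu : {measure set T -> \bar R}) (D : set T) (f : T -> R[i]) : Prop :=
  Cmeasurable D f /\
  (\int[mu]_(x in D)
     (complex.Re (f x) ^+ 2 + complex.Im (f x) ^+ 2)%:E < +oo)%E.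

Definition Cderiv (R : realType) (f : R -> R[i]) (x : R) : R[i] :=
  Complex (derive1 (fun y => complex.Re (f y)) x)
          (derive1 (fun y => complex.Im (f y)) x).

(* A real-valued, locally finite Borel measure need not extend to unbounded
   sets, so only the values on bounded Borel sets are meaningful. *)
Record signed_borel (R : realType) := SignedBorel {
  sb_fun :> set (measurableTypeR R) -> R ;
  sb_sigma_additive : forall F : nat -> set (measurableTypeR R),
    (forall i, measurable (F i)) -> trivIset setT F ->
    bounded_set (\bigcup_i F i : set R) ->
    (fun n => \sum_(0 <= i < n) sb_fun (F i)) @ \oo --> sb_fun (\bigcup_i F i)
}.

Definition locally_finite_measure (R : realType)
    (mu : {measure set (measurableTypeR R) -> \bar R}) : Prop :=
  forall A : set (measurableTypeR R),
    measurable A -> bounded_set (A : set R) -> (mu A < +oo)%E.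

Definition window (R : realType) (n : nat) : set (measurableTypeR R) :=
  `[(- n%:R : R), n%:R]%classic.
Arguments window : clear implicits.

Section signed_restriction.
Context (R : realType) (omega : signed_borel R) (n : nat).

Definition signed_restr (A : set (measurableTypeR R)) : \bar R :=
  (omega (A `&` window R n))%:E.

Let bounded_window (A : set R) : bounded_set (A `&` (window R n : set R)).
Proof.
exists n%:R; split; first exact: num_real.
move=> x nx y [_]; rewrite /window /= in_itv/= => yn.
by rewrite (le_trans _ (ltW nx))// ler_norml.
Qed.

Let signed_restr0 : signed_restr set0 = 0%E.
Proof.
rewrite /signed_restr set0I; congr EFin.
have b0 : bounded_set (\bigcup_(i : nat) (set0 : set R)).
  by rewrite bigcup0// -[X in bounded_set X](set0I (window R n));
    exact: bounded_window.
have := @sb_sigma_additive _ omega (fun=> set0) (fun=> measurable0)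
  (@trivIset_set0 _ _ _) b0.
rewrite bigcup0//; set a := omega set0 => cva.
have cva1 : (fun k => \sum_(0 <= i < k.+1) a) @ \oo --> a.
  by rewrite (cvg_shiftS (fun k => \sum_(0 <= i < k) a)).
have := cvgB cva1 cva; rewrite subrr => cv0.
have E : (fun k => \sum_(0 <= i < k.+1) a) - (fun k => \sum_(0 <= i < k) a)
    = (fun=> a) :> (nat -> R).
  by apply/funext => k; rewrite !fctE big_nat_recr//= addrC addKr.
rewrite E in cv0.
have cvc : (fun=> a) @ \oo --> a by exact: cvg_cst.
exact: (cvg_unique (@Rhausdorff R) cvc (cv0 _)).
Qed.

Let signed_restr_fin A : measurable A -> signed_restr A \is a fin_num.
Proof. by []. Qed.

Let signed_restr_sigma_additive : semi_sigma_additive signed_restr.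
Proof.
move=> F mF tF _; rewrite /signed_restr setI_bigcupl.
under eq_fun do rewrite sumEFin.
apply: cvg_EFin; first exact: nearW.
apply: sb_sigma_additive.
- by move=> i; apply: measurableI => //; exact: measurable_itv.
- exact: trivIset_setIr.
- by rewrite -setI_bigcupl; exact: bounded_window.
Qed.

HB.instance Definition _ := isCharge.Build _ _ _ signed_restr
  signed_restr0 signed_restr_fin signed_restr_sigma_additive.

End signed_restriction.

(* The positive and negative parts below do not depend on the Hahn
   decomposition that is chosen. *)
Definition hahn_choice d (T : measurableType d) (R : realType)
    (nu : {charge set T -> \bar R}) :
    {PN : set T * set T | hahn_decomposition nu PN.1 PN.2} :=
  cid (let: ex_intro P (ex_intro N PN) := Hahn_decomposition nu in
       ex_intro (fun PN => hahn_decomposition nu PN.1 PN.2) (P, N) PN).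

Definition charge_Cintegral d (T : measurableType d) (R : realType)
    (nu : {charge set T -> \bar R}) (f : T -> R[i]) : R[i] :=
  Cintegral (jordan_pos (svalP (hahn_choice nu))) f -
  Cintegral (jordan_neg (svalP (hahn_choice nu))) f.

Definition abs_continuous_on (R : realType) (a b : R) (f : R -> R[i]) : Prop :=
  forall e : R, 0 < e -> exists2 d : R, 0 < d &
    forall (m : nat) (I : 'I_m -> R * R),
      (forall i, a <= (I i).1 /\ (I i).1 <= (I i).2 /\ (I i).2 <= b) ->
      trivIset setT (fun i => `](I i).1, (I i).2[%classic) ->
      \sum_(i < m) ((I i).2 - (I i).1) < d ->
      \sum_(i < m) Normc.normc (f (I i).2 - f (I i).1) < e.

Definition locally_abs_continuous (R : realType) (f : R -> R[i]) : Prop :=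
  forall a b : R, abs_continuous_on a b f.

Definition L2loc (R : realType)
    (mu : {measure set (measurableTypeR R) -> \bar R}) (f : R -> R[i]) : Prop :=
  forall n, square_integrable mu (window R n) f.

(* A locally absolutely continuous function is differentiable almost
   everywhere, so the junk values of [Cderiv] occur on a null set only. *)
Definition H1loc (R : realType) (f : R -> R[i]) : Prop :=
  locally_abs_continuous f /\ L2loc lebesgue_measure (Cderiv f).

Definition Hloc (R : realType)
    (upsilon : {measure set (measurableTypeR R) -> \bar R})
    (f : (R -> R[i]) * (R -> R[i])) : Prop :=
  H1loc f.1 /\ L2loc upsilon f.2.

Definition test_function (R : realType) (n : nat) (phi : R -> R[i]) : Prop :=
  [/\ forall (k : nat) (x : R),
        derivable (derive1n k (fun y => complex.Re (phi y))) x 1,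
      forall (k : nat) (x : R),
        derivable (derive1n k (fun y => complex.Im (phi y))) x 1
    & forall x, n%:R < `|x| -> phi x = 0].

(* - f1'' + f1 / 4 = omega g1 + upsilon g2, tested against compactly supported
   smooth functions; since [phi] vanishes outside [-n, n], its integral
   against [omega] only involves the restriction of [omega] to [-n, n]. *)
Definition distributional_eq (R : realType) (omega : signed_borel R)
    (upsilon : {measure set (measurableTypeR R) -> \bar R})
    (f1 g1 g2 : R -> R[i]) : Prop :=
  forall (n : nat) (phi : R -> R[i]), test_function n phi ->
    - Cintegral lebesgue_measure (fun x => f1 x * Cderiv (Cderiv phi) x)
    + 4^-1 * Cintegral lebesgue_measure (fun x => f1 x * phi x)
    = charge_Cintegral (signed_restr omega n) (fun x => g1 x * phi x)
      + Cintegral upsilon (fun x => g2 x * phi x).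

Definition Tloc (R : realType) (omega : signed_borel R)
    (upsilon : {measure set (measurableTypeR R) -> \bar R}) :
    set (((R -> R[i]) * (R -> R[i])) * ((R -> R[i]) * (R -> R[i]))) :=
  [set fg | [/\ Hloc upsilon fg.1, Hloc upsilon fg.2,
      distributional_eq omega upsilon fg.1.1 fg.2.1 fg.2.2
    & {ae upsilon, forall x : measurableTypeR R, fg.1.2 x = fg.2.1 x}]].

(* Elements of H^1(R) are identified with their continuous representatives. *)
Record H1 (R : realType) := MkH1 {
  H1_fun :> R -> R[i] ;
  H1_ac : locally_abs_continuous H1_fun ;
  H1_L2 : square_integrable lebesgue_measure setT H1_fun ;
  H1_deriv_L2 : square_integrable lebesgue_measure setT (Cderiv H1_fun)
}.

Record L2fun (R : realType)
    (mu : {measure set (measurableTypeR R) -> \bar R}) := MkL2fun {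
  L2fun_fun :> R -> R[i] ;
  L2fun_sqint : square_integrable mu setT L2fun_fun
}.

Section L2_quotient.
Context (R : realType) (mu : {measure set (measurableTypeR R) -> \bar R}).

HB.instance Definition _ := gen_eqMixin (L2fun mu).
HB.instance Definition _ := gen_choiceMixin (L2fun mu).

Definition L2_eq_op (f g : L2fun mu) : bool :=
  `[< {ae mu, forall x : measurableTypeR R, f x = g x} >].

Let L2_eq_refl : reflexive L2_eq_op.
Proof. by move=> f; apply/asboolP; exact: aeW. Qed.

Let L2_eq_sym : symmetric L2_eq_op.
Proof.
by move=> f g; apply/idP/idP => /asboolP h; apply/asboolP;
  apply: filterS h => x ->.
Qed.

Let L2_eq_trans : transitive L2_eq_op.
Proof.
move=> f g h /asboolP gf /asboolP fh; apply/asboolP.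
by apply: filterS2 gf fh => x -> ->.
Qed.

Canonical L2_eq_equiv := EquivRel L2_eq_op L2_eq_refl L2_eq_sym L2_eq_trans.

Definition L2 : Type := {eq_quot L2_eq_op}%qT.
HB.instance Definition _ := Choice.on L2.
HB.instance Definition _ := EqQuotient.on L2.

Definition L2_rep (f : L2) : R -> R[i] := repr f.

End L2_quotient.

Definition Hspace (R : realType)
    (upsilon : {measure set (measurableTypeR R) -> \bar R}) : Type :=
  (H1 R * L2 upsilon)%type.

Definition H_rep (R : realType)
    (upsilon : {measure set (measurableTypeR R) -> \bar R})
    (f : Hspace upsilon) : (R -> R[i]) * (R -> R[i]) :=
  (f.1 : R -> R[i], L2_rep f.2).

Definition H_inner (R : realType)
    (upsilon : {measure set (measurableTypeR R) -> \bar R})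
    (f g : Hspace upsilon) : R[i] :=
  4^-1 * Cintegral lebesgue_measure (fun x => f.1 x * conjc (g.1 x))
  + Cintegral lebesgue_measure (fun x => Cderiv f.1 x * conjc (Cderiv g.1 x))
  + Cintegral upsilon (fun x => L2_rep f.2 x * conjc (L2_rep g.2 x)).

Definition adjoint_relation (H C : Type) (inner : H -> H -> C)
    (S : set (H * H)) : set (H * H) :=
  [set uv | forall hk, S hk -> inner uv.1 hk.2 = inner uv.2 hk.1].

Definition self_adjoint_relation (H C : Type) (inner : H -> H -> C)
    (S : set (H * H)) : Prop := S = adjoint_relation inner S.

(* Membership in [Tloc] is insensitive to changing the second components on
   [upsilon]-null sets, so it may be tested on representatives. *)
Definition Trel (R : realType) (omega : signed_borel R)
    (upsilon : {measure set (measurableTypeR R) -> \bar R}) :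
    set (Hspace upsilon * Hspace upsilon) :=
  [set fg | Tloc omega upsilon (H_rep fg.1, H_rep fg.2)].
Arguments Trel {R} omega upsilon _.

(* Main.v *)
From HB Require Import structures.
Require Import Defs.
From mathcomp Require Import all_boot all_order all_algebra.
From mathcomp Require Import all_classical all_reals all_analysis.
From mathcomp Require Import measurable_realfun complex.
From mathcomp Require Import ring lra.

Set Implicit Arguments.
Unset Strict Implicit.
Unset Printing Implicit Defensive.

Import Order.TTheory GRing.Theory Num.Theory.
Import numFieldNormedType.Exports.

Local Open Scope classical_set_scope.
Local Open Scope ring_scope.

(** Write [B] for the scalar product of [H^1(R)] and take [(f, g)] and [(h, k)]
    in the relation. Testing the equation of [f] with [k1] formally gives
    [B(f1, k1) = int g1 k1 domega + int g2 k1 dupsilon]. Exchanging the two pairs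
    leaves the integral against [omega] unchanged, and as [f2 = g1] and [h2 = k1]
    almost everywhere, the difference of the two formulas says that [<f, k>] and
    [<g, h>] agree for real functions. Two points need care.
    The equation is given for smooth test functions only; [weak_eq_sobolev]
    extends it to compactly supported functions of Sobolev class through the
    lemma of du Bois-Reymond, by which [f1'] is almost everywhere a constant
    minus the distribution function of the other terms. Moreover [k1] does not
    have compact support and [g1 k1] need not be integrable against [omega], so
    [weak_eq_symmetric] tests with cutoffs of [k1], cancels the integrals against
    [omega], and removes the cutoffs afterwards.

    Conversely, let [(u, v)] be in the adjoint. For a smooth function [phi] and a
    square integrable function [q], both of bounded support, the measure
    [phi omega + q upsilon] is finite, and its convolution with the Green function
    [exp(-|x|/2)] of [- d^2/dx^2 + 1/4] solves the equation with right-hand side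
    given by [(phi, q)] ([green_represents], [weak_eq_solvable]). This produces
    enough elements of the relation: pairing [(u, v)] with them
    ([adjoint_tested]) yields [u2 = v1] almost everywhere when [phi = 0], and the
    distributional equation for [u1] when [q = 0].

    All of this is done for real functions. A pair is in the relation exactly
    when its real and imaginary parts satisfy the real equation ([Trel_parts]),
    and the complex scalar product expands into four real ones
    ([H_inner_parts]). Elements of [H^1(R)] are given as locally absolutely
    continuous functions in the sense of sums over disjoint intervals; that these
    are the integrals of their derivatives ([ac_primitive]) follows by applying
    the Radon-Nikodym theorem to the Stieltjes measure of the total variation. *)

(** * Absolutely continuous Stieltjes measures *)

Section interval_lists.
Context {R : realType}.
Implicit Types (l : seq (R * R)) (I J : R * R).

Definition apart I J := (I.2 <= J.1) || (J.2 <= I.1).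

Definition proper_itvs l := all (fun I => I.1 <= I.2) l.

Definition total_length l := \sum_(I <- l) (I.2 - I.1).

Definition covered l (x : R) := exists2 I, I \in l & I.1 < x <= I.2.

Lemma apartC I J : apart I J = apart J I.
Proof. by rewrite /apart orbC. Qed.

(** An interval that meets [I] is absorbed into the hull of the two, which is no
    longer than both together; the list gets shorter with each absorption. *)
Lemma merge_interval n l I : (size l <= n)%N ->
  proper_itvs l -> pairwise apart l -> I.1 <= I.2 ->
  exists l', [/\ proper_itvs l', pairwise apart l',
    total_length l' <= I.2 - I.1 + total_length l &
    forall x, covered (I :: l) x -> covered l' x].
Proof.
elim: n l I => [|n IHn] l I.
  rewrite leqn0 => /eqP/size0nil -> _ _ I12; exists [:: I]; split => //=.
  - by rewrite /proper_itvs /= I12.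
  - by rewrite /total_length big_seq1 big_nil addr0.
move=> szl pl al I12.
have [aI|/allPn[J Jl nIJ]] := boolP (all (apart I) l).
  exists (I :: l); split => //=.
  - by rewrite /proper_itvs /= I12.
  - by rewrite aI.
  - by rewrite /total_length big_cons.
have J12 : J.1 <= J.2 by move/allP: pl; apply.
pose H : R * R := (Num.min I.1 J.1, Num.max I.2 J.2).
move: nIJ; rewrite /apart negb_or -!ltNge => /andP[JI IJ].
have pJ := perm_to_rem Jl.
have [||||l' [l1 l2 l3 l4]] := IHn (rem J l) H.
- by rewrite size_rem// -ltnS prednK//; case: (l) Jl.
- by apply/allP => K /mem_rem Kl; move/allP: pl; apply.
- exact: (subseq_pairwise (rem_subseq _ _) al).
- by rewrite /= ge_min le_max I12.
exists l'; split => //.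
  rewrite (le_trans l3)// /total_length (perm_big _ pJ) big_cons addrA lerD2r /=.
  rewrite /Num.max /Num.min; case: ifPn; case: ifPn; rewrite -?leNgt => ? ?; lra.
move=> x [K]; rewrite inE => Kl Kx; apply: l4.
have [K2|/negP KI] := pselect (K \in rem J l).
  by exists K => //; rewrite inE K2 orbT.
exists H; rewrite ?mem_head// /H /= gt_min le_max.
case/orP: Kl => [/eqP <-|]; first by case/andP: Kx => -> ->.
rewrite (perm_mem pJ) inE (negbTE KI) orbF => /eqP <-.
by case/andP: Kx => -> ->; rewrite !orbT.
Qed.

Lemma merge_intervals l : proper_itvs l ->
  exists l', [/\ proper_itvs l', pairwise apart l',
    total_length l' <= total_length l & forall x, covered l x -> covered l' x].
Proof.
elim: l => [|I l IHl] /=; first by move=> _; exists [::].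
move=> /andP[I12 /IHl[l' [l1 l2 l3 l4]]].
have [l'' [k1 k2 k3 k4]] := merge_interval (leqnn _) l1 l2 I12.
exists l''; split => //.
  by rewrite (le_trans k3)// /total_length big_cons lerD2l.
move=> x [K]; rewrite inE => /orP[/eqP ->|Kl] Kx; apply: k4.
  by exists I; rewrite ?mem_head.
have [|K' K'l K'x] := l4 x; first by exists K.
by exists K' => //; rewrite inE K'l orbT.
Qed.

(** The bound is not strict, so that it survives taking suprema over lists. *)
Definition small_lists (F : R * R -> R) (dom : pred (R * R)) :=
  forall e : R, 0 < e -> exists2 d : R, 0 < d & forall l, proper_itvs l ->
    all dom l -> pairwise apart l -> total_length l < d ->
    \sum_(I <- l) F I <= e.

End interval_lists.

Section stieltjes_dominated.
Context {R : realType} (F : cumulative R R).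
Local Notation mu := (@lebesgue_measure R).
Local Notation muF := (lebesgue_stieltjes_measure F : {measure set (measurableTypeR R) -> \bar R}).

Lemma stieltjes_itv (a b : R) : a <= b ->
  lebesgue_stieltjes_measure F `]a, b] = (F b - F a)%:E.
Proof.
move=> ab; rewrite -(wlength_itv_bnd F false false ab).
exact: (measurable_mu_extE (wlength F) (is_ocitv a b)).
Qed.

Let lists_measure (l : seq (R * R)) : proper_itvs l ->
  (muF (\big[setU/set0]_(I <- l) `]I.1, I.2]%classic) <=
   (\sum_(I <- l) (F I.2 - F I.1))%:E)%E.
Proof.
elim: l => [|I l IHl]; first by rewrite !big_nil measure0.
move=> /= /andP[I12 pl]; rewrite !big_cons EFinD.
apply: le_trans (leeD _ (IHl pl)).
  apply: measureU2 => //.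
  by apply: bigsetU_measurable => J _; exact: measurable_itv.
by rewrite /= stieltjes_itv.
Qed.

(** A null set is covered by intervals of small total length. Merging finitely
    many of them makes them disjoint, and the hypothesis bounds the measure of
    their union. *)
Lemma stieltjes_dominated :
  small_lists (fun I : R * R => F I.2 - F I.1) xpredT -> muF `<< mu.
Proof.
move=> acF; apply/null_content_dominatesP => A mA A0.
apply/eqP; rewrite -measure_le0; apply/lee_addgt0Pr => e e0; rewrite add0e.
have [d d0 dP] := acF _ e0.
have : (mu A < d%:E)%E by rewrite A0 lte_fin.
rewrite /lebesgue_measure /lebesgue_stieltjes_measure /= /measure_extension.
move=> /ereal_inf_lt[_ [B [mB AB] <-]] Bd.
have {mB} /choice[b bB] : forall k, exists I : R * R,
    I.1 <= I.2 /\ B k = `]I.1, I.2]%classic.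
  move=> k; have [[x1 x2] _ /= xB] := mB k.
  have [x12|x21] := leP x1 x2; first by exists (x1, x2).
  by exists (x1, x1); split => //=; rewrite -xB !set_itv_ge//= bnd_simp ?ltxx// -leNgt ltW.
have BE : B = fun k => `](b k).1, (b k).2]%classic.
  by apply/funext => k; case: (bB k).
pose l n := [seq b k | k <- iota 0 n].
have pl n : proper_itvs (l n).
  by apply/allP => I /mapP[k _ ->]; case: (bB k).
have ld n : total_length (l n) < d.
  rewrite -lte_fin; apply: le_lt_trans Bd; rewrite /total_length big_map -sumEFin.
  have -> : iota 0 n = index_iota 0 n by rewrite /index_iota subn0.
  apply: (@le_trans _ _ (\sum_(0 <= k < n) wlength idfun (B k))%E).
    by apply: lee_sum => k _; rewrite BE wlength_itv_bnd//; case: (bB k).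
  by apply: nneseries_lim_ge => k _ _; exact: (wlength_ge0 idfun).
pose U n := \big[setU/set0]_(k < n) B k.
have mBk k : measurable (B k : set (measurableTypeR R)).
  by rewrite BE; exact: measurable_itv.
have mU n : measurable (U n : set (measurableTypeR R)).
  by apply: bigsetU_measurable => k _.
apply: (@le_trans _ _ (muF (\bigcup_n U n))).
  apply: le_measure; rewrite ?inE//; first exact: bigcup_measurable.
  move=> x /AB[k _ Bkx]; exists k.+1 => //.
  by rewrite /U -bigcup_mkord; exists k => //=.
have cvU : (muF \o U) n @[n --> \oo] --> muF (\bigcup_n U n).
  apply: nondecreasing_cvg_mu => //; first exact: bigcup_measurable.
  apply/nondecreasing_seqP => n; rewrite /U big_ord_recr /=.
  by apply/subsetPset; left.
apply: cvge_le cvU; apply: nearW => n /=.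
have [l' [pl' al' tl' cl']] := merge_intervals (pl n).
have /= := dP l' pl' (all_predT _) al' (le_lt_trans tl' (ld n)).
rewrite -lee_fin; apply: le_trans; apply: le_trans (lists_measure pl').
apply: le_measure; rewrite ?inE//.
  by apply: bigsetU_measurable => J _; exact: measurable_itv.
move=> x; rewrite /U -bigcup_mkord => -[k /= kn].
rewrite BE /= in_itv/= => xk.
have [|K Kl Kx] := cl' x.
  by exists (b k) => //; apply/mapP; exists k => //; rewrite mem_iota.
by rewrite -bigcup_seq; exists K => //=; rewrite in_itv.
Qed.

End stieltjes_dominated.

(** * Total variation of absolutely continuous functions *)

Section total_variation_of_ac.
Context {R : realType}.
Implicit Types (l : seq (R * R)) (I J : R * R) (f : R -> R).

Definition inside (a b : R) : pred (R * R) := fun I => (a <= I.1) && (I.2 <= b).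

Definition ac_on (a b : R) f :=
  small_lists (fun I => `|f I.2 - f I.1|) (inside a b).

(** Neighbouring points of a partition, as a list of intervals. *)
Definition steps a (s : seq R) := [seq (x.2, x.1) | x <- zip s (a :: s)].

Lemma steps_cons a x s : steps a (x :: s) = (a, x) :: steps x s.
Proof. by []. Qed.

Lemma steps_inside a b s : itv_partition a b s ->
  proper_itvs (steps a s) /\ all (inside a b) (steps a s).
Proof.
elim: s a => [//|x s IHs] a abs; have xbs := itv_partition_cons abs.
have ax : a < x by case: abs => /= /andP[].
have [h1 h2] := IHs _ xbs.
rewrite steps_cons; split.
  by apply/andP; split; [exact: ltW|exact: h1].
apply/andP; split; first by rewrite /inside/= lexx (itv_partition_le xbs).
apply/allP => I /(allP h2); rewrite /inside => /andP[xI ->].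
by rewrite (le_trans (ltW ax) xI).
Qed.

Lemma steps_apart a b s : itv_partition a b s -> pairwise apart (steps a s).
Proof.
elim: s a => [//|x s IHs] a abs; have xbs := itv_partition_cons abs.
rewrite steps_cons; apply/andP; split; last exact: IHs.
by apply/allP => I /(allP (steps_inside xbs).2) /andP[xI _]; rewrite /apart /= xI.
Qed.

Lemma steps_length a b s : itv_partition a b s -> total_length (steps a s) = b - a.
Proof.
elim: s a => [|x s IHs] a abs.
  by rewrite (itv_partition_nil abs) subrr /total_length big_nil.
rewrite steps_cons /total_length big_cons -/(total_length _) IHs /=.
  ring.
exact: itv_partition_cons abs.
Qed.

Lemma steps_variation a b f s : itv_partition a b s ->
  variation a b f s = \sum_(I <- steps a s) `|f I.2 - f I.1|.
Proof. by move=> abs; rewrite (variation_zip _ abs) big_map. Qed.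

Lemma apart_inside I J K : inside I.1 I.2 K -> apart I J -> apart K J.
Proof.
rewrite /inside /apart => /andP[IK KI] /orP[IJ|JI].
  by rewrite (le_trans KI IJ).
by rewrite (le_trans JI IK) orbT.
Qed.

Lemma total_length_cat l1 l2 : total_length (l1 ++ l2) = total_length l1 + total_length l2.
Proof. by rewrite /total_length big_cat. Qed.

Local Notation TV := total_variation.

(** The intervals of a list are traded one at a time for the steps of a
    partition of the interval, which does not change the total length; taking
    the supremum over the partitions gives the total variation. *)
Let sum_total_variation a b f (d e : R) : 0 <= e ->
  (forall l, proper_itvs l -> all (inside a b) l -> pairwise apart l ->
     total_length l < d -> \sum_(I <- l) `|f I.2 - f I.1| <= e) ->
  forall l2 l1, proper_itvs (l1 ++ l2) -> all (inside a b) (l1 ++ l2) ->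
    pairwise apart (l1 ++ l2) -> total_length (l1 ++ l2) < d ->
    ((\sum_(I <- l1) `|f I.2 - f I.1|)%:E + \sum_(I <- l2) TV I.1 I.2 f <= e%:E)%E.
Proof.
move=> e0 fP; elim=> [|I l2 IHl] l1.
  by rewrite cats0 big_nil adde0 lee_fin; exact: fP.
rewrite /proper_itvs !all_cat /= => /and3P[p1 pI p2] /and3P[i1 iI i2].
rewrite pairwise_cat /= => /and4P[a12 a1 aI a2] ll.
rewrite big_cons addeCA; rewrite allrel_consr in a12; case/andP: a12 => a1I a12.
have tvl : (0 <= \sum_(J <- l2) TV J.1 J.2 f)%E.
  rewrite big_seq; apply: sume_ge0 => J Jl; apply: total_variation_ge0.
  by move/allP: p2; apply.
rewrite total_length_cat /total_length big_cons -!/(total_length _) in ll.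
have fS : (\sum_(J <- l2) TV J.1 J.2 f)%E \is a fin_num.
  rewrite ge0_fin_numE//; apply: (@le_lt_trans _ _ e%:E); last by rewrite ltry.
  have := IHl [::] p2 i2 a2; rewrite big_nil add0e; apply.
  rewrite /= in ll *; apply: le_lt_trans ll.
  rewrite addrA lerDr addr_ge0 ?subr_ge0//.
  rewrite /total_length big_seq sumr_ge0// => J Jl; rewrite subr_ge0.
  by move/allP: p1; apply.
rewrite -leeBrDr ?fin_numD ?fS//; apply: ub_ereal_sup => _ [_ [s Is <-] <-].
rewrite leeBrDr ?fin_numD ?fS// addeA -EFinD [X in (X%:E + _)%E]addrC.
rewrite (steps_variation _ Is) -big_cat.
have [s1 s2] := steps_inside Is.
have s2ab : all (inside a b) (steps I.1 s).
  apply/allP => K /(allP s2); case/andP: iI => aI1 I2b /andP[K1 K2].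
  by rewrite /inside (le_trans aI1 K1) (le_trans K2 I2b).
apply: IHl; rewrite ?/proper_itvs ?all_cat -?/(proper_itvs _).
- by apply/andP; split => //; apply/andP; split.
- by rewrite i1 s2ab.
- rewrite !pairwise_cat allrel_catl a12 a1 a2 (steps_apart Is) /= !andbT.
  apply/andP; split.
    apply/allrelP => K J K2 J2.
    by apply: (apart_inside (allP s2 _ K2)); move/allP: aI; apply.
  apply/allrelP => K J K2 J2; rewrite apartC.
  apply: (apart_inside (allP s2 _ J2)); rewrite apartC.
  by move/allP: a1I => /(_ _ K2).
- by rewrite !total_length_cat (steps_length Is) -addrA.
Qed.

Lemma ac_total_variation a b f (e : R) : ac_on a b f -> 0 < e ->
  exists2 d : R, 0 < d & forall l, proper_itvs l -> all (inside a b) l ->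
    pairwise apart l -> total_length l < d ->
    (\sum_(I <- l) TV I.1 I.2 f <= e%:E)%E.
Proof.
move=> acf e0; have [d d0 dP] := acf _ e0; exists d => // l l1 l2 l3 l4.
have := sum_total_variation (ltW e0) dP (l1 := [::]) l1 l2 l3 l4.
by rewrite big_nil add0e.
Qed.

(** Short intervals have variation at most one, and finitely many of them cover
    the interval from [x] to [y]. *)
Lemma ac_total_variation_fin a b f x y : ac_on a b f -> a <= x -> x <= y ->
  y <= b -> TV x y f \is a fin_num.
Proof.
move=> acf ax; have [d d0 dP] := ac_total_variation acf ltr01.
have d20 : 0 < d / 2 by rewrite divr_gt0.
have small u v : a <= u -> u <= v -> v <= b -> v - u <= d / 2 -> (TV u v f < +oo)%E.
  move=> au uv vb vu; apply: (@le_lt_trans _ _ 1%:E); last by rewrite ltry.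
  have := dP [:: (u, v)]; rewrite /total_length !big_seq1; apply => //=.
  - by rewrite /proper_itvs/= uv.
  - by rewrite /inside/= au vb.
  - by rewrite (le_lt_trans vu)// ltr_pdivrMr// ltr_pMr// ltr1n.
have main n z : x <= z -> z <= b -> z - x <= n%:R * (d / 2) -> (TV x z f < +oo)%E.
  elim: n z => [|n IHn] z xz zb; first by rewrite mul0r => h; apply: small; lra.
  rewrite -natr1 => h; pose c := Num.max x (z - d / 2).
  have xc : x <= c by rewrite le_max lexx.
  have cz : c <= z by rewrite ge_max xz lerBlDr lerDl ltW.
  rewrite (total_variationD f xc cz) lte_add_pinfty//.
    apply: IHn => //; first exact: le_trans zb.
    have [xz'|zx'] := leP x (z - d / 2).
      by rewrite /c (max_r xz'); rewrite mulrDl mul1r in h; lra.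
    by rewrite /c (max_l (ltW zx')) subrr mulr_ge0// ltW.
  apply: small => //; first exact: le_trans ax xc.
  rewrite lerBlDr -lerBlDl; rewrite /c le_max lexx orbT //.
move=> xy yb; rewrite ge0_fin_numE ?total_variation_ge0//.
have [n nP] : exists n, (y - x) / (d / 2) <= n%:R :> R.
  by exists (Num.truncn ((y - x) / (d / 2))).+1; exact/ltW/truncnS_gt.
by apply: (main n) => //; rewrite -ler_pdivrMr.
Qed.

End total_variation_of_ac.

(** * Densities of absolutely continuous functions *)

Section density.
Context {R : realType}.
Local Notation mu := (@lebesgue_measure R).

(** This is the Radon-Nikodym theorem for the Stieltjes measure, restricted to
    the interval to make it finite. *)
Lemma stieltjes_density (F : cumulative R R) (a b : R) : a <= b ->
  small_lists (fun I : R * R => F I.2 - F I.1) xpredT ->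
  exists rho : R -> R, [/\ measurable_fun setT rho,
    mu.-integrable setT (EFin \o rho) &
    forall x y, a <= x -> x <= y -> y <= b ->
      F y - F x = \int[mu]_(t in `]x, y]) rho t].
Proof.
move=> ab /stieltjes_dominated dF.
pose muF : {measure set (measurableTypeR R) -> \bar R} := lebesgue_stieltjes_measure F.
have mab : measurable (`]a, b]%classic : set (measurableTypeR R)) by exact: measurable_itv.
have muFoo : (muF `]a, b]%classic < +oo)%E by rewrite /muF/= stieltjes_itv// ltry.
pose nu : {finite_measure set (measurableTypeR R) -> \bar R} := mfrestr mab muFoo.
have numu : nu `<< mu.
  apply/null_content_dominatesP => A mA A0; rewrite /nu /= /mfrestr /mrestr.
  move/null_content_dominatesP : dF; apply; first exact: measurableI.
  by apply/eqP; rewrite -measure_le0 -A0 le_measure ?inE//; exact: measurableI.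
have [g [g0 gfin gint gE]] := radon_nikodym_sigma_finite numu.
exists (fine \o g); have gg : EFin \o (fine \o g) = g.
  by apply/funext => x /=; rewrite fineK.
split.
- by apply/measurable_EFinP; rewrite gg; exact: measurable_int gint.
- by rewrite gg.
move=> x y ax xy yb; apply: EFin_inj; rewrite -stieltjes_itv//.
transitivity (nu `]x, y]%classic).
  rewrite /nu /= /mfrestr /mrestr setIidl// => z /=; rewrite !in_itv /= => /andP[xz zy].
  by rewrite (le_lt_trans ax xz) (le_trans zy yb).
rewrite gE; last exact: measurable_itv.
rewrite /Rintegral fineK; last first.
  by rewrite [X in integral _ _ X]gg; apply: integrable_fin_num => //; exact: integrableS gint.
by apply: eq_integral => z _; rewrite -[in LHS]gg.
Qed.

End density.

Section ac_density.
Context {R : realType}.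
Local Notation mu := (@lebesgue_measure R).
Local Notation TV := total_variation.
Variables (a b : R) (f : R -> R).
Hypotheses (ab : a <= b) (acf : ac_on a b f).

(** Freezing the functions outside the interval yields cumulative functions on
    the whole line. *)
Let clamp x := Num.min b (Num.max a x).

Let clamp_in x : a <= clamp x <= b.
Proof. by rewrite /clamp le_min ab le_max lexx ge_min lexx. Qed.

Let clamp_nd x y : x <= y -> clamp x <= clamp y.
Proof.
move=> xy; rewrite /clamp le_min ge_min lexx /= ge_min ge_max !le_max lexx /= xy.
by rewrite orbT orbT.
Qed.

Let clamp_lip x y : x <= y -> clamp y - clamp x <= y - x.
Proof.
move=> xy; rewrite /clamp /Num.min /Num.max.
by repeat case: ifPn; rewrite -?leNgt => *; lra.
Qed.

Let clamp_id x : a <= x -> x <= b -> clamp x = x.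
Proof. by move=> ax xb; rewrite /clamp max_r// min_r. Qed.

Let V x := fine (TV a (clamp x) f).

Let VB x y : x <= y -> V y - V x = fine (TV (clamp x) (clamp y) f).
Proof.
move=> xy; have /andP[ax xb] := clamp_in x; have /andP[ay yb] := clamp_in y.
have cxy := clamp_nd xy.
rewrite /V (total_variationD f ax cxy) fineD ?(ac_total_variation_fin acf)//.
by rewrite addrC addKr.
Qed.

Let V_incr x y : x <= y -> `|f (clamp y) - f (clamp x)| <= V y - V x.
Proof.
move=> xy; rewrite VB//; have /andP[ax xb] := clamp_in x.
have /andP[ay yb] := clamp_in y; have cxy := clamp_nd xy.
by rewrite -lee_fin fineK ?(ac_total_variation_fin acf)// total_variation_ge.
Qed.

Let V_small (e : R) : 0 < e ->
  exists2 d : R, 0 < d & forall l, proper_itvs l -> pairwise apart l ->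
    total_length l < d -> \sum_(I <- l) (V I.2 - V I.1) <= e.
Proof.
move=> e0; have [d d0 dP] := ac_total_variation acf e0; exists d => // l pl al ld.
pose l' := [seq (clamp K.1, clamp K.2) | K <- l].
have := dP l'; rewrite big_map => h.
have : (\sum_(I <- l) TV (clamp I.1) (clamp I.2) f <= e%:E)%E.
  apply: h => //.
  - by apply/allP => _ /mapP[I Il ->] /=; apply: clamp_nd; move/allP: pl; apply.
  - apply/allP => _ /mapP[I Il ->]; rewrite /inside /=.
    by have /andP[-> _] := clamp_in I.1; have /andP[_ ->] := clamp_in I.2.
  - rewrite pairwise_map; apply: sub_pairwise al => I J /= /orP[]/clamp_nd h'.
      by rewrite /apart /= h'.
    by rewrite /apart /= h' orbT.
  - apply: le_lt_trans ld; rewrite /total_length big_map big_seq [leRHS]big_seq.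
    by apply: ler_sum => I Il; apply: clamp_lip; move/allP: pl; apply.
rewrite -lee_fin -sumEFin big_seq => h'; rewrite big_seq; apply: le_trans h'.
apply: lee_sum => I Il; have I12 : I.1 <= I.2 by move/allP: pl; apply.
rewrite VB// fineK//; have /andP[? ?] := clamp_in I.1.
by have /andP[? ?] := clamp_in I.2; apply: (ac_total_variation_fin acf) => //; exact: clamp_nd.
Qed.

(** Meant for [V] and for [V - f \o clamp], whose difference is [f] on the
    interval. *)
Let controlled_density (W : R -> R) :
  (forall x y, x <= y -> 0 <= W y - W x <= 2 * (V y - V x)) ->
  exists rho : R -> R, [/\ measurable_fun setT rho,
    mu.-integrable setT (EFin \o rho) &
    forall x y, a <= x -> x <= y -> y <= b ->
      W y - W x = \int[mu]_(t in `]x, y]) rho t].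
Proof.
move=> WP.
have Wnd : {homo W : x y / x <= y} by move=> x y /WP/andP[]; rewrite subr_ge0.
have Wsmall : small_lists (fun I : R * R => W I.2 - W I.1) xpredT.
  move=> e e0; have [d d0 dP] := V_small (divr_gt0 e0 (ltr0n R 2)).
  exists d => // l pl _ al ld; have := dP l pl al ld.
  rewrite ler_pdivlMr// mulr_suml; apply: le_trans.
  rewrite big_seq [leRHS]big_seq; apply: ler_sum => I Il.
  have I12 : I.1 <= I.2 by move/allP: pl; apply.
  by have /andP[_] := WP _ _ I12; rewrite mulrC.
have Wrc : right_continuous W.
  move=> x; apply/cvgrPdist_le => e e0; have [d d0 dP] := Wsmall _ e0.
  near=> y; have xy : x <= y by near: y; exact: nbhs_right_ge.
  rewrite distrC ger0_norm ?subr_ge0 ?Wnd//.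
  have := dP [:: (x, y)]; rewrite /total_length !big_seq1; apply => //=.
  - by rewrite /proper_itvs/= xy.
  - rewrite ltrBlDl; near: y; apply: nbhs_right_lt; by rewrite ltrDl.
pose isC := isCumulative.Build R _ R W Wnd Wrc.
pose F : cumulative R R := HB.pack W isC.
exact: (@stieltjes_density _ F).
Unshelve. all: by end_near. Qed.

(** Jordan decomposition: [f] is the difference of the monotone functions [V]
    and [V - f]. *)
Lemma ac_density : exists rho : R -> R, [/\ measurable_fun setT rho,
    mu.-integrable setT (EFin \o rho) &
    forall x y, a <= x -> x <= y -> y <= b ->
      f y - f x = \int[mu]_(t in `]x, y]) rho t].
Proof.
have [|r1 [m1 i1 E1]] := @controlled_density V.
  move=> x y xy; have h : 0 <= V y - V x by apply: le_trans (V_incr xy).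
  by apply/andP; split => //; lra.
have [|r2 [m2 i2 E2]] := @controlled_density (fun x => V x - f (clamp x)).
  move=> x y xy; have := V_incr xy; rewrite ler_norml => /andP[h1 h2].
  by apply/andP; split; lra.
exists (r1 \- r2); split.
- exact: measurable_funB.
- by apply: (integrableB measurableT i1 i2).
move=> x y ax xy yb.
have mI : measurable (`]x, y]%classic : set (measurableTypeR R)) by exact: measurable_itv.
rewrite RintegralB//; last 2 first.
  exact: integrableS i1.
  exact: integrableS i2.
rewrite -E1// -E2// !clamp_id//; first ring; first exact: le_trans yb.
exact: le_trans xy.
Qed.

End ac_density.

(** * Integrals of real functions *)

Section real_integral.
Context d (T : measurableType d) (R : realType) (m : {measure set T -> \bar R}).
Implicit Types f g : T -> R.

Definition integ f := m.-integrable setT (EFin \o f).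

Lemma integ_measurable f : integ f -> measurable_fun setT f.
Proof. by move/integrableP => [/measurable_EFinP]. Qed.

Lemma integD f g : integ f -> integ g -> integ (fun x => f x + g x).
Proof. by move=> fi gi; apply: (integrableD measurableT fi gi). Qed.

Lemma integN f : integ f -> integ (fun x => - f x).
Proof. by move=> fi; apply: (integrableN fi). Qed.

Lemma integB f g : integ f -> integ g -> integ (fun x => f x - g x).
Proof. by move=> fi gi; apply: integD => //; exact: integN. Qed.

Lemma integZ (r : R) f : integ f -> integ (fun x => r * f x).
Proof. by move=> fi; apply: (integrableZl measurableT r fi). Qed.

Lemma integ_le f g : measurable_fun setT f -> (forall x, `|f x| <= g x) ->
  integ g -> integ f.
Proof.
move=> mf fg; apply: le_integrable => //; first exact/measurable_EFinP.
by move=> x _ /=; rewrite lee_fin (le_trans (fg x))// ler_norm.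
Qed.

Lemma integ_norm f : integ f -> integ (fun x => `|f x|).
Proof. by move=> fi; apply: (integrable_abse fi). Qed.

Lemma integMb (C : R) f g : measurable_fun setT f -> (forall x, `|f x| <= C) ->
  integ g -> integ (fun x => f x * g x).
Proof.
move=> mf fC gi; apply: (@integ_le _ (fun x => C * `|g x|)).
- by apply: measurable_funM => //; exact: integ_measurable.
- by move=> x; rewrite normrM ler_wpM2r.
- by apply: integZ; exact: integ_norm.
Qed.

Lemma integ_sqr_mul f g : measurable_fun setT f -> measurable_fun setT g ->
  integ (fun x => f x ^+ 2) -> integ (fun x => g x ^+ 2) ->
  integ (fun x => f x * g x).
Proof.
move=> mf mg f2 g2; apply: (integ_le _ _ (integD f2 g2)).
  exact: measurable_funM.
move=> x; rewrite ler_norml; apply/andP; split; nra.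
Qed.

Lemma ae_eq_Rint f g : measurable_fun setT f -> measurable_fun setT g ->
  {ae m, forall x, f x = g x} -> \int[m]_x f x = \int[m]_x g x.
Proof.
move=> mf mg fg; rewrite /Rintegral; congr fine; apply: ae_eq_integral => //.
- exact/measurable_EFinP.
- exact/measurable_EFinP.
- by apply: filterS fg => x + _ => <-.
Qed.

Lemma ae_eq_integ f g : measurable_fun setT f -> measurable_fun setT g ->
  {ae m, forall x, f x = g x} -> integ f -> integ g.
Proof.
move=> mf mg fg /integrableP[_ fi]; apply/integrableP; split.
  exact/measurable_EFinP.
apply: le_lt_trans fi; apply: ae_ge0_le_integral => //.
- by apply: measurableT_comp => //; exact/measurable_EFinP.
- by apply: measurableT_comp => //; exact/measurable_EFinP.
- by apply: filterS fg => x /= + _ => ->.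
Qed.

Lemma RintD f g : integ f -> integ g ->
  \int[m]_x (f x + g x) = \int[m]_x f x + \int[m]_x g x.
Proof. by move=> fi gi; rewrite RintegralD. Qed.

Lemma RintB f g : integ f -> integ g ->
  \int[m]_x (f x - g x) = \int[m]_x f x - \int[m]_x g x.
Proof. by move=> fi gi; rewrite RintegralB. Qed.

Lemma RintZ (r : R) f : integ f -> \int[m]_x (r * f x) = r * \int[m]_x f x.
Proof. by move=> fi; rewrite RintegralZl. Qed.

Lemma dominated_Rint (f_ : nat -> T -> R) f g :
  (forall n, measurable_fun setT (f_ n)) -> integ g ->
  (forall n x, `|f_ n x| <= g x) ->
  {ae m, forall x, f_ n x @[n --> \oo] --> f x} -> measurable_fun setT f ->
  \int[m]_x f_ n x @[n --> \oo] --> \int[m]_x f x.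
Proof.
move=> mf_ gi fg cvf mf.
have [] := @dominated_convergence _ T R m setT measurableT
  (fun n => EFin \o f_ n) (EFin \o f) (EFin \o g).
- by move=> n; exact/measurable_EFinP.
- exact/measurable_EFinP.
- by apply: filterS cvf => x cx _; apply: cvg_EFin => //; exact: nearW.
- exact: gi.
- by apply: aeW => x n _ /=; rewrite lee_fin.
move=> fi _ cv; apply: fine_cvg => /=; rewrite [X in _ --> X]fineK; first exact: cv.
exact: integrable_fin_num.
Qed.

End real_integral.

Section swap.
Context d1 d2 (T1 : measurableType d1) (T2 : measurableType d2) (R : realType).
Variables (m1 : {sigma_finite_measure set T1 -> \bar R})
          (m2 : {sigma_finite_measure set T2 -> \bar R}).
Variables (K : T1 * T2 -> R) (C : R) (p : T1 -> R) (e : T2 -> R).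
Hypotheses (mK : measurable_fun setT K) (KC : forall z, `|K z| <= C).
Hypotheses (pi : integ m1 p) (ei : integ m2 e).

Let mK1 s : measurable_fun setT (fun y => K (s, y)).
Proof. exact: (measurableT_comp mK (measurable_pair1 s)). Qed.

Let mK2 y : measurable_fun setT (fun s => K (s, y)).
Proof. exact: (measurableT_comp mK (measurable_pair2 y)). Qed.

Let F (z : T1 * T2) := p z.1 * (K z * e z.2).

Let mF : measurable_fun setT F.
Proof.
apply: measurable_funM; first exact: (measurableT_comp (integ_measurable pi) measurable_fst).
apply: measurable_funM => //.
exact: (measurableT_comp (integ_measurable ei) measurable_snd).
Qed.

Let Fi : (m1 \x m2)%E.-integrable setT (EFin \o F).
Proof.
have mEF : measurable_fun setT (EFin \o F) by exact/measurable_EFinP.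
apply/(integrable12ltyP m1 m2 mEF).
have /integrableP[_ p1] := pi; have e1 := integ_norm ei.
apply: (@le_lt_trans _ _ (\int[m1]_x (`|C * \int[m2]_y `|e y| |%:E * `|(p x)%:E|))%E).
  apply: ge0_le_integral => //.
  - by move=> x _; exact: integral_ge0.
  - apply: (@measurable_fun_fubini_tonelli_F _ _ _ _ _ m2 (abse \o (EFin \o F))).
      exact: measurableT_comp.
    by move=> x; rewrite /= lee_fin.
  - apply: measurable_funeM; apply: measurableT_comp => //.
    by apply/measurable_EFinP; exact: integ_measurable pi.
  move=> x _.
  apply: (@le_trans _ _ (\int[m2]_y (`|p x| * C * `|e y|)%:E)%E).
    apply: ge0_le_integral => //.
    - apply: measurableT_comp => //; apply/measurable_EFinP.
      exact: (measurableT_comp mF (measurable_pair1 x)).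
    - by apply/measurable_EFinP; apply: measurable_funM => //; exact: integ_measurable e1.
    - move=> y _; rewrite lee_fin /F /= !normrM -mulrA ler_wpM2l// ler_wpM2r//.
  have -> : (\int[m2]_y (`|p x| * C * `|e y|)%:E = (`|p x| * C * \int[m2]_y `|e y|)%:E)%E.
    rewrite -RintZ// fineK//; apply: integrable_fin_num => //.
    by have := integZ (`|p x| * C) e1.
  rewrite (_ : `|(p x)%:E|%E = `|p x|%:E)// -EFinM lee_fin -mulrA mulrC.
  by rewrite ler_wpM2r// ler_norm.
rewrite ge0_integralZl//; last first.
  apply: measurableT_comp => //.
  by apply/measurable_EFinP; exact: integ_measurable pi.
by rewrite lte_mul_pinfty// ltry.
Qed.

(** Fubini applies because [K] is bounded. *)
Lemma Rint_swap : \int[m1]_s (p s * \int[m2]_y (K (s, y) * e y)) =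
  \int[m2]_y (e y * \int[m1]_s (K (s, y) * p s)).
Proof.
have -> : \int[m1]_s (p s * \int[m2]_y (K (s, y) * e y)) =
    fine (\int[m1]_s \int[m2]_y (EFin \o F) (s, y))%E.
  congr fine; apply: eq_integral => s _.
  have Ke : integ m2 (fun y => K (s, y) * e y) by exact: (integMb (mK1 s) (fun y => KC (s, y)) ei).
  by rewrite -RintZ// /Rintegral fineK//; apply: integrable_fin_num => //; exact: integZ.
rewrite (Fubini Fi); congr fine; apply: eq_integral => y _.
have Kp : integ m1 (fun s => K (s, y) * p s) by exact: (integMb (mK2 y) (fun s => KC (s, y)) pi).
rewrite -RintZ// /Rintegral fineK//; last by apply: integrable_fin_num => //; exact: integZ.
by apply: eq_integral => s _; rewrite /F /=; congr EFin; ring.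
Qed.

Lemma measurable_Rint : measurable_fun setT (fun y => \int[m1]_s (K (s, y) * p s)).
Proof.
have mG : measurable_fun setT (fun z : T1 * T2 => (K z * p z.1)%:E).
  apply/measurable_EFinP; apply: measurable_funM => //.
  exact: (measurableT_comp (integ_measurable pi) measurable_fst).
pose g (z : T1 * T2) := (K z * p z.1)%:E.
have mp : measurable_fun setT (fubini_G m1 g^\+%E).
  by apply: measurable_fun_fubini_tonelli_G => //; exact: measurable_funepos.
have mn : measurable_fun setT (fubini_G m1 g^\-%E).
  by apply: measurable_fun_fubini_tonelli_G => //; exact: measurable_funeneg.
apply: (measurableT_comp (@fine_measurable R setT measurableT)).
rewrite [X in measurable_fun _ X](_ : _ = (fubini_G m1 g^\+ \- fubini_G m1 g^\-)%E).
  exact: emeasurable_funB.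
apply/funext => y; rewrite integralE; congr (_ - _)%E; apply: eq_integral => s _.
  by rewrite !funeposE.
by rewrite !funenegE.
Qed.

End swap.

(** * Primitives *)

Section primitives.
Context {R : realType}.
Local Notation mu := (@lebesgue_measure R).
Local Notation borel := (measurableTypeR R).
Implicit Types (u v d e : R -> R).

Definition ind (D : set borel) (x : borel) : R := \1_D x.

Definition oc (a b : R) : set borel := `]a, b]%classic.

(** A locally absolutely continuous function together with a representative of
    its derivative, which matters only up to null sets. *)
Definition primitive u d :=
  [/\ measurable_fun setT (d : borel -> R),
      forall a b, mu.-integrable (oc a b) (EFin \o d) &
      forall a b, a <= b -> u b - u a = \int[mu]_(t in oc a b) d t].

Lemma indE D x : ind D x = (x \in D)%:R.
Proof. by rewrite /ind indicE. Qed.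

Lemma Rint_indic (m : {measure set borel -> \bar R}) (D : set borel) (f : borel -> R) :
  \int[m]_(x in D) f x = \int[m]_x (ind D x * f x).
Proof.
rewrite Rintegral_mkcond; congr Rintegral; apply/funext => x.
by rewrite patch_indic /= mulrC /ind.
Qed.

Lemma integ_indic (m : {measure set borel -> \bar R}) (D : set borel) (f : borel -> R) :
  measurable D ->
  m.-integrable D (EFin \o f) <-> integ m (fun x => ind D x * f x).
Proof.
move=> mD; apply: (iff_trans (integrable_mkcond _ mD)); rewrite /integ.
suff -> : (EFin \o f) \_ D = EFin \o (fun x => ind D x * f x) by [].
by apply/funext => x; rewrite /patch /= indE; case: ifP; rewrite ?mul1r ?mul0r.
Qed.

Lemma oc_measurable (a b : R) : measurable (oc a b).
Proof. exact: measurable_itv. Qed.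

Lemma ind_oc_measurable (a b : R) : measurable_fun setT (ind (oc a b)).
Proof. by apply: measurable_indic; exact: oc_measurable. Qed.

#[local] Hint Resolve oc_measurable ind_oc_measurable : core.

Lemma indic_oc (a b x : R) : ind (oc a b) x = (a < x <= b)%R%:R :> R.
Proof. by rewrite indE mem_setE in_itv. Qed.

Lemma indic_bound (D : set R) x : `|ind D x| <= 1 :> R.
Proof. by rewrite indE; case: (_ \in _); rewrite ?normr1 ?normr0. Qed.

Lemma primitive_integ u d a b : primitive u d ->
  integ mu (fun x => ind (oc a b) x * d x).
Proof. by move=> [_ di _]; exact/(@integ_indic mu (oc a b) d (oc_measurable a b)). Qed.

Lemma primitive_int u d a b : primitive u d -> a <= b ->
  \int[mu]_x (ind (oc a b) x * d x) = u b - u a.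
Proof. by move=> [_ _ dE] ab; rewrite -Rint_indic dE. Qed.

Lemma primitiveD u d v e : primitive u d -> primitive v e ->
  primitive (fun x => u x + v x) (fun x => d x + e x).
Proof.
move=> [md di dE] [me ei eE]; split.
- exact: measurable_funD.
- by move=> a b; apply: (integrableD _ (di a b) (ei a b)).
- by move=> a b ab; rewrite RintegralD// -dE// -eE//; ring.
Qed.

Lemma primitiveZ (r : R) u d : primitive u d ->
  primitive (fun x => r * u x) (fun x => r * d x).
Proof.
move=> [md di dE]; split.
- exact: measurable_funM.
- by move=> a b; apply: (integrableZl _ r (di a b)).
- by move=> a b ab; rewrite RintegralZl// -dE//; ring.
Qed.

Lemma primitive_continuous u d : primitive u d -> continuous u.
Proof.
move=> [md di dE] x; pose a := x - 1; pose b := x + 1.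
have ab : a <= b by rewrite /a /b; lra.
have di' : mu.-integrable `[a, b] (EFin \o d).
  apply: (integrableS _ _ _ (di (a - 1) b)) => // y; rewrite /oc /= !in_itv /= => /andP[ay ->].
  by rewrite andbT; lra.
have := parameterized_integral_continuous ab di'.
rewrite continuous_within_itvP; last by rewrite /a /b; lra.
move=> [h _ _].
have xab : x \in `]a, b[ by rewrite in_itv /= /a /b; apply/andP; split; lra.
have {h} h := h x xab.
have cvu : u a + parameterized_integral mu a y d @[y --> x] -->
    u a + parameterized_integral mu a x d by apply: cvgD => //; exact: cvg_cst.
have uE y : a <= y -> u y = u a + parameterized_integral mu a y d.
  move=> ay; rewrite /parameterized_integral -Rintegral_itv_obnd_cbnd; last exact: di.
  by rewrite -/(oc a y) -dE// addrC subrK.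
rewrite /continuous_at uE; last by rewrite /a; lra.
apply: cvg_trans cvu; apply: near_eq_cvg; near=> y; rewrite -uE//.
by apply/ltW; near: y; apply: lt_nbhsr; rewrite /a; lra.
Unshelve. all: by end_near. Qed.

Lemma primitive_C1 u d : (forall x : R, is_derive x 1 u (d x)) -> continuous d ->
  primitive u d.
Proof.
move=> ud cd.
have cdi a b : mu.-integrable `[a, b] (EFin \o d).
  apply: continuous_compact_integrable; first exact: segment_compact.
  by move=> x; apply: continuous_subspaceT => y; exact: cd.
have cdi' a b : mu.-integrable (oc a b) (EFin \o d).
  by apply: (integrableS _ _ _ (cdi a b)) => // x; exact: subset_itv_oc_cc.
split => //.
  exact: continuous_measurable_fun.
move=> a b; rewrite le_eqVlt => /predU1P[->|ab].
  by rewrite subrr /oc set_itv_ge ?bnd_simp ?ltxx// Rintegral_set0.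
rewrite Rintegral_itv_obnd_cbnd; last exact: cdi'.
rewrite /Rintegral (@continuous_FTC2 _ d u)//.
- by apply: continuous_subspaceT => x; exact: cd.
- have cu x : {for x, continuous u}.
    by apply/differentiable_continuous/derivable1_diffP; case: (ud x).
  split.
  + by move=> x _; case: (ud x).
  + by apply: cvg_at_right_filter; exact: cu.
  + by apply: cvg_at_left_filter; exact: cu.
- by move=> x _; rewrite derive1E; case: (ud x) => _ ->.
Qed.

(** Lebesgue differentiation of the indefinite integral. *)
Lemma primitive_derive_local u (rho : R -> R) a b :
  mu.-integrable setT (EFin \o rho) ->
  (forall x, a <= x -> x <= b -> u x - u a = \int[mu]_(t in oc a x) rho t) ->
  {ae mu, forall x : borel, a < x < b -> derive1 u x = rho x}.
Proof.
move=> rhoi uE.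
have rhoi' y : mu.-integrable [set` Interval (BRight a) (BRight y)] (EFin \o rho).
  exact: (integrableS _ _ _ rhoi).
have rhol : locally_integrable [set: R] rho.
  by apply: open_integrable_locally => //; exact: openT.
have := FTC1 rhoi' rhol; apply: filterS; first exact: (ae_filter_ringOfSetsType mu).
move=> x Fx /andP[ax xb]; have [|dF <-] := Fx; first by rewrite lte_fin.
rewrite !derive1E; transitivity ('D_1 (fun y : R => u a + (\int[mu]_(t in oc a y) rho t)) x).
  apply: near_eq_derive; near=> y; rewrite -uE; first by rewrite addrC subrK.
    by apply/ltW; near: y; exact: lt_nbhsr.
  by apply/ltW; near: y; exact: lt_nbhsl.
by rewrite deriveD// derive_cst add0r.
Unshelve. all: by end_near. Qed.

Let cover (P : R -> Prop) :
  (forall n : nat, {ae mu, forall x : borel, ((- n%:R : R) < x < n%:R) -> P x}) ->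
  {ae mu, forall x : borel, P x}.
Proof.
move=> /ae_foralln; apply: filterS => x h.
apply: (h (Num.truncn `|x|).+1); rewrite -ltr_norml.
exact: truncnS_gt.
Qed.

Lemma primitive_derive u d : primitive u d -> {ae mu, forall x : borel, derive1 u x = d x}.
Proof.
move=> ud; have [md di dE] := ud; apply: cover => n.
pose D : set R := oc (- n%:R) n%:R.
have : mu.-integrable setT (EFin \o (fun x => ind D x * d x)).
  exact: primitive_integ ud.
move=> /(@primitive_derive_local u _ (- n%:R) n%:R) h.
have /h : forall x, - n%:R <= x -> x <= n%:R ->
    u x - u (- n%:R) = \int[mu]_(t in oc (- n%:R) x) (ind D t * d t).
  move=> x nx xn; rewrite dE//; apply: eq_Rintegral => t.
  rewrite mem_setE in_itv /= => /andP[nt tx].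
  by rewrite indic_oc nt (le_trans tx xn) mul1r.
apply: filterS => x hx /[dup] /andP[n1 n2] /hx ->.
by rewrite indic_oc n1 (ltW n2) mul1r.
Qed.

(** On each window the density coincides almost everywhere with the derivative,
    so that the derivative itself is a density on all windows at once. *)
Lemma ac_primitive u : (forall a b, ac_on a b u) ->
  measurable_fun setT (derive1 u : borel -> R) -> primitive u (derive1 u).
Proof.
move=> acu mu'.
have loc n : exists rho : R -> R, [/\ measurable_fun setT (rho : borel -> R),
    mu.-integrable setT (EFin \o rho),
    (forall x y, - n%:R <= x -> x <= y -> y <= n%:R ->
      u y - u x = \int[mu]_(t in oc x y) rho t) &
    {ae mu, forall x : borel, ((- n%:R : R) < x < n%:R) -> derive1 u x = rho x}].
  have [|rho [m1 m2 m3]] := ac_density _ (acu (- n%:R) n%:R).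
    by rewrite (@le_trans _ _ 0)// oppr_le0.
  exists rho; split => //; apply: primitive_derive_local => // x x1 x2.
  by apply: m3.
have big (a b : R) : exists n : nat, - n%:R < a /\ b < n%:R :> R.
  exists (Num.truncn (Num.max `|a| `|b|)).+1.
  have := truncnS_gt (Num.max `|a| `|b|); rewrite gt_max => /andP[].
  by rewrite !ltr_norml => /andP[? ?] /andP[? ?].
have eqae (a b : R) n (rho : R -> R) : - n%:R < a -> b < n%:R ->
    {ae mu, forall x : borel, ((- n%:R : R) < x < n%:R) -> derive1 u x = rho x} ->
    {ae mu, forall x : borel, x \in oc a b -> derive1 u x = rho x}.
  move=> na bn; apply: filterS => x h; rewrite mem_setE in_itv /= => /andP[ax xb].
  by apply: h; rewrite (lt_trans na ax) (le_lt_trans xb bn).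
split => //.
- move=> a b; have [n [na bn]] := big a b; have [rho [m1 m2 m3 /(eqae _ _ _ _ na bn) m4]] := loc n.
  apply/(@integ_indic mu _ _ (oc_measurable a b)); apply: (ae_eq_integ (f := fun x => ind (oc a b) x * rho x)).
  + exact: measurable_funM.
  + exact: measurable_funM.
  + apply: filterS m4 => x h; rewrite indE.
    by have [/h ->|] := boolP (x \in _); rewrite ?mul0r.
  + by apply/(@integ_indic mu _ _ (oc_measurable a b)); apply: (integrableS _ _ _ m2).
- move=> a b ab; have [n [na bn]] := big a b; have [rho [m1 m2 m3 /(eqae _ _ _ _ na bn) m4]] := loc n.
  rewrite m3 ?(ltW na) ?(ltW bn)// [LHS]Rint_indic [RHS]Rint_indic; apply: ae_eq_Rint.
  + exact: measurable_funM.
  + exact: measurable_funM.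
  + apply: filterS m4 => x h; rewrite indE.
    by have [/h ->|] := boolP (x \in _); rewrite ?mul0r.
Qed.

(** Swapping the integrals in [int p(s) int_s^b e(y) dy dm(s)] is integration
    by parts for a distribution function against an absolutely continuous
    function. *)
Lemma stieltjes_by_parts (m : {sigma_finite_measure set borel -> \bar R})
    (p : borel -> R) v e a b :
  integ m p -> primitive v e -> a <= b ->
  \int[m]_s (ind (oc a b) s * p s * (v b - v s)) =
  \int[mu]_y (ind (oc a b) y * e y * \int[m]_s (ind (oc a y) s * p s)).
Proof.
move=> pi ve ab; have [me ei eE] := ve.
pose K (z : borel * borel) : R := if z.1 <= z.2 then 1 else 0.
have mK : measurable_fun setT K.
  apply: measurable_fun_ifT => //.
  exact: (@measurable_fun_ler _ _ _ setT (fst : borel * borel -> R) snd).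
have KC z : `|K z| <= 1 by rewrite /K; case: ifP; rewrite ?normr1 ?normr0.
have pi' : integ m (fun s => ind (oc a b) s * p s).
  by apply: (@integMb _ _ _ _ 1) => // x; exact: indic_bound.
have ei' := primitive_integ a b ve.
transitivity (\int[m]_s (ind (oc a b) s * p s *
    \int[mu]_y (K (s, y) * (ind (oc a b) y * e y)))).
  apply: eq_Rintegral => s _; rewrite !indic_oc.
  have [/andP[as_ sb]|] := boolP (a < s <= b); last by rewrite !mul0r.
  have -> : v b - v s = \int[mu]_(t in (`[s, b]%classic : set borel)) e t.
    by rewrite eE// /oc Rintegral_itv_obnd_cbnd//; exact: ei.
  congr (_ * _); rewrite [LHS]Rint_indic.
  congr Rintegral; apply/funext => y; rewrite mulrA; congr (_ * _).
  rewrite indic_oc indE mem_setE in_itv /= /K /=.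
  case: (leP s y) => [sy|]; last by rewrite mul0r.
  by rewrite (lt_le_trans as_ sy) mul1r.
rewrite (@Rint_swap _ _ _ _ _ m mu K 1)//.
apply: eq_Rintegral => y _; rewrite !indic_oc.
have [/andP[ay yb]|] := boolP (a < y <= b); last by rewrite !mul0r.
congr (_ * _); congr Rintegral; apply/funext => s; rewrite mulrA; congr (_ * _).
rewrite !indic_oc /K /=; case: (leP s y) => [sy|].
  by rewrite mul1r (le_trans sy yb) andbT.
by rewrite mul0r andbF.
Qed.

Lemma continuous_bounded_itv (w : R -> R) (a b : R) : continuous w ->
  exists M : R, forall x, a <= x <= b -> `|w x| <= M.
Proof.
move=> cw; have [M [_ hM]] : bounded_set (w @` `[a, b]%classic : set R^o).
  apply: (@compact_bounded R R^o).
  apply: continuous_compact; last exact: segment_compact.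
  by apply: continuous_subspaceT => x; exact: cw.
exists (M + 1) => x xab; apply: (hM (M + 1)); first by rewrite ltrDl.
by exists x => //=; rewrite in_itv.
Qed.

(** [stieltjes_by_parts] for the measure with Lebesgue density [d]. *)
Lemma primitive_mul u d v e : primitive u d -> primitive v e ->
  primitive (fun x => u x * v x) (fun x => d x * v x + u x * e x).
Proof.
move=> ud ve; have cu := primitive_continuous ud; have cv := primitive_continuous ve.
have [md di dE] := ud; have [me ei eE] := ve.
have mw (w : R -> R) : continuous w -> measurable_fun setT (w : borel -> R).
  by move=> cw; exact: continuous_measurable_fun.
have mulI (w r z s : R -> R) (a b : R) : primitive w r -> primitive z s ->
    integ mu (fun x => ind (oc a b) x * (r x * z x)).
  move=> wr zs; have cz := primitive_continuous zs; have [M hM] := continuous_bounded_itv a b cz.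
  have ri := primitive_integ a b wr; have [mr _ _] := wr.
  apply: (@integ_le _ _ _ _ _ (fun x => `|M * (ind (oc a b) x * r x)|)).
  - by apply: measurable_funM => //; apply: measurable_funM => //; exact: mw.
  - move=> x; rewrite indic_oc; have [xab|] := boolP (a < x <= b).
      have hx : `|z x| <= M by apply: hM; case/andP: xab => /ltW h1 h2; apply/andP.
      by rewrite !mul1r !normrM mulrC ler_wpM2r// (le_trans hx) ?ler_norm.
    by rewrite !mul0r mulr0.
  - by apply: integ_norm; exact: integZ.
have mulI' (a b : R) : integ mu (fun x => ind (oc a b) x * (u x * e x)).
  have := mulI _ _ _ _ a b ve ud; congr integ; apply/funext => x; congr (_ * _).
  exact: mulrC.
split.
- by apply: measurable_funD; apply: measurable_funM => //; exact: mw.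
- move=> a b; apply/(@integ_indic mu _ _ (oc_measurable a b)).
  have := integD (mulI _ _ _ _ a b ud ve) (mulI' a b); congr integ.
  by apply/funext => x; rewrite mulrDr.
move=> a b ab.
have := stieltjes_by_parts (primitive_integ a b ud) ve ab.
have -> : \int[mu]_s (ind (oc a b) s * (ind (oc a b) s * d s) * (v b - v s)) =
    v b * (u b - u a) - \int[mu]_s (ind (oc a b) s * (d s * v s)).
  have ud' := primitive_integ a b ud.
  rewrite -(primitive_int ud ab) -RintZ// -RintB//; last 2 first.
    exact: integZ.
    exact: (mulI _ _ _ _ _ _ ud ve).
  congr Rintegral; apply/funext => s; rewrite !indic_oc.
  by case: (_ && _); rewrite /=; ring.
have -> : \int[mu]_y (ind (oc a b) y * e y *
    \int[mu]_s (ind (oc a y) s * (ind (oc a b) s * d s))) =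
    \int[mu]_s (ind (oc a b) s * (u s * e s)) - u a * (v b - v a).
  have ve' := primitive_integ a b ve.
  rewrite -(primitive_int ve ab) -RintZ// -RintB; [|exact: mulI'|exact: integZ].
  apply: eq_Rintegral => y _; rewrite !indic_oc.
  have [/andP[ay yb]|] := boolP (a < y <= b); last by move=> _ /=; ring.
  rewrite (_ : \int[mu]_s _ = u y - u a); first by rewrite /=; ring.
  rewrite -(primitive_int ud (ltW ay)); congr Rintegral; apply/funext => s.
  rewrite !indic_oc; have [/andP[as_ sy]|] := boolP (a < s <= y); last by rewrite !mul0r.
  by rewrite as_ (le_trans sy yb) /=; ring.
move=> E; rewrite Rint_indic.
rewrite (_ : (fun x => _ * (_ + _)) = (fun x => ind (oc a b) x * (d x * v x) +
   ind (oc a b) x * (u x * e x))); last by apply/funext => x; rewrite mulrDr.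
rewrite RintD; [|exact: (mulI _ _ _ _ _ _ ud ve)|exact: mulI'].
lra.
Qed.

End primitives.
#[global] Hint Resolve oc_measurable ind_oc_measurable : core.

(** * Smooth steps *)

Section smooth_functions.
Context {R : realType}.
Implicit Types f g : R -> R.

(** The derivative is quantified rather than computed, which makes stability
    under algebraic operations a plain induction. *)
Fixpoint Ck (n : nat) f : Prop :=
  if n is m.+1 then
    exists f' : R -> R, (forall x : R, is_derive x 1 f (f' x)) /\ Ck m f'
  else True.

Definition smooth f := forall n, Ck n f.

Lemma CkS n f : Ck n.+1 f -> Ck n f.
Proof.
elim: n f => [//|n IHn] f [f' [df /IHn cf']].
by exists f'; split.
Qed.

Lemma eq_Ck n f g : f =1 g -> Ck n f -> Ck n g.
Proof. by move=> /funext ->. Qed.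

Lemma Ck_cst n (c : R) : Ck n (fun=> c).
Proof.
elim: n c => [//|n IHn] c; exists (fun=> 0); split; last exact: IHn.
by move=> x; exact: is_derive_cst.
Qed.

Lemma CkD n f g : Ck n f -> Ck n g -> Ck n (fun x => f x + g x).
Proof.
elim: n f g => [//|n IHn] f g [f' [df cf]] [g' [dg cg]].
exists (fun x => f' x + g' x); split; last exact: IHn.
by move=> x; exact: is_deriveD.
Qed.

Lemma CkM n f g : Ck n f -> Ck n g -> Ck n (fun x => f x * g x).
Proof.
elim: n f g => [//|n IHn] f g cf0 cg0.
have [f' [df cf]] := cf0; have [g' [dg cg]] := cg0.
exists (fun x => f x * g' x + g x * f' x); split.
  by move=> x; have := is_deriveM (df x) (dg x).
by apply: CkD; apply: IHn => //; exact: CkS.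
Qed.

Lemma CkV n f : (forall x, f x != 0) -> Ck n f -> Ck n (fun x => (f x)^-1).
Proof.
move=> f0; elim: n => [//|n IHn] cf0; have [f' [df cf]] := cf0.
exists (fun x => (- 1) * (f' x * ((f x)^-1 * (f x)^-1))); split.
  move=> x; have := is_deriveV (f0 x) (df x).
  move=> h; apply: (is_derive_eq h); rewrite scaleNr mulN1r; congr (- _).
  by rewrite -[_ *: _]/(_ * _) -exprVn expr2 mulrC.
have fV := IHn (CkS cf0).
by apply: CkM; [exact: Ck_cst|apply: CkM => //; exact: CkM].
Qed.

Lemma is_derive_affine f (df a b x : R) : is_derive (a * x + b) 1 f df ->
  is_derive x 1 (fun x => f (a * x + b)) (a * df).
Proof.
move=> fd; have h : is_derive x 1 (fun x : R => a * x + b) a.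
  have := is_deriveD (is_deriveZ a (is_derive_id x (1 : R))) (is_derive_cst b x (1 : R)).
  by move=> h; apply: (is_derive_eq h); rewrite addr0 -[_ *: _]/(_ * _) mulr1.
by have := @is_derive1_comp R f (fun y => a * y + b) x _ _ fd h; rewrite mulrC.
Qed.

Lemma Ck_affine n f (a b : R) : Ck n f -> Ck n (fun x => f (a * x + b)).
Proof.
elim: n f => [//|n IHn] f [f' [df cf]].
exists (fun x => a * f' (a * x + b)); split; first by move=> x; exact: is_derive_affine.
by apply: CkM; [exact: Ck_cst|exact: IHn].
Qed.

Lemma Ck_derive1 n f : Ck n.+1 f -> Ck n (derive1 f).
Proof.
move=> [f' [df]]; apply: eq_Ck => x; rewrite derive1E.
by case: (df x) => _ ->.
Qed.

Lemma smooth_derive1 f : smooth f -> smooth (derive1 f).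
Proof. by move=> sf n; apply: Ck_derive1; exact: sf. Qed.

Lemma smooth_derive1n f k : smooth f -> smooth (derive1n k f).
Proof. by elim: k => // k IHk sf; rewrite derive1nS; apply/smooth_derive1/IHk. Qed.

Lemma smooth_derivable f x : smooth f -> derivable f x 1.
Proof. by move=> /(_ 1%N) [f' [df _]]; case: (df x). Qed.

Lemma smooth_is_derive f (x : R) : smooth f -> is_derive x 1 f (derive1 f x).
Proof.
by move=> sf; rewrite derive1E; apply: derivableP; exact: smooth_derivable.
Qed.

Lemma smooth_continuous f : smooth f -> continuous f.
Proof.
by move=> sf x; apply/differentiable_continuous/derivable1_diffP/smooth_derivable.
Qed.

Lemma smooth_primitive f : smooth f -> primitive f (derive1 f).
Proof.
move=> sf; apply: primitive_C1; first by move=> x; exact: smooth_is_derive.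
exact/smooth_continuous/smooth_derive1.
Qed.

(** [flat j] is [x^-j exp(-1/x)] on the positive half-line; the index [j] makes
    the family stable under differentiation up to linear combinations. *)
Definition flat (j : nat) (x : R) : R :=
  if 0 < x then x^-1 ^+ j * expR (- x^-1) else 0.

Lemma flat_ge0 j x : 0 <= flat j x.
Proof.
rewrite /flat; case: ifPn => // x0.
by rewrite mulr_ge0 ?expR_ge0// exprn_ge0// invr_ge0 ltW.
Qed.

(** [exp(1/x)] dominates the term of order [j + 1] of its power series. *)
Lemma flat_le j x : flat j x <= (j.+1)`!%:R * `|x|.
Proof.
rewrite /flat; case: ifPn => [x0|_]; last by rewrite mulr_ge0.
rewrite gtr0_norm// expRN ler_pdivrMr ?expR_gt0//.
have xV : 0 < x^-1 by rewrite invr_gt0.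
have f0 : 0 < (j.+1)`!%:R :> R by rewrite ltr0n fact_gt0.
apply: (@le_trans _ _ (j.+1`!%:R * x * (x^-1 ^+ j.+1 / j.+1`!%:R))).
  rewrite exprS (_ : _ * x * _ = x^-1 ^+ j); first by [].
  by field; rewrite !gt_eqF.
rewrite ler_wpM2l//; first by rewrite mulr_ge0 ?ltW.
by apply: le_trans (expR_ge1Dxn j (ltW xV)); rewrite lerDr.
Qed.

Lemma flat_derive j (x : R) : is_derive x 1 (flat j) (- j%:R * flat j.+1 x + flat j.+2 x).
Proof.
have [x0|x0|x0] := ltgtP x (0 : R).
- have -> : - j%:R * flat j.+1 x + flat j.+2 x = 0.
    by rewrite /flat ltNge (ltW x0) /= mulr0 addr0.
  have h0 : is_derive x 1 (cst (0 : R)) (0 : R) by exact: is_derive_cst.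
  apply: near_eq_is_derive h0.
  near=> y; rewrite /flat ifF//; apply/negbTE; rewrite -leNgt ltW//.
  by near: y; exact: lt_nbhsl.
- have E : is_derive x 1 (fun y : R => y^-1 ^+ j * expR (- y^-1))
      (- j%:R * flat j.+1 x + flat j.+2 x).
    have x0' : x != 0 by rewrite gt_eqF.
    have dV := is_deriveV x0' (is_derive_id x (1 : R)).
    have dX : is_derive x 1 (fun y : R => y^-1 ^+ j) ((j%:R * x^-1 ^+ j.-1) *: ((- x ^- 2) *: 1)).
      rewrite (_ : (fun y : R => y^-1 ^+ j) = GRing.inv ^+ j); first exact: is_deriveX dV.
      by apply/funext => y; rewrite fctE.
    have dE := @is_derive1_comp R expR (fun y => - y^-1) x _ _ (is_derive_expR _) (is_deriveN dV).
    have h : is_derive x 1 (fun y : R => y^-1 ^+ j * expR (- y^-1)) _ := is_deriveM dX dE.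
    apply: (is_derive_eq h).
    rewrite /flat x0 /= -!/(_ * _).
    case: j {h dX} => [|j].
      rewrite /= !expr0 mulr0n ?scale0r ?scaler0.
      rewrite -![_ *: _]/(_ * _); field.
      by [].
    rewrite -![_ *: _]/(_ * _) -pred_Sn -mulr_natl !exprS; field.
    by [].
  apply: near_eq_is_derive E; near=> y; rewrite /flat ifT//.
  by near: y; exact: lt_nbhsr.
- have f0 i : flat i 0 = 0 by rewrite /flat ltxx.
  have x00 : x = 0 by exact: x0.
  rewrite x00 !f0 mulr0 addr0; apply/is_derive1_caratheodory.
  exists (flat j.+1); split; [|  |by rewrite f0].
    move=> z; rewrite f0 !subr0 /flat; case: ifPn => [z0|]; last by rewrite mul0r.
    by rewrite exprS; field; rewrite gt_eqF.
  suff cv0 : flat j.+1 z @[z --> (0 : R)] --> (0 : R).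
    by move: cv0; rewrite -[X in _ --> X](f0 j.+1).
  apply/cvgrPdist_le => e e0; near=> y.
  rewrite sub0r normrN ger0_norm ?flat_ge0//; apply: le_trans (flat_le _ _) _.
  rewrite -ler_pdivlMl ?ltr0n ?fact_gt0//; near: y.
  have /= := @nbhs0_le R R^o (((j.+2)`!)%:R^-1 * e).
  by apply; rewrite mulr_gt0// invr_gt0 ltr0n fact_gt0.
Unshelve. all: by end_near. Qed.

Lemma flat_smooth j : smooth (flat j).
Proof.
move=> n; elim: n j => [//|n IHn] j.
exists (fun x => - j%:R * flat j.+1 x + flat j.+2 x); split.
  by move=> x; exact: flat_derive.
by apply: CkD => //; apply: CkM => //; exact: Ck_cst.
Qed.

(** A smooth transition from [0] to [1]; [- 1 * x + 1] has the shape treated by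
    [Ck_affine]. *)
Definition step (x : R) : R := flat 0 x / (flat 0 x + flat 0 (- 1 * x + 1)).

Let step_den x : 0 < flat 0 x + flat 0 (- 1 * x + 1).
Proof.
have [x0|x0] := ltP 0 x.
  by rewrite ltr_pwDl ?flat_ge0// /flat x0 mul1r expR_gt0.
rewrite ltr_wpDl ?flat_ge0// /flat ifT; first by rewrite mul1r expR_gt0.
lra.
Qed.

Lemma step_smooth : smooth step.
Proof.
move=> n; apply: CkM; first exact: flat_smooth.
apply: CkV; first by move=> x; rewrite gt_eqF// step_den.
by apply: CkD; [exact: flat_smooth|apply: Ck_affine; exact: flat_smooth].
Qed.

Lemma step_le0 x : x <= 0 -> step x = 0.
Proof. by move=> x0; rewrite /step /flat ltNge x0 mul0r. Qed.

Lemma step_ge1 x : 1 <= x -> step x = 1.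
Proof.
move=> x1; have := step_den x; rewrite /step.
rewrite [X in _ + X](_ : _ = 0) ?addr0; first by move=> h; rewrite divff// gt_eqF.
by rewrite /flat ifF//; apply/negbTE; rewrite -leNgt; lra.
Qed.

Lemma step_ge0 x : 0 <= step x.
Proof. by rewrite divr_ge0 ?flat_ge0// ltW// step_den. Qed.

Lemma step_le1 x : step x <= 1.
Proof. by rewrite ler_pdivrMr ?step_den// mul1r lerDl flat_ge0. Qed.

Lemma derive_step_out x : x < 0 \/ 1 < x -> derive1 step x = 0.
Proof.
rewrite derive1E => -[x0|x1].
  rewrite (@near_eq_derive _ _ _ step (cst 0)) ?derive_cst//.
  by near=> y; apply: step_le0; apply/ltW; near: y; exact: lt_nbhsl.
rewrite (@near_eq_derive _ _ _ step (cst 1)) ?derive_cst//.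
by near=> y; apply: step_ge1; apply/ltW; near: y; exact: lt_nbhsr.
Unshelve. all: by end_near. Qed.

Lemma derive_step_bounded : exists M : R, forall x, `|derive1 step x| <= M.
Proof.
have [M hM] := continuous_bounded_itv 0 1 (smooth_continuous (smooth_derive1 step_smooth)).
have M0 : 0 <= M by apply: le_trans (hM 0 _); rewrite ?normr_ge0// lexx ler01.
exists M => x; have [x0|x0] := ltP x 0; first by rewrite derive_step_out ?normr0//; left.
have [x1|x1] := ltP 1 x; first by rewrite derive_step_out ?normr0//; right.
by apply: hM; rewrite x0.
Qed.

End smooth_functions.

(** * Approximation of point values *)

Section approximate_identity.
Context {R : realType}.
Local Notation mu := (@lebesgue_measure R).
Local Notation borel := (measurableTypeR R).

Lemma lebesgue_pt_small (f : R -> R) (y e : R) : lebesgue_pt f y -> 0 < e ->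
  exists2 r0 : R, 0 < r0 & forall r, 0 < r -> r < r0 ->
    (\int[mu]_(x in ball y r) `|f x - f y|%:E <= (e * (r *+ 2))%:E)%E.
Proof.
move=> fy e0; have /fine_cvgP[fin_davg /cvgrPdist_le/(_ _ e0) small] := fy.
have [r0 /= r00 hr0] : \forall r \near (0 : R)^'+, (davg f y r <= e%:E)%E.
  near=> r; rewrite -[davg f y r]fineK; last by near: r.
  rewrite lee_fin (le_trans (ler_norm _))// -normrN -sub0r.
  by near: r.
exists r0 => // r rpos rr0; have := hr0 r; rewrite /= sub0r normrN gtr0_norm//.
move=> /(_ rr0 rpos); rewrite /davg /iavg lebesgue_measure_ball ?(ltW rpos)//.
have r2 : 0 < r *+ 2 by rewrite mulrn_wgt0.
rewrite inver gt_eqF// EFinM lee_pdivrMl//.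
by rewrite muleC.
Unshelve. all: by end_near. Qed.

(** The transition is squeezed between [y] and [y + 1/(k + 1)], so that the
    derivatives form an approximate identity at [y]. *)
Definition bump (y : R) (k : nat) (x : R) : R := step (k.+1%:R * x + (- (k.+1%:R * y))).

Lemma bump_smooth y k : smooth (bump y k).
Proof. by move=> n; apply: Ck_affine; exact: step_smooth. Qed.

Lemma bump_derive (y : R) k (x : R) :
  derive1 (bump y k) x = k.+1%:R * derive1 step (k.+1%:R * x + (- (k.+1%:R * y))).
Proof.
by rewrite derive1E; have [_ <-] := is_derive_affine (smooth_is_derive (k.+1%:R * x + (- (k.+1%:R * y))) (@step_smooth R)).
Qed.

Let scale_pos (y x : R) k : (0 < k.+1%:R * x + (- (k.+1%:R * y))) = (y < x).
Proof. by rewrite -mulrBr pmulr_rgt0 ?ltr0n// subr_gt0. Qed.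

Lemma bump0 (y : R) k (x : R) : x <= y -> bump y k x = 0.
Proof. by move=> xy; rewrite /bump step_le0// leNgt scale_pos -leNgt. Qed.

Lemma bump1 (y : R) k (x : R) : y + k.+1%:R^-1 <= x -> bump y k x = 1.
Proof.
move=> xy; rewrite /bump step_ge1// -mulrBr -ler_pdivrMl ?ltr0n// mulr1.
by rewrite lerBrDl.
Qed.

Lemma bump_derive0 (y : R) k (x : R) : x < y \/ y + k.+1%:R^-1 < x -> derive1 (bump y k) x = 0.
Proof.
move=> h; rewrite bump_derive derive_step_out ?mulr0//; case: h => h; [left|right].
  by rewrite -mulrBr pmulr_rlt0 ?ltr0n// subr_lt0.
by rewrite -mulrBr -ltr_pdivrMl ?ltr0n// mulr1 ltrBrDl.
Qed.

Lemma bump_cvg (y x : R) : bump y k x @[k --> \oo] --> (if y < x then 1 else 0 : R).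
Proof.
case: ifPn => [yx|]; last first.
  rewrite -leNgt => xy; rewrite (_ : (fun k => _) = cst 0); first exact: cvg_cst.
  by apply/funext => k; rewrite bump0.
have xy0 : 0 < x - y by rewrite subr_gt0.
apply: cvg_near_cst; near=> k; rewrite bump1// -lerBrDl.
rewrite -[leRHS]invrK lef_pV2 ?posrE ?invr_gt0 ?ltr0n//.
rewrite (@le_trans _ _ k%:R) ?ler_nat//; near: k; exact: nbhs_infty_ger.
Unshelve. all: by end_near. Qed.

(** The derivative of the bump has integral one, is at most a multiple of [k + 1]
    and is supported in an interval of length [1/(k + 1)]; hence its mean of
    [f - f y] is controlled by averages over balls around [y]. *)
Lemma bump_approx (f : borel -> R) (y : R) : integ mu f -> lebesgue_pt f y ->
  \int[mu]_x (f x * derive1 (bump y k) x) @[k --> \oo] --> f y.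
Proof.
move=> fi fy; have [M hM] := @derive_step_bounded R.
have M0 : 0 <= M by exact: le_trans (hM 0).
have bp k := smooth_primitive (bump_smooth y k).
have mb k : measurable_fun setT (derive1 (bump y k) : borel -> R).
  by case: (bp k).
have bM k x : `|derive1 (bump y k) x| <= k.+1%:R * M.
  by rewrite bump_derive normrM normr_nat ler_wpM2l.
have bi k : integ mu (derive1 (bump y k)).
  have := primitive_integ (y - 1) (y + 1) (bp k); congr integ; apply/funext => x.
  rewrite indic_oc; have [|] := boolP (y - 1 < x <= y + 1); first by rewrite mul1r.
  rewrite negb_and -leNgt -ltNge mul0r => h; rewrite bump_derive0//.
  case/orP: h => h; [left; lra|right].
  apply: le_lt_trans h; rewrite lerD2l invf_le1 ?ltr0n// ler1n//.
have b1 k : \int[mu]_x (derive1 (bump y k) x) = 1.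
  have y1 : y - 1 <= y + 1 by lra.
  have := primitive_int (bp k) y1; rewrite bump1 ?bump0; last 2 first.
  - lra.
  - by rewrite lerD2l invf_le1 ?ltr0n// ler1n.
  rewrite subr0 => <-; congr Rintegral; apply/funext => x.
  rewrite indic_oc; have [|] := boolP (y - 1 < x <= y + 1); first by rewrite mul1r.
  rewrite negb_and -leNgt -ltNge mul0r => h; rewrite bump_derive0//.
  case/orP: h => h; [left; lra|right].
  apply: le_lt_trans h; rewrite lerD2l invf_le1 ?ltr0n// ler1n//.
have fbi k : integ mu (fun x => f x * derive1 (bump y k) x).
  have := integMb (mb k) (bM k) fi; congr integ; apply/funext => x.
  exact: mulrC.
apply/cvgrPdist_le => e e0.
(* The bound [(k + 1) M] of the derivative times the diameter [4/(k + 1)] of the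
   ball below costs a factor [4 M]. *)
pose e' := e / (4 * M + 1).
have M1 : 0 < 4 * M + 1 by lra.
have e'0 : 0 < e' by rewrite divr_gt0.
have [r0 r00 hr0] := lebesgue_pt_small fy e'0.
near=> k.
pose r := 2 * k.+1%:R^-1 : R.
have rpos : 0 < r by rewrite mulr_gt0 ?invr_gt0.
have rr0 : r < r0.
  rewrite /r -ltr_pdivlMl// -[ltRHS]invrK ltf_pV2 ?posrE ?invr_gt0 ?ltr0n ?mulr_gt0 ?invr_gt0//.
  rewrite (@lt_trans _ _ k%:R) ?ltr_nat//; near: k; exact: nbhs_infty_gtr.
have h := hr0 r rpos rr0.
rewrite -[X in X - _](mulr1 (f y)) -(b1 k) -RintZ// -RintB//; last exact: integZ.
have di : integ mu (fun x => f y * derive1 (bump y k) x - f x * derive1 (bump y k) x).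
  by apply: integB => //; exact: integZ.
apply: le_trans (le_normr_Rintegral measurableT di) _.
have mball : measurable (ball y r : set borel) by exact: measurable_ball.
have fci : mu.-integrable (ball y r) (EFin \o (fun x => `|f x - f y|)).
  apply/integrableP; split.
    apply/measurable_EFinP; apply: measurableT_comp => //.
    by apply: measurable_funB => //; apply: measurable_funTS; exact: integ_measurable fi.
  apply: le_lt_trans (ltry (e' * (r *+ 2))); apply: le_trans h.
  rewrite le_eqVlt; apply/orP; left; apply/eqP; apply: eq_integral => x _.
  by rewrite /= normr_id.
have fci' := (@integ_indic _ mu _ _ mball).1 fci.
have ballE : \int[mu]_x (ind (ball y r) x * `|f x - f y|) <= e' * (r *+ 2).
  rewrite -Rint_indic -lee_fin /Rintegral fineK; first exact: h.
  by apply: integrable_fin_num.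
apply: (@le_trans _ _ (\int[mu]_x (k.+1%:R * M * (ind (ball y r) x * `|f x - f y|)))).
  apply: le_Rintegral => //; [exact: integ_norm|exact: integZ|move=> x _].
  rewrite -mulrBl normrM distrC indE.
  have [|xb] := boolP (x \in (ball y r : set R)).
    by rewrite mul1r mulrC => _; rewrite ler_wpM2r.
  rewrite bump_derive0 ?normr0 ?mulr0 ?mul0r ?mulr0//.
  have [|xy] := ltP x y; [by left|right].
  rewrite ltNge; apply/negP => xk; move/negP: xb; apply.
  rewrite inE /ball /= ltr_norml /r; have : 0 < k.+1%:R^-1 :> R by rewrite invr_gt0.
  move: (k.+1%:R^-1) xk => c xk c0; apply/andP; split; lra.
rewrite RintZ//; apply: (@le_trans _ _ (k.+1%:R * M * (e' * (r *+ 2)))).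
  by rewrite ler_wpM2l// mulr_ge0.
rewrite (_ : _ * _ * _ = e * (4 * M / (4 * M + 1))); last first.
  rewrite /r /e'; by field; rewrite ?gt_eqF//=.
rewrite ler_piMr ?(ltW e0)// ler_pdivrMr// mul1r lerDl.
Unshelve. all: by end_near. Qed.

End approximate_identity.

(** * The du Bois-Reymond lemma *)

Section functionals.
Context {R : realType}.
Local Notation mu := (@lebesgue_measure R).
Local Notation borel := (measurableTypeR R).
Implicit Types (L : (R -> R) -> R) (psi v e : R -> R).

Definition bounded_borel psi := measurable_fun setT (psi : borel -> R) /\
  exists M : R, forall x, `|psi x| <= M.

(** What the du Bois-Reymond lemma needs of the right-hand side of the equation.
    Sums and differences of integrals against unrelated measures qualify, in
    particular the integral against a signed measure given by two positive ones. *)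
Record measure_like L : Prop := MeasureLike {
  ml_sub : forall psi1 psi2, bounded_borel psi1 -> bounded_borel psi2 ->
    L (fun x => psi1 x - psi2 x) = L psi1 - L psi2 ;
  ml_cvg : forall (psi_ : nat -> R -> R) psi (M : R),
    (forall k, measurable_fun setT (psi_ k : borel -> R)) ->
    (forall k x, `|psi_ k x| <= M) ->
    (forall x, psi_ k x @[k --> \oo] --> psi x) ->
    L (psi_ k) @[k --> \oo] --> L psi ;
  ml_parts_integ : forall v e a b, primitive v e ->
    integ mu (fun y => ind (oc a b) y * e y * L (ind (oc a y))) ;
  ml_parts : forall v e a b, primitive v e -> a <= b ->
    L (fun s => ind (oc a b) s * (v b - v s)) =
    \int[mu]_y (ind (oc a b) y * e y * L (ind (oc a y))) }.

Lemma bounded_borel_ind (a b : R) : bounded_borel (ind (oc a b)).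
Proof. by split => //; exists 1 => x; exact: indic_bound. Qed.

Lemma ml_zero L : measure_like L -> L (fun=> 0) = 0.
Proof.
move=> mL; have z : bounded_borel (fun=> 0).
  by split; [exact: measurable_cst|exists 0 => x; rewrite normr0].
have := ml_sub mL z z; rewrite [RHS]subrr => h; rewrite -[RHS]h; congr L.
by apply/funext => x; rewrite subrr.
Qed.

Lemma ml_opp L psi : measure_like L -> bounded_borel psi ->
  L (fun x => - psi x) = - L psi.
Proof.
move=> mL bpsi; have z : bounded_borel (fun=> 0).
  by split; [exact: measurable_cst|exists 0 => x; rewrite normr0].
have := ml_sub mL z bpsi; rewrite ml_zero// sub0r => <-; congr L.
by apply/funext => x; rewrite sub0r.
Qed.

Lemma measure_like_int (m : {sigma_finite_measure set borel -> \bar R})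
    (p : borel -> R) : integ m p -> measure_like (fun psi => \int[m]_x (p x * psi x)).
Proof.
move=> pi; have mp := integ_measurable pi.
have bi psi : bounded_borel psi -> integ m (fun x => p x * psi x).
  move=> [mpsi [M hM]]; have := integMb mpsi hM pi; congr integ.
  by apply/funext => x; exact: mulrC.
split.
- move=> psi1 psi2 b1 b2; rewrite -RintB; [|exact: bi..].
  by apply: eq_Rintegral => x _; rewrite mulrBr.
- move=> psi_ psi M mpsi_ hM cv.
  apply: (@dominated_Rint _ _ _ _ _ _ (fun x => M * `|p x|)).
  + by move=> k; exact: measurable_funM.
  + by apply: integZ; exact: integ_norm.
  + by move=> k x; rewrite normrM mulrC ler_wpM2r.
  + by apply: aeW => x; apply: cvgM => //; exact: cvg_cst.
  + apply: measurable_funM => //.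
    by apply: (measurable_fun_cvg mpsi_) => x _; exact: cv.
- move=> v e a b ve.
  pose K (z : borel * borel) : R := ind (oc a z.2) z.1.
  have mK : measurable_fun setT K.
    rewrite (_ : K = fun z => if z.1 <= z.2 then ind (`]a, +oo[%classic : set borel) z.1 else 0); last first.
      apply/funext => z; rewrite /K indic_oc indE mem_setE in_itv /= andbT.
      by case: (z.1 <= z.2); rewrite ?andbT ?andbF.
    apply: measurable_fun_ifT => //.
      exact: (@measurable_fun_ler _ _ _ setT (fst : borel * borel -> R) snd).
    have mI : measurable_fun setT (ind (`]a, +oo[%classic : set borel)).
      by apply: measurable_indic; exact: measurable_itv.
    exact: (measurableT_comp mI measurable_fst).
  have mG := @measurable_Rint _ _ _ _ _ m K p mK pi.
  have := primitive_integ a b ve.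
  have hM y : `|\int[m]_s (K (s, y) * p s)| <= \int[m]_s `|p s|.
    have Kp : integ m (fun s => K (s, y) * p s).
      exact: (integMb (ind_oc_measurable a y) (indic_bound _) pi).
    apply: le_trans (le_normr_Rintegral measurableT Kp) _.
    apply: le_Rintegral => //; [exact: integ_norm|exact: integ_norm|].
    by move=> s _; rewrite normrM ler_piMl// indic_bound.
  move=> /(integMb mG hM); congr integ; apply/funext => y.
  rewrite mulrC; congr (_ * _); apply: eq_Rintegral => s _; exact: mulrC.
- move=> v e a b ve ab.
  rewrite (_ : \int[m]_x _ = \int[m]_s (ind (oc a b) s * p s * (v b - v s))); last first.
    by apply: eq_Rintegral => s _; rewrite mulrA (mulrC (p s)).
  rewrite (stieltjes_by_parts pi ve ab); apply: eq_Rintegral => y _; congr (_ * _).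
  by apply: eq_Rintegral => s _; exact: mulrC.
Qed.

Lemma measure_like_sub L1 L2 : measure_like L1 -> measure_like L2 ->
  measure_like (fun psi => L1 psi - L2 psi).
Proof.
move=> m1 m2; split.
- by move=> psi1 psi2 b1 b2; rewrite !ml_sub//; ring.
- move=> psi_ psi M mpsi hM cv; apply: cvgB; [exact: (ml_cvg m1 mpsi hM cv)|].
  exact: (ml_cvg m2 mpsi hM cv).
- move=> v e a b ve; have := integB (ml_parts_integ m1 a b ve) (ml_parts_integ m2 a b ve).
  by congr integ; apply/funext => y; rewrite mulrBr.
- move=> v e a b ve ab; rewrite (ml_parts m1 ve ab) (ml_parts m2 ve ab) -RintB.
  + by apply: eq_Rintegral => y _; rewrite mulrBr.
  + exact: (ml_parts_integ m1 a b ve).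
  + exact: (ml_parts_integ m2 a b ve).
Qed.

Lemma measure_like_add L1 L2 : measure_like L1 -> measure_like L2 ->
  measure_like (fun psi => L1 psi + L2 psi).
Proof.
move=> m1 m2; split.
- by move=> psi1 psi2 b1 b2; rewrite !ml_sub//; ring.
- move=> psi_ psi M mpsi hM cv; apply: cvgD; [exact: (ml_cvg m1 mpsi hM cv)|].
  exact: (ml_cvg m2 mpsi hM cv).
- move=> v e a b ve; have := integD (ml_parts_integ m1 a b ve) (ml_parts_integ m2 a b ve).
  by congr integ; apply/funext => y; rewrite mulrDr.
- move=> v e a b ve ab; rewrite (ml_parts m1 ve ab) (ml_parts m2 ve ab) -RintD.
  + by apply: eq_Rintegral => y _; rewrite mulrDr.
  + exact: (ml_parts_integ m1 a b ve).
  + exact: (ml_parts_integ m2 a b ve).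
Qed.

End functionals.

Section du_bois_reymond.
Context {R : realType}.
Local Notation mu := (@lebesgue_measure R).
Local Notation borel := (measurableTypeR R).
Variables (alpha beta : R) (d : borel -> R) (G : (R -> R) -> R).
Hypotheses (ab : alpha < beta) (di : integ mu d) (mG : measure_like G).
Hypothesis dG : forall phi, smooth phi ->
  (forall x, x < alpha \/ beta < x -> phi x = 0) ->
  \int[mu]_x (d x * derive1 phi x) = G phi.

(** The claim is that this sum of [d] and of the distribution function of [G] is
    almost everywhere constant. *)
Let F y := d y + G (ind (oc alpha y)).

(** Test with functions that rise to [1] just after [y0] and fall back to [0]
    just after [y]: their derivatives concentrate at these two points, and they
    converge to the indicator of the interval between them. *)
Let F_cst_lt y0 y : alpha < y0 -> y0 < y -> y < beta ->
  lebesgue_pt d y0 -> lebesgue_pt d y -> F y0 = F y.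
Proof.
move=> ay0 y0y yb l0 l.
pose phi k x := bump y0 k x - bump y k x.
have sphi k : smooth (phi k).
  move=> n; rewrite /phi; have := CkD (bump_smooth y0 k n) (CkM (Ck_cst n (-1)) (bump_smooth y k n)).
  by apply: eq_Ck => x; rewrite mulN1r.
have dphi k x : derive1 (phi k) x = derive1 (bump y0 k) x - derive1 (bump y k) x.
  rewrite !derive1E deriveB//; apply: smooth_derivable; exact: bump_smooth.
have mdb z k : measurable_fun setT (derive1 (bump z k) : borel -> R).
  by case: (smooth_primitive (bump_smooth z k)).
have [M hM] := @derive_step_bounded R.
have dbi z k : integ mu (fun x => d x * derive1 (bump z k) x).
  have hb x : `|derive1 (bump z k) x| <= k.+1%:R * M.
    by rewrite bump_derive normrM normr_nat ler_wpM2l.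
  have := integMb (mdb z k) hb di; congr integ; apply/funext => x.
  exact: mulrC.
have E : \forall k \near \oo, G (phi k) =
    \int[mu]_x (d x * derive1 (bump y0 k) x) - \int[mu]_x (d x * derive1 (bump y k) x).
  near=> k; rewrite -dG//; last first.
    have k1 : k.+1%:R^-1 < beta - y.
      rewrite -[ltRHS]invrK ltf_pV2 ?posrE ?invr_gt0 ?subr_gt0 ?ltr0n//.
      rewrite (@lt_trans _ _ k%:R) ?ltr_nat//; near: k; exact: nbhs_infty_gtr.
    move=> x [xa|bx]; rewrite /phi.
      rewrite !bump0 ?subrr//; lra.
    rewrite !bump1 ?subrr//.
      by rewrite -lerBrDl (le_trans (ltW k1))//; lra.
    by rewrite -lerBrDl (le_trans (ltW k1))//; lra.
  rewrite -RintB//; apply: eq_Rintegral => x _.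
  by rewrite dphi mulrBr.
have c1 : G (phi k) @[k --> \oo] --> d y0 - d y.
  apply: cvg_trans (cvgB (bump_approx di l0) (bump_approx di l)).
  by apply: near_eq_cvg; near=> k; rewrite /=; apply/esym; near: k.
have c2 : G (phi k) @[k --> \oo] --> G (fun x => ind (oc alpha y) x - ind (oc alpha y0) x).
  apply: (@ml_cvg _ _ mG _ _ 2).
  - by move=> k; apply: continuous_measurable_fun; exact: smooth_continuous.
  - move=> k x; rewrite /phi /bump (le_trans (ler_normB _ _))//.
    by rewrite !ger0_norm ?step_ge0// -[2]/(1 + 1) lerD// step_le1.
  - move=> x; rewrite /phi.
    have -> : ind (oc alpha y) x - ind (oc alpha y0) x =
        (if y0 < x then 1 else 0) - (if y < x then 1 else 0).
      rewrite !indic_oc.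
      have [ax|xa] := ltP alpha x; last first.
        by rewrite !ltNge (le_trans xa (ltW ay0)) (le_trans xa (ltW (lt_trans ay0 y0y))) /=.
      have [xy|yx] := leP x y; have [xy0|y0x] := leP x y0; rewrite /= ?subrr //.
    by apply: cvgB; exact: bump_cvg.
have := cvg_unique (@Rhausdorff R) c1 c2.
rewrite (ml_sub mG); [|exact: bounded_borel_ind..].
move=> h; rewrite /F -[d y0](subrK (d y)) h; ring.
Unshelve. all: by end_near. Qed.

(** Replace [d] by [c - G 1_(alpha, y]]. The constant integrates to zero against
    [r'] because [r] vanishes at both ends, and integration by parts turns the
    other term into [G r]. *)
Lemma du_bois_reymond (r r' : R -> R) : primitive r r' ->
  integ mu (fun x => d x * r' x) ->
  (forall x, x <= alpha \/ beta <= x -> r x = 0) ->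
  (forall x, x <= alpha \/ beta < x -> r' x = 0) ->
  \int[mu]_x (d x * r' x) = G r.
Proof.
move=> rr' dri r0 r'0.
have lpt : {ae mu, forall x : borel, lebesgue_pt d x}.
  have := @lebesgue_differentiation R d _; apply.
  by apply: open_integrable_locally => //; exact: openT.
have [c cP] : exists c, {ae mu, forall x : borel, x \in oc alpha beta -> F x = c}.
  have [y0 [ay0 y0b l0]] : exists y0 : R, [/\ alpha < y0, y0 < beta & lebesgue_pt d y0].
    apply: contrapT => no; have [N [mN N0 sN]] := lpt.
    have : mu `]alpha, beta[%classic = 0%E.
      apply/eqP; rewrite -measure_le0 -N0 le_measure ?inE//.
      move=> x /=; rewrite in_itv /= => /andP[ax xb]; apply: sN => /= lx.
      by apply: no; exists x.
    rewrite lebesgue_measure_itv /= lte_fin ab -EFinD => /eqP.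
    by rewrite eqe subr_eq0 gt_eqF.
  exists (F y0).
  have lpt' : {ae mu, forall x : borel, (x : R) != beta}.
    exists [set beta]; split => //; first exact: lebesgue_measure_set1.
    by move=> x /= /negP; rewrite negbK => /eqP.
  apply: filterS2 lpt lpt'; first exact: (ae_filter_ringOfSetsType mu).
  move=> x lx xb; rewrite mem_setE in_itv /= => /andP[ax xb'].
  have {xb xb'} xb : x < beta by rewrite lt_neqAle xb.
  have [xy|yx|->//] := ltgtP x y0; first exact: F_cst_lt.
  by apply/esym; exact: F_cst_lt.
have ri := primitive_integ alpha beta rr'.
have indr' x : ind (oc alpha beta) x * r' x = r' x.
  rewrite indic_oc; have [|] := boolP (alpha < x <= beta); first by rewrite mul1r.
  rewrite negb_and -leNgt -ltNge mul0r => h; rewrite r'0//.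
  by case/orP: h; [left|right].
have mr' : measurable_fun setT (r' : borel -> R) by case: rr'.
have pi := ml_parts_integ mG alpha beta rr'.
have -> : \int[mu]_x (d x * r' x) =
    \int[mu]_x (c * (ind (oc alpha beta) x * r' x) -
                ind (oc alpha beta) x * r' x * G (ind (oc alpha x))).
  apply: ae_eq_Rint.
  - exact: integ_measurable dri.
  - by apply: (@integ_measurable _ _ _ mu); apply: integB; [exact: integZ|exact: pi].
  apply: filterS cP => x; rewrite mulrC -{1}indr'.
  rewrite -(_ : (x \in oc alpha beta)%:R = ind (oc alpha beta) x); last by rewrite indE.
  case: (x \in _) => [/(_ isT)|_]; last by rewrite /= !mul0r mulr0 subrr.
  by rewrite /F => <-; rewrite /=; ring.
rewrite RintB//; last exact: integZ.
rewrite RintZ// (primitive_int rr' (ltW ab)) -(ml_parts mG rr' (ltW ab)).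
rewrite !r0; [|by left|by right].
rewrite subrr mulr0 sub0r.
have br : bounded_borel r.
  have cr := primitive_continuous rr'; split; first exact: continuous_measurable_fun.
  have [M hM] := continuous_bounded_itv alpha beta cr; exists M => x.
  have M0 : 0 <= M by apply: le_trans (hM alpha _); rewrite ?normr_ge0// lexx ltW.
  have [ax|xa] := leP alpha x; last by rewrite r0 ?normr0//; left; exact: ltW.
  have [xb|bx] := leP x beta; first by apply: hM; rewrite ax.
  by rewrite r0 ?normr0//; right; exact: ltW.
rewrite -[RHS]opprK -(ml_opp mG br); congr (- G _); apply/funext => x.
rewrite indic_oc; have [|] := boolP (alpha < x <= beta); first by rewrite mul1r sub0r.
rewrite negb_and -leNgt -ltNge mul0r => h; rewrite r0 ?oppr0//.
by case/orP: h; [left|right; exact: ltW].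
Qed.

End du_bois_reymond.

(** * Cutoffs and the Sobolev form *)

Section cutoff.
Context {R : realType}.
Local Notation mu := (@lebesgue_measure R).
Local Notation borel := (measurableTypeR R).

Lemma vanish_boundary (g : R -> R) (n : R) : continuous g ->
  (forall x, n < `|x| -> g x = 0) -> forall x, n <= `|x| -> g x = 0.
Proof.
move=> cg g0 x; rewrite le_eqVlt => /predU1P[nx|]; last exact: g0.
have [x0|x0] := leP 0 x.
  have c1 : g y @[y --> x^'+] --> g x by apply: cvg_at_right_filter; exact: cg.
  have c2 : g y @[y --> x^'+] --> (0 : R).
    apply: cvg_near_cst; near=> y; have xy : x < y by near: y; exact: nbhs_right_gt.
    by apply: g0; rewrite nx ger0_norm// gtr0_norm// (le_lt_trans x0).
  exact: (cvg_unique (@Rhausdorff R) c1 c2).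
have c1 : g y @[y --> x^'-] --> g x by apply: cvg_at_left_filter; exact: cg.
have c2 : g y @[y --> x^'-] --> (0 : R).
  apply: cvg_near_cst; near=> y; have yx : y < x by near: y; exact: nbhs_left_lt.
  by apply: g0; rewrite nx ltr0_norm// ltr0_norm ?(lt_trans yx)// ltrN2.
exact: (cvg_unique (@Rhausdorff R) c1 c2).
Unshelve. all: by end_near. Qed.

Lemma derive1_vanish (g : R -> R) (n : R) : smooth g ->
  (forall x, n < `|x| -> g x = 0) -> forall x, n <= `|x| -> derive1 g x = 0.
Proof.
move=> sg g0; apply: vanish_boundary; first exact/smooth_continuous/smooth_derive1.
move=> x nx; rewrite derive1E (@near_eq_derive _ _ _ g (cst 0)) ?derive_cst//.
near=> y; apply: g0; near: y.
have : (fun y : R => `|y|) y @[y --> x] --> `|x| by exact: norm_continuous.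
by move/(@cvgr_gt _ R _ _ _ _) => /(_ _ nx).
Unshelve. all: by end_near. Qed.

Definition cutoff (k : nat) (x : R) : R :=
  step (1 * x + k.+2%:R) - step (1 * x + (- k.+1%:R)).

Lemma cutoff_smooth k : smooth (cutoff k).
Proof.
move=> n; have := CkD (Ck_affine 1 k.+2%:R (@step_smooth R n))
  (CkM (Ck_cst n (-1)) (Ck_affine 1 (- k.+1%:R) (@step_smooth R n))).
by apply: eq_Ck => x; rewrite mulN1r.
Qed.

Lemma cutoff_out k x : k.+2%:R <= `|x| -> cutoff k x = 0.
Proof.
have k0 : (0 : R) <= k%:R by [].
rewrite /cutoff !mul1r -[k.+2]addn2 -[k.+1]addn1 !natrD ler_normr => /orP[kx|kx].
  by rewrite !step_ge1 ?subrr//; lra.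
by rewrite !step_le0 ?subrr//; lra.
Qed.

Lemma cutoff_in k x : `|x| <= k.+1%:R -> cutoff k x = 1.
Proof.
have k0 : (0 : R) <= k%:R by [].
rewrite /cutoff !mul1r -[k.+2]addn2 -[k.+1]addn1 !natrD ler_norml => /andP[kx xk].
by rewrite step_ge1 ?step_le0 ?subr0//; lra.
Qed.

Lemma cutoff_bound k x : `|cutoff k x| <= 2.
Proof.
rewrite (le_trans (ler_normB _ _))// -[2]/(1 + 1).
by rewrite !ger0_norm ?step_ge0// lerD// step_le1.
Qed.

Lemma cutoff_cvg x : cutoff k x @[k --> \oo] --> (1 : R).
Proof.
apply: cvg_near_cst; near=> k; apply: cutoff_in.
rewrite (@le_trans _ _ k%:R) ?ler_nat//; near: k; exact: nbhs_infty_ger.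
Unshelve. all: by end_near. Qed.

Lemma derive_cutoff k x : derive1 (cutoff k) x =
  derive1 step (1 * x + k.+2%:R) - derive1 step (1 * x + (- k.+1%:R)).
Proof.
have aff (b : R) : is_derive x 1 (fun x : R => step (1 * x + b)) (derive1 step (1 * x + b)).
  have := is_derive_affine (smooth_is_derive (1 * x + b) (@step_smooth R)).
  by move=> h; apply: (is_derive_eq h); exact: mul1r.
by rewrite derive1E; have [_ <-] := is_deriveB (aff k.+2%:R) (aff (- k.+1%:R)).
Qed.

Lemma derive_cutoff_bounded : exists M : R, forall k x, `|derive1 (cutoff k) x| <= M.
Proof.
have [M hM] := @derive_step_bounded R; exists (M + M) => k x.
by rewrite derive_cutoff (le_trans (ler_normB _ _))// lerD.
Qed.

Lemma derive_cutoff_cvg x : derive1 (cutoff k) x @[k --> \oo] --> (0 : R).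
Proof.
apply: cvg_near_cst; near=> k; rewrite derive_cutoff.
have xk : `|x| < k%:R by near: k; exact: nbhs_infty_gtr.
move: xk; rewrite ltr_norml -[k.+2]addn2 -[k.+1]addn1 !natrD => /andP[kx xk].
rewrite !derive_step_out ?subrr//; [left|right]; lra.
Unshelve. all: by end_near. Qed.

(** The scalar product of [H^1(R)]; the derivatives are separate arguments
    because they only matter up to null sets. *)
Definition sobolev_form (a a' v v' : R -> R) : R :=
  \int[mu]_x (a' x * v' x) + 4^-1 * \int[mu]_x (a x * v x).

Definition square_int (m : {measure set borel -> \bar R}) (f : borel -> R) :=
  measurable_fun setT f /\ integ m (fun x => f x ^+ 2).

Lemma square_int_mul m f g : square_int m f -> square_int m g ->
  integ m (fun x => f x * g x).
Proof. by move=> [mf f2] [mg g2]; exact: integ_sqr_mul. Qed.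

(** Dominated convergence: the derivatives of the cutoffs are uniformly bounded
    and vanish eventually at every point. *)
Lemma cutoff_limit (a a' v v' : R -> R) :
  square_int mu a -> square_int mu a' -> square_int mu v -> square_int mu v' ->
  sobolev_form a a' (fun x => cutoff k x * v x)
    (fun x => derive1 (cutoff k) x * v x + cutoff k x * v' x) @[k --> \oo] -->
  sobolev_form a a' v v'.
Proof.
move=> sa sa' sv sv'.
have [M hM] := derive_cutoff_bounded.
have M0 : 0 <= M by apply: le_trans (hM 0%N 0).
have mc k : measurable_fun setT (cutoff k : borel -> R).
  apply: continuous_measurable_fun; exact/smooth_continuous/cutoff_smooth.
have mdc k : measurable_fun setT (derive1 (cutoff k) : borel -> R).
  apply: continuous_measurable_fun; exact/smooth_continuous/smooth_derive1/cutoff_smooth.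
have [ma _] := sa; have [ma' _] := sa'; have [mv _] := sv; have [mv' _] := sv'.
apply: cvgD; last first.
  apply: cvgM; first exact: cvg_cst.
  apply: (@dominated_Rint _ _ _ mu (fun k x => a x * (cutoff k x * v x))
    (fun x => a x * v x) (fun x => 2 * `|a x * v x|)).
  - by move=> k; do 2 apply: measurable_funM => //.
  - by apply: integZ; apply: integ_norm; exact: square_int_mul.
  - move=> k x; rewrite mulrCA normrM ler_wpM2r//; exact: cutoff_bound.
  - apply: aeW => x; rewrite -[X in _ --> X]mul1r.
    rewrite (_ : (fun k => _) = (fun k => cutoff k x * (a x * v x))).
      by apply: cvgM; [exact: cutoff_cvg|exact: cvg_cst].
    by apply/funext => k; rewrite mulrCA.
  - exact: measurable_funM.
apply: (@dominated_Rint _ _ _ mu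
  (fun k x => a' x * (derive1 (cutoff k) x * v x + cutoff k x * v' x))
  (fun x => a' x * v' x) (fun x => M * `|a' x * v x| + 2 * `|a' x * v' x|)).
- move=> k; apply: measurable_funM => //; apply: measurable_funD; exact: measurable_funM.
- by apply: integD; apply: integZ; apply: integ_norm; exact: square_int_mul.
- move=> k x; rewrite mulrDr (le_trans (ler_normD _ _))// lerD//.
    by rewrite mulrCA normrM ler_wpM2r.
  by rewrite mulrCA normrM ler_wpM2r// cutoff_bound.
- apply: aeW => x.
  rewrite [X in _ --> X](_ : _ = 0 * (a' x * v x) + 1 * (a' x * v' x)); last ring.
  rewrite (_ : (fun k => _) = (fun k => derive1 (cutoff k) x * (a' x * v x) +
      cutoff k x * (a' x * v' x))).
    apply: cvgD; apply: cvgM; [exact: derive_cutoff_cvg|exact: cvg_cst|exact: cutoff_cvg|exact: cvg_cst].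
  by apply/funext => k; ring.
- exact: measurable_funM.
Qed.

End cutoff.

(** * The weak equation tested with Sobolev functions *)

Section weak_equation.
Context {R : realType} (omega : signed_borel R)
    (upsilon : {measure set (measurableTypeR R) -> \bar R})
    (upsilon_lf : locally_finite_measure upsilon).
Local Notation mu := (@lebesgue_measure R).
Local Notation borel := (measurableTypeR R).

Definition omega_pos n := jordan_pos (svalP (hahn_choice (signed_restr omega n))).
Definition omega_neg n := jordan_neg (svalP (hahn_choice (signed_restr omega n))).

Definition omega_int n (psi : borel -> R) : R :=
  \int[omega_pos n]_x psi x - \int[omega_neg n]_x psi x.

(** The distributional equation for real functions; [n] bounds the support of
    [phi], so that only the restriction of [omega] to a window is evaluated. *)
Definition weak_eq (a p q : R -> R) := forall n phi, smooth phi ->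
  (forall x, n%:R < `|x| -> phi x = 0) ->
  - (\int[mu]_x (a x * derive1 (derive1 phi) x)) + 4^-1 * \int[mu]_x (a x * phi x) =
  omega_int n (fun x => p x * phi x) + \int[upsilon]_x (q x * phi x).

Lemma window_measurable n : measurable (window R n).
Proof. exact: measurable_itv. Qed.
Hint Resolve window_measurable : core.

Lemma ind_window_measurable n : measurable_fun setT (ind (window R n)).
Proof. by apply: measurable_indic. Qed.
Hint Resolve ind_window_measurable : core.

Lemma window_norm n x : (x \in window R n) = (`|x| <= n%:R).
Proof. by rewrite mem_setE in_itv /= ler_norml. Qed.

Lemma window_fin n : (upsilon (window R n) < +oo)%E.
Proof.
apply: upsilon_lf => //; exists n%:R; split; first exact: num_real.
move=> x nx y; rewrite /window /= in_itv/= => yn.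
by rewrite (le_trans _ (ltW nx))// ler_norml.
Qed.

Lemma upsilon_sigma_finite : sigma_finite setT upsilon.
Proof.
exists (window R); last by move=> n; split => //; exact: window_fin.
apply/esym; rewrite -subTset => x _; exists (Num.truncn `|x|).+1 => //.
by rewrite -[_ x]/(_ x) -inE window_norm; exact/ltW/truncnS_gt.
Qed.

(** Carrying the proof of local finiteness in the term lets the sigma-finite
    structure be inferred. *)
Definition lf_measure (_ : locally_finite_measure upsilon) : set borel -> \bar R :=
  upsilon.

HB.instance Definition _ H := Measure.copy (lf_measure H) upsilon.

HB.instance Definition _ H := @Measure_isSigmaFinite.Build _ _ _ (lf_measure H)
  upsilon_sigma_finite.

Let ups : {sigma_finite_measure set borel -> \bar R} := lf_measure upsilon_lf.

Lemma integ_ind_window n : integ upsilon (ind (window R n)).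
Proof.
have := (@integ_indic _ upsilon _ (fun=> 1) (window_measurable n)).1.
rewrite (_ : (fun x => _ * 1) = ind (window R n)); last by apply/funext => x; rewrite mulr1.
apply; apply: measurable_bounded_integrable => //; first exact: window_fin.
by exists 1; split => // M M1 x _ /=; rewrite normr1 ltW.
Qed.

Lemma integ_window_upsilon n q : square_int upsilon q ->
  integ upsilon (fun x => ind (window R n) x * q x).
Proof.
move=> [mq q2].
have i1 := integ_ind_window n.
apply: (@integ_le _ _ _ _ _ (fun x => ind (window R n) x + q x ^+ 2)).
- exact: measurable_funM.
- move=> x; rewrite indE; case: (_ \in _) => /=; rewrite ?mul1r ?mul0r ?normr0.
    rewrite -[1%:R]/1 ler_norml; apply/andP; split; nra.
  by rewrite add0r sqr_ge0.
- exact: integD.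
Qed.

Lemma integ_window_finite (m : {finite_measure set borel -> \bar R}) n (p : R -> R) :
  continuous p -> integ m (fun x => ind (window R n) x * p x).
Proof.
move=> cp; have [M hM] := continuous_bounded_itv (- n%:R) n%:R cp.
have mp : measurable_fun setT (p : borel -> R) by exact: continuous_measurable_fun.
have mI : measurable_fun setT (fun x : borel => ind (window R n) x * p x).
  exact: measurable_funM.
apply: measurable_bounded_integrable => //.
  by rewrite -ge0_fin_numE// fin_num_measure.
exists (`|M|); split; first exact: num_real.
move=> M' MM' x _ /=; rewrite indE window_norm.
have [xn|nx] := leP `|x : R| n%:R; last by rewrite mul0r normr0 (le_trans (normr_ge0 M)) ?ltW.
rewrite mul1r (le_trans (hM _ _)) -?ler_norml// (le_trans (ler_norm _))//.
exact: ltW.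
Qed.

(** With the indicator of the window inserted, the right-hand side makes sense
    for all bounded Borel functions, whatever their support. *)
Let windowed n p q psi : R :=
  \int[omega_pos n]_x (ind (window R n) x * p x * psi x) -
  \int[omega_neg n]_x (ind (window R n) x * p x * psi x) +
  \int[ups]_x (ind (window R n) x * q x * psi x).

Let windowed_ml n (p q : R -> R) : continuous p -> square_int upsilon q ->
  measure_like (windowed n p q).
Proof.
move=> cp sq; apply: measure_like_add; first apply: measure_like_sub.
- apply: (@measure_like_int _ (omega_pos n)); exact: integ_window_finite.
- apply: (@measure_like_int _ (omega_neg n)); exact: integ_window_finite.
- apply: (@measure_like_int _ ups); exact: integ_window_upsilon.
Qed.

Let windowedE n p q psi : (forall x, n%:R < `|x| -> psi x = 0) ->
  windowed n p q psi =
  omega_int n (fun x => p x * psi x) + \int[upsilon]_x (q x * psi x).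
Proof.
move=> psi0.
have E (f : R -> R) : (fun x => ind (window R n) x * f x * psi x) = (fun x => f x * psi x).
  apply/funext => x; rewrite indE window_norm.
  by case: leP => [_|/psi0 ->]; rewrite ?mul1r// !mulr0.
by rewrite /windowed !E.
Qed.

(** With [a / 4] moved to the right, the equation expresses the integral of
    [a' phi'] by a measure-like functional of [phi]; [du_bois_reymond] then
    admits [r] in place of [phi]. *)
Lemma weak_eq_sobolev n (a a' p q r r' : R -> R) : (0 < n)%N -> weak_eq a p q ->
  primitive a a' -> continuous p -> square_int upsilon q -> primitive r r' ->
  (forall x, n%:R <= `|x| -> r x = 0) -> (forall x, n%:R <= `|x| -> r' x = 0) ->
  integ mu (fun x => a' x * r' x) ->
  sobolev_form a a' r r' =
  omega_int n (fun x => p x * r x) + \int[upsilon]_x (q x * r x).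
Proof.
move=> n0 weq aa' cp sq rr' r0 r'0 iar.
pose al : R := - n%:R; pose be : R := n%:R.
have ab : al < be by rewrite /al /be gtrN// ltr0n.
have ale x : x <= al -> n%:R <= `|x|.
  by move=> xa; rewrite ler_normr lerNr xa orbT.
have bee x : be <= x -> n%:R <= `|x| by move=> bx; rewrite ler_normr bx.
have ca := primitive_continuous aa'.
have ma : measurable_fun setT (a : borel -> R) by exact: continuous_measurable_fun.
have [ma' _ _] := aa'.
have iaW : integ mu (fun x => ind (oc al be) x * a x).
  apply/(@integ_indic _ mu _ _ (oc_measurable al be)).
  have iaC : mu.-integrable `[al, be] (EFin \o a).
    apply: continuous_compact_integrable; first exact: segment_compact.
    by move=> x; apply: continuous_subspaceT => y; exact: ca.
  by apply: (integrableS _ _ _ iaC) => // x; exact: subset_itv_oc_cc.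
have oco x : be < `|x| -> ind (oc al be) x = 0.
  rewrite indic_oc ltr_normr => /orP[bx|bx].
    by rewrite andbC leNgt bx.
  by rewrite (_ : al < x = false)//; apply/negbTE; rewrite -leNgt /al lerNr ltW.
have mG : measure_like (fun psi => windowed n p q psi -
    \int[mu]_x (4^-1 * (ind (oc al be) x * a x) * psi x)).
  apply: measure_like_sub; first exact: windowed_ml.
  by apply: (@measure_like_int _ mu); exact: integZ.
have iM4 (f : R -> R) : bounded_borel f ->
    \int[mu]_x (4^-1 * (ind (oc al be) x * a x) * f x) =
    4^-1 * \int[mu]_x (ind (oc al be) x * a x * f x).
  move=> [mf [M hM]]; rewrite -RintZ; last first.
    by have := integMb mf hM iaW; congr integ; apply/funext => x; rewrite mulrC.
  by apply: eq_Rintegral => x _; rewrite mulrA.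
have indP (f : R -> R) : (forall x, n%:R <= `|x| -> f x = 0) ->
    forall x, ind (oc al be) x * f x = f x.
  move=> f0 x; rewrite indic_oc.
  have [|] := boolP (al < x <= be); first by rewrite mul1r.
  rewrite negb_and -leNgt -ltNge mul0r => h; rewrite f0//.
  by case/orP: h => [/ale//|/ltW/bee].
have bb (f : R -> R) : continuous f -> (forall x, n%:R <= `|x| -> f x = 0) -> bounded_borel f.
  move=> cf f0; split; first exact: continuous_measurable_fun.
  have [M hM] := continuous_bounded_itv al be cf; exists M => x.
  have M0 : 0 <= M by apply: le_trans (hM al _); rewrite ?normr_ge0// lexx ltW.
  have [nx|xn] := leP n%:R `|x|; first by rewrite f0// normr0.
  by apply: hM; rewrite -ler_norml ltW.
have dG phi : smooth phi -> (forall x, x < al \/ be < x -> phi x = 0) ->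
    \int[mu]_x (ind (oc al be) x * a' x * derive1 phi x) =
    windowed n p q phi - \int[mu]_x (4^-1 * (ind (oc al be) x * a x) * phi x).
  move=> sphi phi0'.
  have phi0 x : n%:R < `|x| -> phi x = 0.
    rewrite ltr_normr => /orP[nx|nx]; apply: phi0'; [by right|left].
    by rewrite /al ltrNr.
  have dphi0 := derive1_vanish sphi phi0.
  have ddphi0 : forall x, n%:R <= `|x| -> derive1 (derive1 phi) x = 0.
    by apply: derive1_vanish; [exact: smooth_derive1|move=> x /ltW; exact: dphi0].
  have phiE := vanish_boundary (smooth_continuous sphi) phi0.
  have := weq n phi sphi phi0; rewrite -(windowedE p q phi0) => <-.
  have bphi := bb _ (smooth_continuous sphi) phiE.
  rewrite iM4//.
  have -> : \int[mu]_x (ind (oc al be) x * a x * phi x) = \int[mu]_x (a x * phi x).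
    by apply: eq_Rintegral => x _; rewrite mulrAC indP// mulrC.
  have adphi := primitive_mul aa' (smooth_primitive (smooth_derive1 sphi)).
  have := primitive_int adphi (ltW ab).
  rewrite !dphi0; [|exact: (ale _ (lexx _))|exact: (bee _ (lexx _))].
  rewrite !mulr0 subrr.
  have i1 : integ mu (fun x => ind (oc al be) x * a' x * derive1 phi x).
    have [mb [M hM]] := bb _ (smooth_continuous (smooth_derive1 sphi)) dphi0.
    by have := integMb mb hM (primitive_integ al be aa'); congr integ; apply/funext => x; rewrite mulrC.
  have i2 : integ mu (fun x => ind (oc al be) x * a x * derive1 (derive1 phi) x).
    have [mb [M hM]] := bb _ (smooth_continuous (smooth_derive1 (smooth_derive1 sphi))) ddphi0.
    by have := integMb mb hM iaW; congr integ; apply/funext => x; rewrite mulrC.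
  rewrite (_ : (fun x => ind _ x * (_ + _)) = (fun x =>
     ind (oc al be) x * a' x * derive1 phi x +
     ind (oc al be) x * a x * derive1 (derive1 phi) x)); last first.
    by apply/funext => x; ring.
  rewrite RintD//.
  have -> : \int[mu]_x (ind (oc al be) x * a x * derive1 (derive1 phi) x) =
      \int[mu]_x (a x * derive1 (derive1 phi) x).
    by apply: eq_Rintegral => x _; rewrite mulrAC indP// mulrC.
  lra.
have r'W x : ind (oc al be) x * a' x * r' x = a' x * r' x.
  by rewrite mulrAC indP// mulrC.
have iar' : integ mu (fun x => ind (oc al be) x * a' x * r' x).
  by move: iar; congr integ; apply/funext => x; rewrite r'W.
have := @du_bois_reymond _ al be _ _ ab (primitive_integ al be aa') mG dG r r' rr' iar'.
move=> /(_ _ _); rewrite (_ : \int[mu]_x (_ * a' x * _) = \int[mu]_x (a' x * r' x)); last first.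
  by apply: eq_Rintegral => x _; rewrite r'W.
rewrite windowedE; last by move=> x /ltW; exact: r0.
rewrite iM4; last by apply: bb => //; exact: primitive_continuous rr'.
rewrite (_ : \int[mu]_x (ind _ x * _ * _) = \int[mu]_x (a x * r x)); last first.
  by apply: eq_Rintegral => x _; rewrite mulrAC indP// mulrC.
rewrite /sobolev_form => ->; first lra.
  by move=> x [/ale|/bee]; exact: r0.
by move=> x [/ale|/ltW/bee]; exact: r'0.
Qed.

End weak_equation.

(** * Symmetry of the weak equation *)

Section symmetry.
Context {R : realType} (omega : signed_borel R)
    (upsilon : {measure set (measurableTypeR R) -> \bar R})
    (upsilon_lf : locally_finite_measure upsilon).
Local Notation mu := (@lebesgue_measure R).
Local Notation borel := (measurableTypeR R).

Definition real_H1 (a a' : R -> R) :=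
  [/\ primitive a a', square_int mu a & square_int mu a'].

Lemma real_H1_cutoff k (v v' : R -> R) : real_H1 v v' ->
  primitive (fun x => cutoff k x * v x)
    (fun x => derive1 (cutoff k) x * v x + cutoff k x * v' x).
Proof.
by move=> [vv' _ _]; apply: primitive_mul => //; exact/smooth_primitive/cutoff_smooth.
Qed.

Lemma weak_eq_cutoff (a a' p q v v' : R -> R) k : weak_eq omega upsilon a p q ->
  real_H1 a a' -> continuous p -> square_int upsilon q -> real_H1 v v' ->
  sobolev_form a a' (fun x => cutoff k x * v x)
    (fun x => derive1 (cutoff k) x * v x + cutoff k x * v' x) =
  omega_int omega k.+2 (fun x => p x * (cutoff k x * v x)) +
  \int[upsilon]_x (q x * (cutoff k x * v x)).
Proof.
move=> weq [aa' sa sa'] cp sq Hv.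
have [vv' sv sv'] := Hv.
apply: (weak_eq_sobolev upsilon_lf) => //.
- exact: real_H1_cutoff.
- by move=> x kx; rewrite cutoff_out// mul0r.
- move=> x kx; rewrite cutoff_out// mul0r addr0.
  rewrite (derive1_vanish (n := k.+2%:R)) ?mul0r//; first exact: cutoff_smooth.
  by move=> y /ltW; exact: cutoff_out.
have mc : measurable_fun setT (cutoff k : borel -> R).
  apply: continuous_measurable_fun; exact/smooth_continuous/cutoff_smooth.
have mdc : measurable_fun setT (derive1 (cutoff k) : borel -> R).
  apply: continuous_measurable_fun; exact/smooth_continuous/smooth_derive1/cutoff_smooth.
have [M hM] := @derive_cutoff_bounded R.
have := integD (integMb mdc (hM k) (square_int_mul sa' sv))
  (integMb mc (cutoff_bound k) (square_int_mul sa' sv')).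
by congr integ; apply/funext => x; ring.
Qed.

Lemma cutoff_cvg_int (m : {measure set borel -> \bar R}) (f g : borel -> R) :
  square_int m f -> square_int m g ->
  \int[m]_x (f x * (cutoff k x * g x)) @[k --> \oo] --> \int[m]_x (f x * g x).
Proof.
move=> sf sg; have [mf _] := sf; have [mg _] := sg.
have mc k : measurable_fun setT (cutoff k : borel -> R).
  apply: continuous_measurable_fun; exact/smooth_continuous/cutoff_smooth.
apply: (@dominated_Rint _ _ _ m (fun k x => f x * (cutoff k x * g x))
    (fun x => f x * g x) (fun x => 2 * `|f x * g x|)).
- by move=> k; do 2 apply: measurable_funM => //.
- by apply: integZ; apply: integ_norm; exact: square_int_mul.
- move=> k x; rewrite mulrCA normrM ler_wpM2r//; exact: cutoff_bound.
- apply: aeW => x; rewrite -[X in _ --> X]mul1r.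
  rewrite (_ : (fun k => _) = (fun k => cutoff k x * (f x * g x))).
    by apply: cvgM; [exact: cutoff_cvg|exact: cvg_cst].
  by apply/funext => k; rewrite mulrCA.
- exact: measurable_funM.
Qed.

(** Testing the equation of [a] with a cutoff of [r] and the equation of [b]
    with the same cutoff of [p] produces the same integral against [omega]. *)
Lemma weak_eq_symmetric (a a' p p' q b b' r r' s : R -> R) :
  weak_eq omega upsilon a p q -> weak_eq omega upsilon b r s ->
  real_H1 a a' -> real_H1 p p' -> real_H1 b b' -> real_H1 r r' ->
  square_int upsilon q -> square_int upsilon s ->
  square_int upsilon p -> square_int upsilon r ->
  sobolev_form a a' r r' - \int[upsilon]_x (q x * r x) =
  sobolev_form b b' p p' - \int[upsilon]_x (s x * p x).
Proof.
move=> wa wb Ha Hp Hb Hr sq ss sp sr.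
have [_ sa sa'] := Ha; have [pp' sp1 sp'] := Hp.
have [_ sb sb'] := Hb; have [rr' sr1 sr'] := Hr.
pose u k := sobolev_form a a' (fun x => cutoff k x * r x)
    (fun x => derive1 (cutoff k) x * r x + cutoff k x * r' x) -
  \int[upsilon]_x (q x * (cutoff k x * r x)).
have c1 : u k @[k --> \oo] --> sobolev_form a a' r r' - \int[upsilon]_x (q x * r x).
  by apply: cvgB; [exact: cutoff_limit|exact: cutoff_cvg_int].
have c2 : u k @[k --> \oo] --> sobolev_form b b' p p' - \int[upsilon]_x (s x * p x).
  rewrite (_ : u = fun k => sobolev_form b b' (fun x => cutoff k x * p x)
      (fun x => derive1 (cutoff k) x * p x + cutoff k x * p' x) -
      \int[upsilon]_x (s x * (cutoff k x * p x))).
    by apply: cvgB; [exact: cutoff_limit|exact: cutoff_cvg_int].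
  apply/funext => k; rewrite /u (weak_eq_cutoff k wa)//; last exact: primitive_continuous pp'.
  rewrite (weak_eq_cutoff k wb)//; last exact: primitive_continuous rr'.
  rewrite !addrK /omega_int.
  by congr (_ - _); apply: eq_Rintegral => x _; ring.
exact: (cvg_unique (@Rhausdorff R) c1 c2).
Qed.

End symmetry.

(** * Potentials of the Green function *)

Section exponential_integral.
Context {R : realType}.
Local Notation mu := (@lebesgue_measure R).
Local Notation borel := (measurableTypeR R).

Lemma is_derive_exp (c b x : R) :
  is_derive x 1 (fun x => expR (c * x + b)) (c * expR (c * x + b)).
Proof. exact: is_derive_affine (is_derive_expR _). Qed.

Lemma continuous_exp (c b : R) : continuous (fun x : R => expR (c * x + b)).
Proof.
move=> x; apply/differentiable_continuous/derivable1_diffP.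
by case: (is_derive_exp c b x).
Qed.

Lemma primitive_exp (c b : R) : primitive (fun x => expR (c * x + b))
  (fun x => c * expR (c * x + b)).
Proof.
apply: primitive_C1; first by move=> x; exact: is_derive_exp.
by move=> x; apply: cvgM; [exact: cvg_cst|exact: continuous_exp].
Qed.

(** An integral over an interval splits at [c]. *)
Lemma primitive_glue (c : R) (u1 d1 u2 d2 : R -> R) :
  primitive u1 d1 -> primitive u2 d2 -> u1 c = u2 c ->
  primitive (fun x => if x <= c then u1 x else u2 x)
    (fun x => if x <= c then d1 x else d2 x).
Proof.
move=> P1 P2 u12; have [m1 _ _] := P1; have [m2 _ _] := P2.
have E a b : (fun x => ind (oc a b) x * (if x <= c then d1 x else d2 x)) =
    (fun x => ind (oc (Num.min a c) (Num.min b c)) x * d1 x +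
              ind (oc (Num.max a c) (Num.max b c)) x * d2 x).
  apply/funext => x; rewrite !indic_oc le_min gt_min gt_max le_max.
  have [xc|cx] := leP x c; rewrite ?andbT ?andbF ?orbF ?orbT ?mul0r ?add0r ?addr0//=.
have i1 a b : integ mu (fun x => ind (oc (Num.min a c) (Num.min b c)) x * d1 x) :=
  primitive_integ _ _ P1.
have i2 a b : integ mu (fun x => ind (oc (Num.max a c) (Num.max b c)) x * d2 x) :=
  primitive_integ _ _ P2.
split.
- apply: measurable_fun_ifT => //.
  exact: (@measurable_fun_ler _ _ _ setT (id : borel -> R) (cst c)).
- move=> a b; apply/(@integ_indic _ mu _ _ (oc_measurable a b)).
  by rewrite E; exact: integD.
- move=> a b ab; rewrite Rint_indic E RintD// (primitive_int P1); last first.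
    by rewrite le_min !ge_min ab lexx orbT.
  rewrite (primitive_int P2); last by rewrite ge_max !le_max ab lexx orbT.
  have [bc|cb] := leP b c; have [ac|ca] := leP a c; rewrite ?u12; ring.
Qed.

Lemma integ_exp_abs : integ mu (fun x : borel => expR (- `|x : R|)).
Proof.
have cexp : continuous (fun x : R => expR (- `|x|)).
  move=> x; apply: (@continuous_comp _ _ _ (fun x : R => - `|x|) expR); last exact: continuous_expR.
  by apply: continuousN; exact: norm_continuous.
apply/integrableP; split; first by apply/measurable_EFinP; exact: continuous_measurable_fun.
under eq_integral do rewrite /= ger0_norm ?expR_ge0//.
rewrite ge0_symfun_integralT//; last first.
  by move=> x /=; rewrite normrN.
rewrite -set_itvcy; have -> : (\int[mu]_(x in `[0%R, +oo[) (expR (- `|x|))%:E =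
    \int[mu]_(x in `[0%R, +oo[) (expR (- x))%:E)%E.
  apply: eq_integral => x; rewrite inE/= in_itv/= andbT => x0.
  by rewrite ger0_norm.
have dF (x : R) : is_derive x 1 (fun x => - expR (- x)) (expR (- x)).
  have := @is_derive1_comp R expR (fun y => - y) x _ _ (is_derive_expR _) (is_deriveN (is_derive_id x (1 : R))).
  by move=> h; apply: (is_derive_eq (is_deriveN h)); rewrite mulrN1 opprK.
have cF : continuous (fun x : R => - expR (- x)).
  by move=> x; apply/differentiable_continuous/derivable1_diffP; case: (dF x).
rewrite (@ge0_continuous_FTC2y R _ (fun x => - expR (- x)) 0 0).
- by rewrite oppr0 expR0 -EFinB opprK add0r -EFinM ltry.
- by move=> x _; exact: expR_ge0.
- apply: continuous_subspaceT => x; apply: (@continuous_comp _ _ _ (fun x : R => - x) expR); last exact: continuous_expR.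
  exact: oppr_continuous.
- rewrite -[X in _ --> X]oppr0; apply: cvgN; exact: cvgr_expR.
- by move=> x _; case: (dF x).
- by apply: cvg_at_right_filter; exact: cF.
- by move=> x _; rewrite derive1E; case: (dF x) => _ ->.
Qed.

End exponential_integral.

Section green_function.
Context {R : realType}.
Local Notation mu := (@lebesgue_measure R).
Local Notation borel := (measurableTypeR R).

(** [exp(-|x - s|/2)], the fundamental solution of [-u'' + u/4]. *)
Definition green (s x : R) : R :=
  if x <= s then expR (2^-1 * x + - (2^-1 * s)) else expR (- 2^-1 * x + 2^-1 * s).

Definition green' (s x : R) : R :=
  if x <= s then 2^-1 * expR (2^-1 * x + - (2^-1 * s))
  else - 2^-1 * expR (- 2^-1 * x + 2^-1 * s).

Lemma green_primitive s : primitive (green s) (green' s).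
Proof.
apply: primitive_glue; [exact: primitive_exp|exact: primitive_exp|].
by congr expR; ring.
Qed.

Lemma greenE s x : green s x = expR (- (2^-1 * `|x - s|)).
Proof.
rewrite /green; have [xs|sx] := leP x s; congr expR.
  by rewrite ler0_norm ?subr_le0//; ring.
by rewrite gtr0_norm ?subr_gt0//; ring.
Qed.

Lemma green_bound s x : `|green s x| <= 1.
Proof.
by rewrite greenE ger0_norm ?expR_ge0// expR_le1 oppr_le0.
Qed.

Lemma green'_le s x : `|green' s x| <= green s x.
Proof.
rewrite /green /green'; case: ifP => _.
  rewrite normrM (ger0_norm (expR_ge0 _)) ler_piMl ?expR_ge0//.
  by rewrite ger0_norm ?invr_ge0// invf_le1// ler1n.
rewrite normrM (ger0_norm (expR_ge0 _)) ler_piMl ?expR_ge0//.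
by rewrite normrN ger0_norm ?invr_ge0// invf_le1// ler1n.
Qed.

Lemma green'_bound s x : `|green' s x| <= 1.
Proof.
apply: le_trans (green'_le s x) _; apply: le_trans (green_bound s x).
exact: ler_norm.
Qed.

Let measurable_exp (c1 c2 : R) : measurable_fun setT
  (fun z : borel * borel => expR (c1 * z.2 + c2 * z.1)).
Proof.
have mexp : measurable_fun setT (expR : borel -> R).
  by apply: continuous_measurable_fun; exact: continuous_expR.
apply: (measurableT_comp mexp); apply: measurable_funD; apply: measurable_funM => //.
Qed.

Lemma measurable_green :
  measurable_fun setT (fun z : borel * borel => green z.1 z.2).
Proof.
apply: measurable_fun_ifT.
- exact: (@measurable_fun_ler _ _ _ setT (snd : borel * borel -> R) fst).
- rewrite (_ : (fun z => _) = fun z : borel * borel => expR (2^-1 * z.2 + (- 2^-1) * z.1)).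
    exact: measurable_exp.
  by apply/funext => z; rewrite mulNr.
- exact: measurable_exp.
Qed.

Lemma measurable_green' :
  measurable_fun setT (fun z : borel * borel => green' z.1 z.2).
Proof.
apply: measurable_fun_ifT.
- exact: (@measurable_fun_ler _ _ _ setT (snd : borel * borel -> R) fst).
- apply: measurable_funM => //.
  rewrite (_ : (fun z => _) = fun z : borel * borel => expR (2^-1 * z.2 + (- 2^-1) * z.1)).
    exact: measurable_exp.
  by apply/funext => z; rewrite mulNr.
- by apply: measurable_funM => //; exact: measurable_exp.
Qed.

(** On either side of [s] the integrand is a multiple of the derivative
    of [exp(+-(x - s)/2) v]; each half-line contributes [v s / 2]. *)
Lemma green_reproducing (v v' : R -> R) (N s : R) : primitive v v' ->
  (forall x, N <= `|x| -> v x = 0) -> (forall x, N <= `|x| -> v' x = 0) ->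
  \int[mu]_x (green' s x * v' x + 4^-1 * (green s x * v x)) = v s.
Proof.
move=> vv' v0 v'0; pose M := Num.max N `|s| + 1.
have NM : N < M by rewrite /M ltr_pwDr// le_max lexx.
have sM : `|s| < M by rewrite /M ltr_pwDr// le_max lexx orbT.
have /andP[Ms sM'] : - M < s < M by rewrite -ltr_norml.
have out x : M <= `|x| -> v x = 0 /\ v' x = 0.
  by move=> Mx; rewrite v0 ?v'0//; apply: ltW; apply: lt_le_trans Mx.
have pl := primitive_mul (primitive_exp 2^-1 (- (2^-1 * s))) vv'.
have pr := primitive_mul (primitive_exp (- 2^-1) (2^-1 * s)) vv'.
have il := primitive_integ (- M) s pl; have ir := primitive_integ s M pr.
transitivity (\int[mu]_x (2^-1 * (ind (oc (- M) s) x *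
    (2^-1 * expR (2^-1 * x + - (2^-1 * s)) * v x + expR (2^-1 * x + - (2^-1 * s)) * v' x)) -
  2^-1 * (ind (oc s M) x *
    (- 2^-1 * expR (- 2^-1 * x + 2^-1 * s) * v x + expR (- 2^-1 * x + 2^-1 * s) * v' x)))).
  apply: eq_Rintegral => x _; rewrite !indic_oc.
  have [Mx|xM] := leP M `|x : R|.
    have [-> ->] := out x Mx; ring.
  move: xM; rewrite ltr_norml => /andP[Mx xM].
  rewrite Mx (ltW xM) andbT /green /green'; have [xs|sx] := leP x s.
    by rewrite /=; field.
  by rewrite /=; field.
rewrite RintB; [|exact: integZ|exact: integZ].
rewrite !RintZ// (primitive_int pl (ltW Ms)) (primitive_int pr (ltW sM')).
have [-> _] := out M (ler_norm M).
have [-> _] : v (- M) = 0 /\ v' (- M) = 0 by apply: out; rewrite normrN ler_norm.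
rewrite subrr (_ : - 2^-1 * s + 2^-1 * s = 0); last ring.
by rewrite expR0; field.
Qed.

End green_function.

Section potential.
Context {R : realType}.
Local Notation mu := (@lebesgue_measure R).
Local Notation borel := (measurableTypeR R).

(** [f] is the Riesz representative of [Lam] in the Sobolev space. *)
Definition represents (Lam : (R -> R) -> R) (f D : R -> R) :=
  [/\ real_H1 f D, (exists C : R, forall x, `|D x| <= C) &
      forall v v', real_H1 v v' -> sobolev_form f D v v' = Lam v].

Lemma square_intD (m : {measure set borel -> \bar R}) f g :
  square_int m f -> square_int m g -> square_int m (fun x => f x + g x).
Proof.
move=> [mf f2] [mg g2]; split; first exact: measurable_funD.
apply: (integ_le _ _ (integD (integZ 2 f2) (integZ 2 g2))).
  by apply: measurable_funX; exact: measurable_funD.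
move=> x; rewrite ger0_norm ?sqr_ge0// -subr_ge0.
by rewrite (_ : _ - _ = (f x - g x) ^+ 2) ?sqr_ge0//; ring.
Qed.

Lemma square_intZ (m : {measure set borel -> \bar R}) (r : R) f :
  square_int m f -> square_int m (fun x => r * f x).
Proof.
move=> [mf f2]; split; first exact: measurable_funM.
by have := integZ (r ^+ 2) f2; congr integ; apply/funext => x; rewrite exprMn.
Qed.

Lemma compact_square_int (g : R -> R) (N : R) : continuous g ->
  (forall x, N < `|x| -> g x = 0) -> square_int mu g.
Proof.
move=> cg g0; split; first exact: continuous_measurable_fun.
have : integ mu (fun x => ind (`[- N, N]%classic : set borel) x * g x ^+ 2).
  apply/(@integ_indic _ mu _ _ (measurable_itv _)).
  apply: continuous_compact_integrable; first exact: segment_compact.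
  move=> x; apply: continuous_subspaceT => y.
  by under eq_fun do rewrite expr2; apply: cvgM; exact: cg.
congr integ; apply/funext => x; rewrite indE mem_setE in_itv /= -ler_norml.
have [_|Nx] := leP `|x| N; first by rewrite mul1r.
by rewrite mul0r g0 ?expr0n.
Qed.

Lemma smooth_real_H1 (g : R -> R) (N : R) : smooth g ->
  (forall x, N < `|x| -> g x = 0) -> real_H1 g (derive1 g).
Proof.
move=> sg g0; split; first exact: smooth_primitive.
  by apply: compact_square_int g0; exact: smooth_continuous.
apply: (@compact_square_int _ N); first exact/smooth_continuous/smooth_derive1.
by move=> x /ltW; exact: derive1_vanish.
Qed.

Lemma representsD Lam1 Lam2 (f1 D1 f2 D2 : R -> R) (c : R) :
  represents Lam1 f1 D1 -> represents Lam2 f2 D2 ->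
  represents (fun v => Lam1 v + c * Lam2 v) (fun x => f1 x + c * f2 x)
    (fun x => D1 x + c * D2 x).
Proof.
move=> [[p1 s1 t1] [C1 b1] r1] [[p2 s2 t2] [C2 b2] r2]; split.
- split.
  + by apply: primitiveD => //; exact: primitiveZ.
  + by apply: square_intD => //; exact: square_intZ.
  + by apply: square_intD => //; exact: square_intZ.
- exists (C1 + `|c| * C2) => x; rewrite (le_trans (ler_normD _ _))// lerD//.
  by rewrite normrM ler_wpM2l.
move=> v v' Hv; have [_ sv sv'] := Hv.
rewrite -(r1 v v' Hv) -(r2 v v' Hv) /sobolev_form.
have E (f g h : borel -> R) : square_int mu f -> square_int mu g -> square_int mu h ->
    \int[mu]_x ((f x + c * g x) * h x) =
    \int[mu]_x (f x * h x) + c * \int[mu]_x (g x * h x).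
  move=> sf sg sh; rewrite -RintZ -?RintD; last 3 first.
  - exact: square_int_mul.
  - by apply: integZ; exact: square_int_mul.
  - exact: square_int_mul.
  by apply: eq_Rintegral => x _; ring.
by rewrite !E//; ring.
Qed.

Variables (m : {sigma_finite_measure set borel -> \bar R}) (p : borel -> R) (n : nat).
Hypotheses (pi : integ m p) (p0 : forall x, n%:R < `|x : R| -> p x = 0).

Let f x := \int[m]_s (green s x * p s).
Let D x := \int[m]_s (green' s x * p s).

Let gi x : integ m (fun s => green s x * p s).
Proof.
have mg : measurable_fun setT (fun s : borel => green s x).
  exact: (measurableT_comp measurable_green (measurable_pair2 x)).
exact: (integMb mg (fun s => green_bound s x) pi).
Qed.

Let g'i x : integ m (fun s => green' s x * p s).
Proof.
have mg : measurable_fun setT (fun s : borel => green' s x).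
  exact: (measurableT_comp measurable_green' (measurable_pair2 x)).
exact: (integMb mg (fun s => green'_bound s x) pi).
Qed.

Let mD : measurable_fun setT (D : borel -> R).
Proof. exact: (@measurable_Rint _ _ _ _ _ m _ _ measurable_green' pi). Qed.

Let P := \int[m]_s `|p s|.

Let P0 : 0 <= P.
Proof. by apply: Rintegral_ge0. Qed.

Let decay (K : R -> R -> R) x : (forall s x, `|K s x| <= green s x) ->
  integ m (fun s => K s x * p s) ->
  `|\int[m]_s (K s x * p s)| <= expR (2^-1 * n%:R) * P * expR (- (2^-1 * `|x|)).
Proof.
move=> Kg Ki; apply: le_trans (le_normr_Rintegral measurableT Ki) _.
rewrite mulrAC -RintZ; last exact: integ_norm.
apply: le_Rintegral => //; [exact: integ_norm|exact/integZ/integ_norm|].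
move=> s _; rewrite normrM.
have [sn|ns] := leP `|s : R| n%:R; last by rewrite p0// normr0 !mulr0.
rewrite ler_wpM2r// (le_trans (Kg s x))// greenE -expRD ler_expR.
have := lerB_dist x s; have : `|x| <= `|x - s| + `|s| by rewrite -{1}(subrK s x) ler_normD.
lra.
Qed.

Let fD : primitive f D.
Proof.
have DP x : `|D x| <= P.
  apply: le_trans (le_normr_Rintegral measurableT (g'i x)) _.
  apply: le_Rintegral => //; [exact/integ_norm|exact: integ_norm|].
  by move=> s _; rewrite normrM ler_piMl// green'_bound.
have i1 a b : integ mu (ind (oc a b)).
  have id1 : primitive (id : R -> R) (cst 1).
    by apply: primitive_C1 => x; exact: cvg_cst.
  by have := primitive_integ a b id1; congr integ; apply/funext => x; rewrite mulr1.
have iD a b : integ mu (fun x => ind (oc a b) x * D x).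
  by have := integMb mD DP (i1 a b); congr integ; apply/funext => x; rewrite mulrC.
split => //.
  by move=> a b; apply/(@integ_indic _ mu _ _ (oc_measurable a b)).
move=> a b ab; rewrite Rint_indic -RintB//.
rewrite -(@Rint_swap _ _ _ _ _ m mu (fun z => green' z.1 z.2) 1 p (ind (oc a b))
  measurable_green' (fun z => green'_bound _ _) pi (i1 a b)).
apply: eq_Rintegral => s _ /=; rewrite -mulrBl mulrC; congr (_ * _).
rewrite -(primitive_int (green_primitive s) ab); apply: eq_Rintegral => x _.
by rewrite mulrC.
Qed.

Let sq (g : borel -> R) (C : R) : measurable_fun setT g ->
  (forall x : R, `|g x| <= C * expR (- (2^-1 * `|x|))) -> square_int mu g.
Proof.
move=> mg gC; split => //.
apply: (integ_le _ _ (integZ (C ^+ 2) (@integ_exp_abs R))).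
  exact: measurable_funX.
move=> x; rewrite ger0_norm ?sqr_ge0// -real_normK ?num_real//.
rewrite (_ : - `|x : R| = - (2^-1 * `|x : R|) + - (2^-1 * `|x : R|)); last by field.
rewrite expRD -expr2 -exprMn ler_sqr ?nnegrE ?normr_ge0//.
exact: le_trans (gC x).
Qed.

Let Hf : real_H1 f D.
Proof.
split => //.
- apply: (@sq _ (expR (2^-1 * n%:R) * P)).
    by apply: continuous_measurable_fun; exact: primitive_continuous fD.
  move=> x; apply: decay => // s y.
  by rewrite ger0_norm// greenE expR_ge0.
- apply: (@sq _ (expR (2^-1 * n%:R) * P)) => //.
  by move=> x; apply: decay => //; exact: green'_le.
Qed.

Let compact_form (v v' : R -> R) (N : R) : primitive v v' ->
  (forall x, N <= `|x| -> v x = 0) -> (forall x, N <= `|x| -> v' x = 0) ->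
  integ mu v -> integ mu v' ->
  sobolev_form f D v v' = \int[m]_s (p s * v s).
Proof.
move=> vv' v0 v'0 vi v'i.
rewrite /sobolev_form.
have -> : \int[mu]_x (D x * v' x) = \int[m]_s (p s * \int[mu]_x (green' s x * v' x)).
  rewrite (@Rint_swap _ _ _ _ _ m mu (fun z => green' z.1 z.2) 1 p v'
    measurable_green' (fun z => green'_bound _ _) pi v'i).
  by apply: eq_Rintegral => x _; rewrite mulrC.
have -> : \int[mu]_x (f x * v x) = \int[m]_s (p s * \int[mu]_x (green s x * v x)).
  rewrite (@Rint_swap _ _ _ _ _ m mu (fun z => green z.1 z.2) 1 p v
    measurable_green (fun z => green_bound _ _) pi vi).
  by apply: eq_Rintegral => x _; rewrite mulrC.
have gen (K : R -> R -> R) (w : borel -> R) :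
    measurable_fun setT (fun z : borel * borel => K z.1 z.2) ->
    (forall s x, `|K s x| <= 1) -> integ mu w ->
    (forall s, integ mu (fun x => K s x * w x)) /\
    integ m (fun s => p s * \int[mu]_x (K s x * w x)).
  move=> mK K1 wi.
  have Kwi s : integ mu (fun x => K s x * w x).
    have mg : measurable_fun setT (fun x : borel => K s x).
      exact: (measurableT_comp mK (measurable_pair1 s)).
    exact: (integMb mg (K1 s) wi).
  split => //.
  have mI : measurable_fun setT (fun s : borel => \int[mu]_x (K s x * w x)).
    have mK' : measurable_fun setT (fun z : borel * borel => K z.2 z.1).
      exact: (measurableT_comp mK (@measurable_swap _ _ _ _)).
    exact: (@measurable_Rint _ _ _ _ _ mu _ _ mK' wi).
  have bI s : `|\int[mu]_x (K s x * w x)| <= \int[mu]_x `|w x|.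
    apply: le_trans (le_normr_Rintegral measurableT (Kwi s)) _.
    apply: le_Rintegral => //; [exact/integ_norm|exact: integ_norm|].
    by move=> x _; rewrite normrM ler_piMl.
  by have := integMb mI bI pi; congr integ; apply/funext => s; rewrite mulrC.
have [a1 a2] := gen _ v' measurable_green' green'_bound v'i.
have [b1 b2] := gen _ v measurable_green green_bound vi.
rewrite -RintZ// -RintD//; last exact: integZ.
apply: eq_Rintegral => s _.
rewrite mulrCA -mulrDr; congr (_ * _); rewrite -RintZ// -RintD//; last exact: integZ.
exact: (@green_reproducing R v v' N s).
Qed.

(** For compactly supported [v] exchange the integrals and use
    [green_reproducing]. As [p] has bounded support, replacing [v] by a cutoff of
    [v] does not change the right-hand side. *)
Lemma green_represents :
  exists f D, represents (fun v => \int[m]_s (p s * v s)) f D.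
Proof.
exists f, D; split => //.
  exists P => x; apply: le_trans (le_normr_Rintegral measurableT (g'i x)) _.
  apply: le_Rintegral => //; [exact/integ_norm|exact: integ_norm|].
  by move=> s _; rewrite normrM ler_piMl// green'_bound.
move=> v v' Hv; have [vv' sv sv'] := Hv; have [_ sf sD] := Hf.
apply: (cvg_unique (@Rhausdorff R) (cutoff_limit sf sD sv sv')).
apply: cvg_near_cst; near=> k.
rewrite (@compact_form _ _ k.+2%:R (real_H1_cutoff k Hv)).
- apply: eq_Rintegral => s _; have [sn|ns] := leP `|s : R| n%:R.
    rewrite cutoff_in ?mul1r//; apply: (le_trans sn); rewrite ler_nat leqW//.
    by near: k; exact: nbhs_infty_ge.
  by rewrite p0// !mul0r.
- by move=> x kx; rewrite cutoff_out// mul0r.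
- move=> x kx; rewrite cutoff_out// mul0r addr0.
  rewrite (derive1_vanish (n := k.+2%:R)) ?mul0r//; first exact: cutoff_smooth.
  by move=> y /ltW; exact: cutoff_out.
- by apply: square_int_mul => //; case: (smooth_real_H1 (cutoff_smooth k) (fun x kx => @cutoff_out R k x (ltW kx))).
- have [_ c1 c2] := smooth_real_H1 (cutoff_smooth k) (fun x kx => @cutoff_out R k x (ltW kx)).
  by apply: integD; exact: square_int_mul.
Unshelve. all: by end_near. Qed.

End potential.

(** * Derivatives of absolutely continuous functions *)

Section measurable_derivative.
Context {R : realType} (f : R -> R) (cf : continuous f).
Local Notation borel := (measurableTypeR R).

Let q (h x : R) := h^-1 *: (f (h + x) - f x).

Let cq2 h : continuous (q h).
Proof.
move=> x; apply: cvgZr; apply: cvgB; last exact: cf.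
apply: (@continuous_comp _ _ _ (fun x : R => h + x) f); last exact: cf.
by apply: cvgD; [exact: cvg_cst|exact: cvg_id].
Qed.

Let cq1 x h : h != 0 -> {for h, continuous (q ^~ x)}.
Proof.
move=> h0; apply: cvgZ; first by apply: cvgV => //; exact: cvg_id.
apply: cvgB; last exact: cvg_cst.
apply: (@continuous_comp _ _ _ (fun h : R => h + x) f); last exact: cf.
by apply: cvgD; [exact: cvg_id|exact: cvg_cst].
Qed.

Let close (k n : nat) (r : rat) : set borel :=
  [set x | 0 < `|ratr r : R| < n.+1%:R^-1 ->
     `|q (ratr r) x - q n.+2%:R^-1 x| <= k.+1%:R^-1].

Let mclose k n r : measurable (close k n r).
Proof.
rewrite /close; have [h|h] := pselect (0 < `|ratr r : R| < n.+1%:R^-1); last first.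
  rewrite (_ : [set x | _] = setT); first exact: measurableT.
  by apply/seteqP; split => // x _ /= /h.
rewrite (_ : [set x | _] = (fun x => `|q (ratr r) x - q n.+2%:R^-1 x|) @^-1` `]-oo, k.+1%:R^-1]%classic); last first.
  by apply/seteqP; split => x /=; rewrite in_itv /=; [exact|move=> ? _].
rewrite -[X in measurable X]setTI.
have mq h' : measurable_fun setT (q h' : borel -> R).
  by apply: continuous_measurable_fun; exact: cq2.
have : measurable_fun setT (fun x : borel => `|q (ratr r) x - q n.+2%:R^-1 x|).
  by apply: measurableT_comp => //; exact: measurable_funB.
by apply => //; exact: measurable_itv.
Qed.

Let D : set borel := \bigcap_k \bigcup_n \bigcap_r close k n r.

Let mD : measurable D.
Proof.
apply: bigcapT_measurable => k; apply: bigcupT_measurable => n.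
rewrite -[X in measurable X]setCK; apply: measurableC.
rewrite setC_bigcap; apply: bigcupT_measurable_rat => r.
by apply: measurableC; exact: mclose.
Qed.

Let inv_small (e : R) : 0 < e -> exists n : nat, n.+1%:R^-1 < e.
Proof.
move=> e0; exists (Num.truncn e^-1); rewrite -[ltRHS]invrK ltf_pV2 ?posrE ?invr_gt0//.
exact: truncnS_gt.
Qed.

Let inv_lt (n : nat) : 0 < `|n.+2%:R^-1 : R| < n.+1%:R^-1.
Proof.
have n2 : 0 < n.+2%:R^-1 :> R by rewrite invr_gt0 ltr0n.
by rewrite gtr0_norm// n2 /= ltf_pV2 ?posrE ?ltr0n// ltr_nat.
Qed.

Let cvg_in x : cvg (q ^~ x @ 0^') -> D x.
Proof.
move=> /cvg_ex[l ql] k _.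
have e0 : 0 < k.+1%:R^-1 / 2 :> R by rewrite divr_gt0// invr_gt0.
have /cvgrPdist_lt/(_ _ e0)[d /= d0 dP] := ql.
have [n nd] := inv_small d0; exists n => // r _ /andP[r0 rn].
have dist h : 0 < `|h| < n.+1%:R^-1 -> `|l - q h x| < k.+1%:R^-1 / 2.
  move=> /andP[h0 hn]; apply: dP; last by rewrite -normr_gt0.
  by rewrite /= sub0r normrN (lt_trans hn).
rewrite -(subrKA l) (le_trans (ler_normD _ _))// (splitr k.+1%:R^-1) lerD// ltW//.
  by rewrite distrC dist// r0.
exact: dist.
Qed.

Let in_near x (k n : nat) : (\bigcap_r close k n r) x ->
  forall h : R, 0 < `|h| < n.+1%:R^-1 -> `|q h x - q n.+2%:R^-1 x| <= k.+1%:R^-1.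
Proof.
move=> cl h hn; rewrite leNgt; apply/negP => far.
have /andP[h0 hn'] := hn; rewrite normr_gt0 in h0.
have c1 : `|q y x - q n.+2%:R^-1 x| @[y --> h] --> `|q h x - q n.+2%:R^-1 x|.
  by apply: cvg_norm; apply: cvgB; [exact: cq1|exact: cvg_cst].
have c2 : `|y| @[y --> h] --> `|h| by exact: norm_continuous.
have [U [oU Uh] UP] : exists2 U : set R, open U /\ U h & forall y, U y ->
    k.+1%:R^-1 < `|q y x - q n.+2%:R^-1 x| /\ 0 < `|y| < n.+1%:R^-1.
  have : \forall y \near h, k.+1%:R^-1 < `|q y x - q n.+2%:R^-1 x| /\ 0 < `|y| < n.+1%:R^-1.
    near=> y; split; first by near: y; move/(@cvgr_gt _ R _ _ _ _) : c1; apply.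
    apply/andP; split; near: y.
      by move/(@cvgr_gt _ R _ _ _ _) : c2; apply; rewrite normr_gt0.
    by move/(@cvgr_lt _ R _ _ _ _) : c2; apply.
  rewrite -near_simpl nbhsE => -[U [oU Uh] UP]; exists U; first by split.
  by move=> y /UP h'; exact: h'.
have [y [Uy [r _ rE]]] := @dense_rat R U (ex_intro _ h Uh) oU.
have [far' small] := UP _ Uy; rewrite -rE in far' small.
by have := cl r I small; rewrite leNgt far'.
Unshelve. all: by end_near. Qed.

Let in_cvg x : D x -> cvg (q ^~ x @ 0^').
Proof.
move=> Dx; apply/cauchy_cvgP/cauchy_exP => e e0.
have [k ke] := inv_small e0; have [n _ cl] := Dx k I.
exists (q n.+2%:R^-1 x).
suff : \forall h \near 0^', ball (q n.+2%:R^-1 x) e (q h x) by [].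
near=> h; apply: le_lt_trans ke; rewrite distrC; apply: (in_near cl); apply/andP; split.
  by rewrite normr_gt0; near: h; exact: nbhs_dnbhs_neq.
by near: h; apply: dnbhs0_lt; rewrite invr_gt0.
Unshelve. all: by end_near. Qed.

(** The difference quotients are continuous in the increment away from [0], so
    whether they converge can be tested on rational increments, which gives a
    Borel set. On it the derivative is a limit of continuous functions; off it
    [derive1] has the default value [0]. *)
Lemma measurable_derive1 : measurable_fun setT (derive1 f : borel -> R).
Proof.
apply: (measurable_fun_cvg (h := fun n x => ind D x * q n.+1%:R^-1 x)).
  move=> n; apply: measurable_funM; first exact: measurable_indic.
  by apply: continuous_measurable_fun; exact: cq2.
move=> x _; rewrite indE; have [xD|xD] := boolP (x \in D); last first.
  have ncv : ~ cvg (q ^~ x @ 0^') by move=> /cvg_in xD'; move/negP: xD; apply; rewrite inE.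
  rewrite /derive1 (dvgP ncv) (_ : (fun n => _) = cst 0); first exact: cvg_cst.
  by apply/funext => n; rewrite mul0r.
rewrite inE in xD; have cv := in_cvg xD.
rewrite (_ : (fun n => _) = (fun n => q n.+1%:R^-1 x)); last first.
  by apply/funext => n; rewrite mul1r.
rewrite /derive1; apply/cvgrPdist_lt => e e0.
have /cvgrPdist_lt/(_ _ e0)[d /= d0 dP] := cv.
near=> n; apply: dP => /=; last by rewrite invr_eq0 pnatr_eq0.
rewrite sub0r normrN gtr0_norm ?invr_gt0//.
near: n; have /cvgrPdist_lt/(_ _ d0) := @cvg_harmonic R.
by apply: filterS => n /=; rewrite sub0r normrN gtr0_norm.
Unshelve. all: by end_near. Qed.

End measurable_derivative.

Section absolute_continuity.
Context {R : realType}.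
Local Notation mu := (@lebesgue_measure R).
Local Notation borel := (measurableTypeR R).

Let ac_part (f : R -> R[i]) (g : R -> R) (a b : R) : abs_continuous_on a b f ->
  (forall x y, `|g y - g x| <= Normc.normc (f y - f x)) -> ac_on a b g.
Proof.
move=> acf gf e e0; have [d d0 dP] := acf e e0; exists d => // l pl il al ld.
have P (i : 'I_(size l)) : tnth (in_tuple l) i \in l by exact: mem_tnth.
apply/ltW; apply: le_lt_trans (dP (size l) (tnth (in_tuple l)) _ _ _).
- rewrite big_tnth; apply: ler_sum => i _; exact: gf.
- move=> i; have /andP[h1 h2] := allP il _ (P i); split => //; split => //.
  exact: (allP pl _ (P i)).
- move=> i j _ _ [x [/=]]; rewrite !in_itv /= => /andP[i1 i2] /andP[j1 j2].
  apply/eqP; apply: contraT => ij.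
  have [I [J [Ii Jj apIJ]]] : exists I J, [/\ I = tnth (in_tuple l) i, J = tnth (in_tuple l) j & apart I J].
    exists (tnth (in_tuple l) i), (tnth (in_tuple l) j); split => //.
    rewrite !(tnth_nth (0, 0)) /=.
    have /(pairwiseP (0, 0)) apl := al.
    have [lt|lt|/val_inj ijE] := ltngtP i j.
    + by apply: apl => //; rewrite inE.
    + by rewrite apartC; apply: apl => //; rewrite inE.
    + by rewrite ijE eqxx in ij.
  move: apIJ; rewrite /apart Ii Jj => /orP[h|h].
    by have := lt_le_trans i2 (le_trans h (ltW j1)); rewrite ltxx.
  by have := lt_le_trans j2 (le_trans h (ltW i1)); rewrite ltxx.
- by move: ld; rewrite /total_length big_tnth.
Qed.

Lemma normc_ge_Re (z : R[i]) : `|complex.Re z| <= Normc.normc z.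
Proof.
case: z => a b /=; rewrite -sqrtr_sqr ler_wsqrtr// lerDl sqr_ge0//.
Qed.

Lemma normc_ge_Im (z : R[i]) : `|complex.Im z| <= Normc.normc z.
Proof.
case: z => a b /=; rewrite -sqrtr_sqr ler_wsqrtr// lerDr sqr_ge0//.
Qed.

Lemma Re_ac (f : R -> R[i]) : locally_abs_continuous f ->
  forall a b, ac_on a b (fun x => complex.Re (f x)).
Proof.
move=> acf a b; apply: ac_part (acf a b) _ => x y.
by apply: le_trans (normc_ge_Re _); case: (f y) (f x) => ? ? [].
Qed.

Lemma Im_ac (f : R -> R[i]) : locally_abs_continuous f ->
  forall a b, ac_on a b (fun x => complex.Im (f x)).
Proof.
move=> acf a b; apply: ac_part (acf a b) _ => x y.
by apply: le_trans (normc_ge_Im _); case: (f y) (f x) => ? ? [].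
Qed.

Lemma primitive_bounded_ac (u d : R -> R) (C : R) : primitive u d ->
  (forall x, `|d x| <= C) -> locally_abs_continuous (fun x => Complex (u x) 0).
Proof.
move=> [md di dE] dC a b e e0.
have C0 : 0 <= C by apply: le_trans (dC 0).
have muoc x y : x <= y -> mu (oc x y) = (y - x)%:E.
  rewrite /oc lebesgue_measure_itv /= lte_fin le_eqVlt.
  by move=> /predU1P[->|xy]; rewrite ?ltxx ?subrr// xy -EFinB.
have lip x y : x <= y -> `|u y - u x| <= C * (y - x).
  move=> xy; rewrite dE//; apply: le_trans (le_normr_Rintegral _ (di x y)) _ => //.
  apply: (@le_trans _ _ (\int[mu]_(t in oc x y) (cst C t))).
    apply: le_Rintegral => //; first exact: (integrable_abse (di x y)).
    apply: measurable_bounded_integrable => //.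
      by change (mu (oc x y) < +oo)%E; rewrite muoc// ltry.
    by exists `|C|; split => // M CM t _ /=; exact: ltW.
  by rewrite Rintegral_cst// [X in fine X](muoc x y xy).
exists (e / (C + 1)); first by rewrite divr_gt0// ltr_pwDr.
move=> m I Iab _ Id.
apply: (@le_lt_trans _ _ (C * \sum_(i < m) ((I i).2 - (I i).1))).
  rewrite mulr_sumr; apply: ler_sum => i _.
  rewrite (_ : Normc.normc _ = `|u (I i).2 - u (I i).1|).
    by apply: lip; have [_ []] := Iab i.
  by rewrite /= subr0 expr0n /= addr0 sqrtr_sqr.
rewrite (@le_lt_trans _ _ (C * (e / (C + 1))))//.
  by rewrite ler_wpM2l// ltW.
by rewrite mulrCA gtr_pMr// ltr_pdivrMr ?mul1r ?ltrDl// ltr_pwDr.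
Qed.

End absolute_continuity.

(** * Restrictions of a signed measure *)

Section charge_windows.
Context {R : realType} (omega : signed_borel R).
Local Notation borel := (measurableTypeR R).

Let decomp n (A : set borel) : measurable A ->
  (omega (A `&` window R n))%:E = (omega_pos omega n A - omega_neg omega n A)%E.
Proof.
move=> mA; have := jordan_decomp (svalP (hahn_choice (signed_restr omega n))) mA.
by rewrite /cadd/= cscaleN1; apply: eq_trans.
Qed.

(** [P1 + N2] and [P2 + N1] are the same measure on [W]. *)
Let swap_parts (P1 N1 P2 N2 : {finite_measure set borel -> \bar R}) (W : set borel)
    (psi : borel -> R) : measurable W ->
  (forall A, measurable A -> A `<=` W -> (P1 A - N1 A = P2 A - N2 A)%E) ->
  (forall m : {finite_measure set borel -> \bar R}, integ m psi) ->
  (forall x, x \notin W -> psi x = 0) ->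
  \int[P1]_x psi x - \int[N1]_x psi x = \int[P2]_x psi x - \int[N2]_x psi x.
Proof.
move=> mW PN psii psi0.
have onW (m : {finite_measure set borel -> \bar R}) :
    \int[m]_x psi x = \int[m]_(x in W) psi x.
  rewrite [RHS]Rint_indic; apply: eq_Rintegral => x _; rewrite indE.
  by have [_|/psi0 ->] := boolP (x \in W); rewrite ?mul1r ?mulr0.
have psiW (m : {finite_measure set borel -> \bar R}) : m.-integrable W (EFin \o psi).
  exact: (integrableS _ _ _ (psii m)).
have fin (m : {finite_measure set borel -> \bar R}) :
    (\int[m]_(x in W) (psi x)%:E)%E \is a fin_num.
  exact: integrable_fin_num (psiW m).
suff : \int[P1]_(x in W) psi x + \int[N2]_(x in W) psi x =
       \int[P2]_(x in W) psi x + \int[N1]_(x in W) psi x.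
  by rewrite !onW => h; lra.
rewrite /Rintegral -!fineD; [congr fine|exact: fin..].
rewrite -(integral_measure_add mW (psiW P1) (psiW N2)).
rewrite -(integral_measure_add mW (psiW P2) (psiW N1)).
apply: eq_measure_integral => A mA AW.
have := PN A mA AW; rewrite /= /msum !big_ord_recl !big_ord0 !adde0 /=.
have f1 := fin_num_measure P1 A mA; have f2 := fin_num_measure P2 A mA.
have f3 := fin_num_measure N1 A mA; have f4 := fin_num_measure N2 A mA.
rewrite -(fineK f1) -(fineK f2) -(fineK f3) -(fineK f4) -!EFinB -!EFinD.
have E (a b c d : R) : (a - b)%:E = (c - d)%:E -> (a + d)%:E = (c + b)%:E.
  by case=> h; congr EFin; lra.
exact: E.
Qed.

(** The Jordan decompositions of the restrictions of [omega] to two windows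
    need not agree, only the charges on the smaller window do. *)
Lemma omega_int_window n m (psi : R -> R) : continuous psi ->
  (forall x, n%:R < `|x| -> psi x = 0) -> (forall x, m%:R < `|x| -> psi x = 0) ->
  omega_int omega n psi = omega_int omega m psi.
Proof.
wlog nm : n m / (n <= m)%N.
  move=> h cpsi pn pm; have [nm|/ltnW mn] := leqP n m; first exact: h.
  by apply/esym; exact: h.
move=> cpsi pn _.
apply: (@swap_parts (omega_pos omega n) (omega_neg omega n) (omega_pos omega m)
  (omega_neg omega m) (window R n) psi).
- exact: window_measurable.
- move=> A mA An; rewrite -(decomp n mA) -(decomp m mA); congr (_%:E); congr (omega _).
  have nW : window R n `<=` window R m.
    move=> x /mem_set; rewrite window_norm => xn; apply: set_mem.
    by rewrite window_norm (le_trans xn)// ler_nat.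
  by rewrite setIidl// setIidl//; exact: subset_trans nW.
- move=> nu; have := integ_window_finite nu n cpsi; congr integ; apply/funext => x.
  rewrite indE window_norm; have [_|/pn ->] := leP `|x : R| n%:R; rewrite ?mul1r//.
  by rewrite mulr0.
- by move=> x; rewrite window_norm -ltNge => /pn.
Qed.

End charge_windows.

(** * Solutions for compactly supported sources *)

Section weak_solutions.
Context {R : realType} (omega : signed_borel R)
    (upsilon : {measure set (measurableTypeR R) -> \bar R})
    (upsilon_lf : locally_finite_measure upsilon).
Local Notation mu := (@lebesgue_measure R).
Local Notation borel := (measurableTypeR R).

(** Integration by parts on an interval that contains the support of [phi]. *)
Lemma sobolev_smooth (a a' phi : R -> R) (n : nat) : real_H1 a a' -> smooth phi ->
  (forall x, n%:R < `|x| -> phi x = 0) ->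
  sobolev_form a a' phi (derive1 phi) =
  - (\int[mu]_x (a x * derive1 (derive1 phi) x)) + 4^-1 * \int[mu]_x (a x * phi x).
Proof.
move=> [aa' sa sa'] sphi phi0; rewrite /sobolev_form; congr (_ + _).
have dphi0 := derive1_vanish sphi phi0.
have sdphi := smooth_derive1 sphi.
have [_ sd sdd] := smooth_real_H1 sdphi (fun x nx => dphi0 x (ltW nx)).
have P := primitive_mul aa' (smooth_primitive sdphi).
have M0 : - n.+1%:R <= n.+1%:R :> R by rewrite ltW// gtrN.
have := primitive_int P M0.
have nM : n%:R <= n.+1%:R :> R by rewrite ler_nat.
rewrite !dphi0 ?normrN ?ger0_norm// !mulr0 subrr.
rewrite (_ : (fun x => ind _ x * _) =
    (fun x => a' x * derive1 phi x + a x * derive1 (derive1 phi) x)).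
  rewrite RintD; [|exact: square_int_mul|exact: square_int_mul].
  by move=> h; apply/eqP; rewrite -addr_eq0 h.
apply/funext => x; rewrite indic_oc.
have [|] := boolP (- n.+1%:R < x <= n.+1%:R); first by rewrite mul1r.
rewrite negb_and -leNgt -ltNge mul0r => h.
have nx : n%:R < `|x|.
  apply: (@lt_le_trans _ _ n.+1%:R); first by rewrite ltr_nat.
  by rewrite ler_normr; case/orP: h => h; rewrite ?(ltW h)// lerNr h orbT.
rewrite dphi0 ?(ltW nx)// (derive1_vanish (n := n%:R)) ?mulr0 ?addr0 ?(ltW nx)//.
by move=> y /ltW; exact: dphi0.
Qed.

Lemma weak_eq_ae (a p q q' : R -> R) : measurable_fun setT (q : borel -> R) ->
  measurable_fun setT (q' : borel -> R) ->
  {ae upsilon, forall x : borel, q x = q' x} ->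
  weak_eq omega upsilon a p q -> weak_eq omega upsilon a p q'.
Proof.
move=> mq mq' qq' w n phi sphi phi0; rewrite (w n phi)//; congr (_ + _).
have mphi : measurable_fun setT (phi : borel -> R).
  by apply: continuous_measurable_fun; exact: smooth_continuous.
apply: ae_eq_Rint; [exact: measurable_funM..|].
by apply: filterS qq' => x ->.
Qed.

(** A superposition of three Green potentials: of [phi] against the positive and
    against the negative part of [omega], and of [q] against [upsilon]. *)
Lemma weak_eq_solvable n (phi q : R -> R) : smooth phi ->
  (forall x, n%:R < `|x| -> phi x = 0) -> square_int upsilon q ->
  (forall x, n%:R < `|x| -> q x = 0) ->
  exists f D, [/\ weak_eq omega upsilon f phi q &
    represents (fun v => omega_int omega n (fun x => phi x * v x) +
      \int[upsilon]_x (q x * v x)) f D].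
Proof.
move=> sphi phi0 sq q0.
have windowE (f : R -> R) : (forall x, n%:R < `|x| -> f x = 0) ->
    (fun x => ind (window R n) x * f x) = f.
  move=> f0; apply/funext => x; rewrite indE window_norm.
  by case: leP => [_|/f0 ->]; rewrite ?mul1r ?mulr0.
have pfin (m : {finite_measure set borel -> \bar R}) : integ m phi.
  by rewrite -(windowE _ phi0); apply: integ_window_finite; exact: smooth_continuous.
have qi : integ (lf_measure upsilon_lf) q.
  by rewrite -(windowE _ q0); exact: (integ_window_upsilon upsilon_lf).
have [f1 [D1 r1]] := green_represents (pfin (omega_pos omega n)) phi0.
have [f2 [D2 r2]] := green_represents (pfin (omega_neg omega n)) phi0.
have [f3 [D3 r3]] := green_represents qi q0.
have [f [D r]] : exists f D, represents (fun v => omega_int omega n (fun x => phi x * v x) +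
    \int[upsilon]_x (q x * v x)) f D.
  have := representsD 1 (representsD (-1) r1 r2) r3 => r.
  do 2 eexists; move: r; congr (represents _ _ _); apply/funext => v.
  by rewrite /omega_int mul1r mulN1r.
exists f, D; split => //; have [Hf _ rep] := r => m psi spsi psi0.
have Hpsi := smooth_real_H1 spsi psi0.
rewrite -(sobolev_smooth Hf spsi psi0) rep//; congr (_ + _).
apply: omega_int_window => [|x nx|x nx].
- by move=> x; apply: cvgM; exact: smooth_continuous.
- by rewrite phi0 ?mul0r.
- by rewrite psi0 ?mulr0.
Qed.

End weak_solutions.

(** * Real and imaginary parts *)

Section complex_parts.
Context {R : realType}.
Local Notation mu := (@lebesgue_measure R).
Local Notation borel := (measurableTypeR R).

(** A uniform notation for real ([false]) and imaginary ([true]) parts, so that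
    the four real relations hidden in a complex one are handled together. *)
Definition part (b : bool) (z : R[i]) : R :=
  if b then complex.Im z else complex.Re z.

Lemma part_Cderiv b (f : R -> R[i]) x :
  part b (Cderiv f x) = derive1 (fun y => part b (f y)) x.
Proof. by case: b. Qed.

Lemma square_integrable_part (m : {measure set borel -> \bar R}) (f : borel -> R[i]) b :
  square_integrable m setT f -> square_int m (fun x => part b (f x)).
Proof.
move=> [[mr mi] fin].
have mp c : measurable_fun setT (fun x : borel => part c (f x)) by case: c.
have i2 : integ m (fun x => complex.Re (f x) ^+ 2 + complex.Im (f x) ^+ 2).
  apply/integrableP; split.
    by apply/measurable_EFinP; apply: measurable_funD; apply: measurable_funX.
  move: fin; rewrite (eq_integral (fun x =>
    `|(complex.Re (f x) ^+ 2 + complex.Im (f x) ^+ 2)%:E|%E))// => x _ /=.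
  by rewrite ger0_norm// addr_ge0// sqr_ge0.
split => //; apply: (integ_le _ _ i2); first exact: measurable_funX.
move=> x; rewrite ger0_norm ?sqr_ge0//.
by case: b => /=; rewrite ?lerDl ?lerDr sqr_ge0.
Qed.

Lemma square_integrable_parts (m : {measure set borel -> \bar R}) (f : borel -> R[i]) :
  (forall b, square_int m (fun x => part b (f x))) -> square_integrable m setT f.
Proof.
move=> sp; have [mr r2] := sp false; have [mi i2] := sp true; split => //.
have /integrableP[_] := integD r2 i2.
rewrite (eq_integral (fun x => (complex.Re (f x) ^+ 2 + complex.Im (f x) ^+ 2)%:E))//.
by move=> x _ /=; rewrite ger0_norm// addr_ge0// sqr_ge0.
Qed.

Section products.
Variables (m : {measure set borel -> \bar R}) (f g : borel -> R[i]).
Variables (f_ g_ : bool -> borel -> R).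
Hypotheses (fE : forall b x, part b (f x) = f_ b x)
           (gE : forall b x, part b (g x) = g_ b x)
           (fgi : forall b c, integ m (fun x => f_ b x * g_ c x)).

Lemma Cintegral_mul : Cintegral m (fun x => f x * g x) =
  Complex (\int[m]_x (f_ false x * g_ false x) - \int[m]_x (f_ true x * g_ true x))
          (\int[m]_x (f_ false x * g_ true x) + \int[m]_x (f_ true x * g_ false x)).
Proof.
rewrite -RintB// -RintD//; congr Complex; apply: eq_Rintegral => x _;
  by rewrite -!fE -!gE; case: (f x) (g x) => a b [c d].
Qed.

Lemma Cintegral_mul_conj : Cintegral m (fun x => f x * conjc (g x)) =
  Complex (\int[m]_x (f_ false x * g_ false x) + \int[m]_x (f_ true x * g_ true x))
          (\int[m]_x (f_ true x * g_ false x) - \int[m]_x (f_ false x * g_ true x)).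
Proof.
rewrite -RintD// -RintB//; congr Complex; apply: eq_Rintegral => x _;
  by rewrite -!fE -!gE; case: (f x) (g x) => a b [c d] /=; ring.
Qed.

End products.

Lemma Rint_eq0 (m : {measure set borel -> \bar R}) (f : borel -> R) :
  (forall x, f x = 0) -> \int[m]_x f x = 0.
Proof. by move=> f0; rewrite /Rintegral integral0_eq// => x _; rewrite f0. Qed.

Lemma sobolev_formC (a a' v v' : R -> R) : sobolev_form a a' v v' = sobolev_form v v' a a'.
Proof.
rewrite /sobolev_form; congr (_ + 4^-1 * _); apply: eq_Rintegral => x _; exact: mulrC.
Qed.

Lemma sobolev_form_derive (f D v v' : R -> R) : primitive f D ->
  measurable_fun setT (v' : borel -> R) ->
  sobolev_form f (derive1 f) v v' = sobolev_form f D v v'.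
Proof.
move=> fD mv'; rewrite /sobolev_form; congr (_ + _).
have mf' := measurable_derive1 (primitive_continuous fD); have [mD _ _] := fD.
apply: ae_eq_Rint; [exact: measurable_funM|exact: measurable_funM|].
by apply: filterS (primitive_derive fD) => x ->.
Qed.

Lemma quarter_Complex (a b : R) : (4^-1 : R[i]) * Complex a b = Complex (4^-1 * a) (4^-1 * b).
Proof.
have -> : (4^-1 : R[i]) = real_complex R 4^-1 by rewrite fmorphV rmorph_nat.
by apply/eqP; rewrite eq_complex /= !mul0r subr0 addr0 !eqxx.
Qed.

Lemma test_function_part n (phi : R -> R[i]) b : test_function n phi ->
  smooth (fun x => part b (phi x)) /\ forall x, n%:R < `|x| -> part b (phi x) = 0.
Proof.
move=> [dr di phi0]; split; last by move=> x /phi0 ->; case: b.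
have dp k x : derivable (derive1n k (fun x => part b (phi x))) x 1 by case: b.
move=> k; rewrite -[X in Ck _ X]/(derive1n 0 _); move: 0%N.
elim: k => [//|k IHk] j; exists (derive1n j.+1 (fun x => part b (phi x))); split => //.
by move=> x; rewrite derive1nS derive1E; apply: derivableP.
Qed.

Lemma real_test_function n (phi : R -> R) : smooth phi ->
  (forall x, n%:R < `|x| -> phi x = 0) -> test_function n (fun x => Complex (phi x) 0).
Proof.
move=> sphi phi0; split => [k x|k x|x /phi0 ->//].
- by apply: smooth_derivable; exact: smooth_derive1n.
- by apply: smooth_derivable; apply: smooth_derive1n => j; exact: Ck_cst.
Qed.

Lemma H1_part (f : H1 R) b :
  real_H1 (fun x => part b (f x)) (derive1 (fun x => part b (f x))).
Proof.
have sd : square_int mu (derive1 (fun x => part b (f x))).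
  have := @square_integrable_part mu _ b (H1_deriv_L2 f).
  by congr square_int; apply/funext => x; exact: part_Cderiv.
split => //; last exact: (@square_integrable_part mu _ b (H1_L2 f)).
apply: ac_primitive; last by case: sd.
by case: b {sd}; [exact: Im_ac (H1_ac f)|exact: Re_ac (H1_ac f)].
Qed.

Lemma L2_part (m : {measure set borel -> \bar R}) (g : L2 m) b :
  square_int m (fun x => part b (L2_rep g x)).
Proof. exact: square_integrable_part (L2fun_sqint (repr g)). Qed.

(** The bound on [D] makes [f] Lipschitz. [D] is the derivative of [f] only
    almost everywhere, which is why the measurability of [derive1 f] needs a
    separate argument. *)
Lemma H1_of_real (f D : R -> R) (C : R) : real_H1 f D -> (forall x, `|D x| <= C) ->
  exists F : H1 R, forall x, F x = Complex (f x) 0.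
Proof.
move=> [fD sf sD] DC; pose F x := Complex (f x) 0.
have sq0 : square_int mu (fun=> 0).
  split => //; have := @integrable0 _ _ R mu setT.
  by congr (mu.-integrable _); apply/funext => x /=; rewrite expr0n.
have acF : locally_abs_continuous F by exact: primitive_bounded_ac fD DC.
have sF : square_integrable mu setT F.
  by apply: square_integrable_parts => -[].
have sF' : square_integrable mu setT (Cderiv F).
  apply: square_integrable_parts => -[].
    rewrite (_ : (fun x => _) = fun=> 0)//; apply/funext => x.
    by rewrite part_Cderiv /= derive1_cst.
  rewrite (_ : (fun x => _) = derive1 f); last by apply/funext => x; rewrite part_Cderiv.
  have mf' := measurable_derive1 (primitive_continuous fD).
  split => //; have [mD D2] := sD; apply: ae_eq_integ D2.
  - exact: measurable_funX.
  - exact: measurable_funX.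
  - by apply: filterS (primitive_derive fD) => x ->.
by exists (MkH1 acF sF sF').
Qed.

Lemma L2_of_real (m : {measure set borel -> \bar R}) (q : R -> R) : square_int m q ->
  exists G : L2 m, {ae m, forall x : borel, L2_rep G x = Complex (q x) 0}.
Proof.
move=> sq; have sq0 : square_int m (fun=> 0).
  split => //; have := @integrable0 _ _ R m setT.
  by congr (m.-integrable _); apply/funext => x /=; rewrite expr0n.
have sG : square_integrable m setT (fun x => Complex (q x) 0).
  by apply: square_integrable_parts => -[].
exists (\pi_(L2 m)%qT (MkL2fun sG)).
have : (\pi_(L2 m) (repr (\pi_(L2 m) (MkL2fun sG))) = \pi_(L2 m) (MkL2fun sG))%qT.
  by rewrite reprK.
by move=> /eqmodP/asboolP.
Qed.

End complex_parts.

(** * Self-adjointness *)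

Section self_adjointness.
Context {R : realType} (omega : signed_borel R)
    (upsilon : {measure set (measurableTypeR R) -> \bar R})
    (upsilon_lf : locally_finite_measure upsilon).
Local Notation mu := (@lebesgue_measure R).
Local Notation borel := (measurableTypeR R).
Local Notation H := (Hspace upsilon).

Let p1 b (f : H) : R -> R := fun x => part b (f.1 x).
Let p2 b (f : H) : R -> R := fun x => part b (L2_rep f.2 x).

Let Hp1 b f : real_H1 (p1 b f) (derive1 (p1 b f)).
Proof. exact: H1_part. Qed.

Let cp1 b f : continuous (p1 b f).
Proof. by have [h _ _] := Hp1 b f; exact: primitive_continuous h. Qed.

Let sp2 b f : square_int upsilon (p2 b f).
Proof. exact: L2_part. Qed.

Let mp1 b f : measurable_fun setT (p1 b f : borel -> R).
Proof. by apply: continuous_measurable_fun; exact: cp1. Qed.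

Definition pairing (f g : H) b c : R :=
  sobolev_form (p1 b f) (derive1 (p1 b f)) (p1 c g) (derive1 (p1 c g)) +
  \int[upsilon]_x (p2 b f x * p2 c g x).

Lemma H_inner_parts (f g : H) : H_inner f g =
  Complex (pairing f g false false + pairing f g true true)
          (pairing f g true false - pairing f g false true).
Proof.
have alg (x1 x2 x3 x4 y1 y2 y3 y4 z1 z2 z3 z4 : R) :
    Complex (4^-1 * (x1 + x2)) (4^-1 * (x3 - x4)) + Complex (y1 + y2) (y3 - y4) +
    Complex (z1 + z2) (z3 - z4) =
    Complex (y1 + 4^-1 * x1 + z1 + (y2 + 4^-1 * x2 + z2))
            (y3 + 4^-1 * x3 + z3 - (y4 + 4^-1 * x4 + z4)).
  by congr Complex; ring.
have D b (h : H) x : part b (Cderiv h.1 x) = derive1 (p1 b h) x by exact: part_Cderiv.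
have i1 b c : integ mu (fun x => p1 b f x * p1 c g x).
  by have [_ h1 _] := Hp1 b f; have [_ h2 _] := Hp1 c g; exact: square_int_mul.
have i2 b c : integ mu (fun x => derive1 (p1 b f) x * derive1 (p1 c g) x).
  by have [_ _ h1] := Hp1 b f; have [_ _ h2] := Hp1 c g; exact: square_int_mul.
have i3 b c : integ upsilon (fun x => p2 b f x * p2 c g x) by exact: square_int_mul.
rewrite /H_inner (Cintegral_mul_conj (fun _ _ => erefl) (fun _ _ => erefl) i1).
rewrite (Cintegral_mul_conj (D ^~ f) (D ^~ g) i2).
rewrite (Cintegral_mul_conj (fun _ _ => erefl) (fun _ _ => erefl) i3).
by rewrite quarter_Complex alg.
Qed.

Let window_square_int n (q : R -> R) (M : R) : measurable_fun setT (q : borel -> R) ->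
  (forall x, `|x| <= n%:R -> `|q x| <= M) -> (forall x, n%:R < `|x| -> q x = 0) ->
  square_int upsilon q.
Proof.
move=> mq qM q0; split => //.
have bq x : `|q x ^+ 2| <= M ^+ 2.
  rewrite normrX ler_sqr ?nnegrE//.
    by have [/qM//|/q0 ->] := leP `|x| n%:R; rewrite normr0 (le_trans (normr_ge0 (q 0)))// qM// normr0.
  by rewrite (le_trans (normr_ge0 (q 0)))// qM// normr0.
have := integMb (measurable_funX 2 mq) bq (integ_ind_window upsilon_lf n).
congr integ; apply/funext => x; rewrite indE window_norm.
by have [_|/q0 ->] := leP `|x : R| n%:R; rewrite ?mulr1 ?mulr0// expr0n.
Qed.

Let locally (m : {measure set borel -> \bar R}) (f : borel -> R[i]) :
  square_integrable m setT f -> L2loc m f.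
Proof.
move=> sf n; have [[mr mi] fin] := sf; split.
  by split; [exact: measurable_funS mr|exact: measurable_funS mi].
apply: le_lt_trans fin; apply: ge0_subset_integral => //.
- exact: window_measurable.
- apply/measurable_EFinP; apply: measurable_funD; exact: measurable_funX.
- by move=> x _; rewrite lee_fin addr_ge0// sqr_ge0.
Qed.

Let Hloc_rep (f : H) : Hloc upsilon (H_rep f).
Proof.
split; last exact: locally (L2fun_sqint (repr f.2)).
by split; [exact: H1_ac|exact: locally (H1_deriv_L2 f.1)].
Qed.

Let lhs (a phi : R -> R) : R :=
  - (\int[mu]_x (a x * derive1 (derive1 phi) x)) + 4^-1 * \int[mu]_x (a x * phi x).

Let rhs n (p q phi : R -> R) : R :=
  omega_int omega n (fun x => p x * phi x) + \int[upsilon]_x (q x * phi x).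

Let weak_eq0 : weak_eq omega upsilon (fun=> 0) (fun=> 0) (fun=> 0).
Proof.
have z (m : {measure set borel -> \bar R}) (w : R -> R) : \int[m]_x (0 * w x) = 0.
  by apply: Rint_eq0 => x; rewrite mul0r.
move=> n phi _ _; by rewrite /omega_int !z mulr0 oppr0 !addr0.
Qed.

Let lhs0 a : lhs a (fun=> 0) = 0.
Proof.
have d0 : derive1 (fun _ : R => 0 : R) = fun=> 0 by apply/funext => y; rewrite derive1_cst.
rewrite /lhs d0 Rint_eq0 => [|x]; last by rewrite d0 mulr0.
by rewrite Rint_eq0 ?mulr0 ?oppr0 ?addr0// => x; rewrite mulr0.
Qed.

Let rhs0 n p q : rhs n p q (fun=> 0) = 0.
Proof.
have z (m : {measure set borel -> \bar R}) (w : R -> R) : \int[m]_x (w x * 0) = 0.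
  by apply: Rint_eq0 => x; rewrite mulr0.
by rewrite /rhs /omega_int (z (omega_pos omega n)) (z (omega_neg omega n)) z subrr addr0.
Qed.

(** Real test functions separate the two parts of the equation. Conversely both
    sides for a complex test function are combinations of the real equations
    for its parts. *)
Lemma distributional_eq_parts (f g : H) :
  distributional_eq omega upsilon f.1 g.1 (L2_rep g.2) <->
  forall b, weak_eq omega upsilon (p1 b f) (p1 b g) (p2 b g).
Proof.
have ups_int n (q phi : R -> R) : square_int upsilon q -> continuous phi ->
    (forall x, n%:R < `|x| -> phi x = 0) -> integ upsilon (fun x => q x * phi x).
  move=> sq cphi phi0; have [M hM] := continuous_bounded_itv (- n%:R) n%:R cphi.
  have mphi : measurable_fun setT (phi : borel -> R) by exact: continuous_measurable_fun.
  have bphi x : `|phi x| <= `|M|.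
    have [xn|/phi0 ->] := leP `|x| n%:R; last by rewrite normr0.
    by apply: le_trans (hM x _) (ler_norm M); rewrite -ler_norml.
  have := integMb mphi bphi (integ_window_upsilon upsilon_lf n sq).
  congr integ; apply/funext => x; rewrite indE window_norm.
  by case: leP => [_|/phi0 ->]; rewrite ?mul1r ?mul0r ?mulr0// mulrC.
have fin_int n (m : {finite_measure set borel -> \bar R}) (p phi : R -> R) :
    continuous p -> continuous phi ->
    (forall x, n%:R < `|x| -> phi x = 0) -> integ m (fun x => p x * phi x).
  move=> cp cphi phi0.
  have : continuous (fun x : R => p x * phi x) by move=> x; apply: cvgM; [exact: cp|exact: cphi].
  move=> /(integ_window_finite m n); congr integ; apply/funext => x; rewrite indE window_norm.
  by case: leP => [_|/phi0 ->]; rewrite ?mul1r ?mulr0.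
have leb_int n (phi : R -> R) b : smooth phi -> (forall x, n%:R < `|x| -> phi x = 0) ->
    integ mu (fun x => p1 b f x * phi x).
  move=> sphi phi0; have [_ h _] := Hp1 b f; apply: square_int_mul => //.
  by have [] := smooth_real_H1 sphi phi0.
have alg1 (x1 x2 x3 x4 y1 y2 y3 y4 : R) :
    - Complex (x1 - x2) (x3 + x4) + Complex (4^-1 * (y1 - y2)) (4^-1 * (y3 + y4)) =
    Complex (- x1 + 4^-1 * y1 - (- x2 + 4^-1 * y2)) (- x3 + 4^-1 * y3 + (- x4 + 4^-1 * y4)).
  by congr Complex; ring.
have alg2 (x1 x2 x3 x4 y1 y2 y3 y4 z1 z2 z3 z4 : R) :
    Complex (x1 - x2) (x3 + x4) - Complex (y1 - y2) (y3 + y4) + Complex (z1 - z2) (z3 + z4) =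
    Complex (x1 - y1 + z1 - (x2 - y2 + z2)) (x3 - y3 + z3 + (x4 - y4 + z4)).
  by congr Complex; ring.
have expand n (phi : R -> R[i]) : test_function n phi ->
    let ph c x := part c (phi x) in
    let L b c := lhs (p1 b f) (ph c) in
    let Q b c := rhs n (p1 b g) (p2 b g) (ph c) in
    (- Cintegral lebesgue_measure (fun x => f.1 x * Cderiv (Cderiv phi) x)
      + 4^-1 * Cintegral lebesgue_measure (fun x => f.1 x * phi x) =
     Complex (L false false - L true true) (L false true + L true false)) /\
    (charge_Cintegral (signed_restr omega n) (fun x => g.1 x * phi x)
      + Cintegral upsilon (fun x => L2_rep g.2 x * phi x) =
     Complex (Q false false - Q true true) (Q false true + Q true false)).
  move=> tphi ph L Q.
  have sph c : smooth (ph c) by have [] := test_function_part c tphi.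
  have ph0 c x : n%:R < `|x| -> ph c x = 0.
    by have [_ h] := test_function_part c tphi; exact: h.
  have cph c := smooth_continuous (sph c).
  have sph2 c := smooth_derive1 (smooth_derive1 (sph c)).
  have ph2 c x : n%:R < `|x| -> derive1 (derive1 (ph c)) x = 0.
    move=> nx; apply: (derive1_vanish (n := n%:R)) (ltW nx); first exact: smooth_derive1.
    by move=> y /ltW; apply: derive1_vanish; [exact: sph|exact: ph0].
  have D c x : part c (Cderiv (Cderiv phi) x) = derive1 (derive1 (ph c)) x.
    rewrite part_Cderiv; congr (derive1 _ x).
    by apply/funext => y; rewrite part_Cderiv.
  have i1 b c : integ mu (fun x => p1 b f x * ph c x) by exact: leb_int (sph c) (ph0 c).
  have i2 b c : integ mu (fun x => p1 b f x * derive1 (derive1 (ph c)) x).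
    exact: leb_int (sph2 c) (ph2 c).
  have i3 (m : {finite_measure set borel -> \bar R}) b c :
    integ m (fun x => p1 b g x * ph c x).
    exact: (fin_int n m _ _ (@cp1 b g) (cph c) (ph0 c)).
  have i4 b c : integ upsilon (fun x => p2 b g x * ph c x).
    exact: (ups_int n _ _ (sp2 b g) (cph c) (ph0 c)).
  split.
    rewrite (Cintegral_mul (fun _ _ => erefl) D i2).
    rewrite (Cintegral_mul (fun _ _ => erefl) (fun _ _ => erefl) i1).
    by rewrite quarter_Complex alg1.
  rewrite /charge_Cintegral (Cintegral_mul (fun _ _ => erefl) (fun _ _ => erefl) (i3 _)).
  rewrite (Cintegral_mul (fun _ _ => erefl) (fun _ _ => erefl) (i3 _)).
  rewrite (Cintegral_mul (fun _ _ => erefl) (fun _ _ => erefl) i4).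
  by rewrite alg2.
split=> [eqC b n phi sphi phi0|eqR n phi tphi].
  have tphi := real_test_function sphi phi0.
  have [EL EQ] := expand n _ tphi.
  have := eqC n _ tphi; rewrite EL EQ.
  have e : (fun x => part true (Complex (phi x) 0)) = fun=> 0 by [].
  rewrite e !lhs0 !rhs0 !(subr0, addr0, add0r).
  by case: b => -[].
have [-> ->] := expand n _ tphi.
have eqb b c : lhs (p1 b f) (fun x => part c (phi x)) =
    rhs n (p1 b g) (p2 b g) (fun x => part c (phi x)).
  by have [h1 h2] := test_function_part c tphi; exact: eqR.
by rewrite !eqb.
Qed.

Lemma Trel_parts (f g : H) : Trel omega upsilon (f, g) <->
  (forall b, weak_eq omega upsilon (p1 b f) (p1 b g) (p2 b g)) /\
  {ae upsilon, forall x : borel, L2_rep f.2 x = g.1 x}.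
Proof.
split=> [[_ _ /distributional_eq_parts eqfg fg]|[eqfg fg]]; first by split.
by split => //; [exact: Hloc_rep..|exact/distributional_eq_parts].
Qed.

(** Both almost everywhere identities are used to exchange second components
    with first ones in the integrals against [upsilon]. *)
Let pairing_sym (f g h k : H) b c :
  Trel omega upsilon (f, g) -> Trel omega upsilon (h, k) ->
  pairing f k b c = pairing g h b c.
Proof.
move=> /Trel_parts[eqfg fg] /Trel_parts[eqhk hk].
have fgb e : {ae upsilon, forall x : borel, p2 e f x = p1 e g x}.
  by apply: filterS fg => x; rewrite /p2 => ->.
have hkb e : {ae upsilon, forall x : borel, p2 e h x = p1 e k x}.
  by apply: filterS hk => x; rewrite /p2 => ->.
have sq e (u v : H) : {ae upsilon, forall x : borel, p2 e u x = p1 e v x} ->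
    square_int upsilon (p1 e v).
  move=> uv; have [mu2 u2] := sp2 e u; split => //.
  apply: ae_eq_integ u2; [exact: measurable_funX|exact: measurable_funX|].
  by apply: filterS uv => x ->.
have sg := sq _ _ _ (fgb b); have sk := sq _ _ _ (hkb c).
have := weak_eq_symmetric upsilon_lf (eqfg b) (eqhk c) (Hp1 b f) (Hp1 b g)
  (Hp1 c h) (Hp1 c k) (sp2 b g) (sp2 c k) sg sk.
have -> : \int[upsilon]_x (p2 b g x * p1 c k x) = \int[upsilon]_x (p2 b g x * p2 c h x).
  have [mg _] := sp2 b g; have [mh _] := sp2 c h.
  apply: ae_eq_Rint; [exact: measurable_funM|exact: measurable_funM|].
  by apply: filterS (hkb c) => x ->.
have -> : \int[upsilon]_x (p2 c k x * p1 b g x) = \int[upsilon]_x (p2 b f x * p2 c k x).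
  have [mk _] := sp2 c k; have [mf _] := sp2 b f.
  apply: ae_eq_Rint; [exact: measurable_funM|exact: measurable_funM|].
  by apply: filterS (fgb b) => x ->; rewrite mulrC.
have alg (x y z w : R) : x - y = z - w -> x + w = z + y by lra.
by rewrite /pairing (sobolev_formC (p1 b g)) => /alg.
Qed.

(** Pairing [(u, v)] with the solution [h] of the equation with source [(phi, q)]. *)
Lemma adjoint_tested (u v : H) n (phi q : R -> R) b :
  adjoint_relation (@H_inner R upsilon) (Trel omega upsilon) (u, v) ->
  smooth phi -> (forall x, n%:R < `|x| -> phi x = 0) ->
  square_int upsilon q -> (forall x, n%:R < `|x| -> q x = 0) ->
  sobolev_form (p1 b u) (derive1 (p1 b u)) phi (derive1 phi) +
    \int[upsilon]_x (p2 b u x * q x) =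
  omega_int omega n (fun x => phi x * p1 b v x) +
    \int[upsilon]_x (q x * p1 b v x) + \int[upsilon]_x (p2 b v x * phi x).
Proof.
move=> adj sphi phi0 sq q0.
have [f [D [eqf [Hf [C DC] rep]]]] := weak_eq_solvable omega upsilon_lf sphi phi0 sq q0.
have [fD sf sD] := Hf; have [phid sphi1 sphi2] := smooth_real_H1 sphi phi0.
have dphi_bounded : exists M : R, forall x, `|derive1 phi x| <= M.
  have [M hM] := continuous_bounded_itv (- n%:R) n%:R (smooth_continuous (smooth_derive1 sphi)).
  exists `|M| => x; have [xn|nx] := leP `|x| n%:R.
    by apply: le_trans (hM x _) (ler_norm M); rewrite -ler_norml.
  by rewrite (derive1_vanish sphi phi0) ?normr0// ltW.
have [M dphiM] := dphi_bounded.
have [F FE] := H1_of_real Hf DC.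
have [Phi PhiE] := H1_of_real (smooth_real_H1 sphi phi0) dphiM.
have cphi := smooth_continuous sphi.
have sphiU : square_int upsilon phi.
  have mphi : measurable_fun setT (phi : borel -> R) by exact: continuous_measurable_fun.
  have [M' hM'] := continuous_bounded_itv (- n%:R) n%:R cphi.
  by apply: (@window_square_int n _ M') => // x xn; apply: hM'; rewrite -ler_norml.
have [G GE] := L2_of_real sphiU; have [Q QE] := L2_of_real sq.
pose h : H := (F, G); pose k : H := (Phi, Q).
have h1 e : p1 e h = if e then fun=> 0 else f.
  by apply/funext => x; rewrite /p1 /h FE; case: e.
have k1 e : p1 e k = if e then fun=> 0 else phi.
  by apply/funext => x; rewrite /p1 /k PhiE; case: e.
have h2 e : {ae upsilon, forall x : borel, p2 e h x = if e then 0 else phi x}.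
  by apply: filterS GE => x; rewrite /p2 => ->; case: e.
have k2 e : {ae upsilon, forall x : borel, p2 e k x = if e then 0 else q x}.
  by apply: filterS QE => x; rewrite /p2 => ->; case: e.
have hk : Trel omega upsilon (h, k).
  apply/Trel_parts; split; last by apply: filterS GE => x ->; rewrite PhiE.
  move=> e; have [mk _] := sp2 e k; rewrite h1 k1.
  apply: (@weak_eq_ae _ _ _ _ _ (fun x => if e then 0 else q x)) => //.
  - by case: e {mk} => //; case: sq.
  - by apply: filterS (k2 e) => x ->.
  - by case: e {mk} => //; exact: weak_eq0.
have := adj (h, k) hk; rewrite /= !H_inner_parts.
have P0 (w : H) c (e : H) : (p1 true e = fun=> 0) ->
    {ae upsilon, forall x : borel, p2 true e x = 0} -> pairing w e c true = 0.
  move=> e1 e2; rewrite /pairing /sobolev_form e1.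
  have [mw _] := sp2 c w; have [me _] := sp2 true e.
  rewrite (_ : \int[upsilon]_x _ = \int[upsilon]_x (p2 c w x * 0)); last first.
    apply: ae_eq_Rint; [exact: measurable_funM|exact: measurable_funM|].
    by apply: filterS e2 => x ->.
  rewrite !Rint_eq0; first by rewrite mulr0 !addr0.
  - by move=> x; rewrite mulr0.
  - by move=> x; rewrite mulr0.
  - by move=> x; rewrite derive1_cst mulr0.
have uk c := P0 u c k (k1 true) (k2 true); have vh c := P0 v c h (h1 true) (h2 true).
rewrite !uk !vh !subr0 !addr0 => uv.
have : pairing u k b false = pairing v h b false by case: b; case: uv.
have [mu2 _] := sp2 b u; have [mv2 _] := sp2 b v; have [mq _] := sq; have [mphi _] := sphiU.
have [mh2 _] := sp2 false h; have [mk2 _] := sp2 false k.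
have -> : pairing u k b false =
    sobolev_form (p1 b u) (derive1 (p1 b u)) phi (derive1 phi) +
    \int[upsilon]_x (p2 b u x * q x).
  rewrite /pairing (k1 false); congr (_ + _).
  apply: ae_eq_Rint; [exact: measurable_funM|exact: measurable_funM|].
  by apply: filterS (k2 false) => x ->.
move=> ->; rewrite -(rep _ _ (Hp1 b v)).
rewrite /pairing (h1 false); congr (_ + _); last first.
  apply: ae_eq_Rint; [exact: measurable_funM|exact: measurable_funM|].
  by apply: filterS (h2 false) => x ->.
have [_ _ [mv1 _]] := Hp1 b v.
by rewrite sobolev_formC; exact: sobolev_form_derive.
Qed.

Let symmetric (f g h k : H) : Trel omega upsilon (f, g) ->
  Trel omega upsilon (h, k) -> H_inner f k = H_inner g h.
Proof. by move=> fg hk; rewrite !H_inner_parts !(pairing_sym _ _ fg hk). Qed.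

(** With [phi = 0] the tested identity says that [u2 - v1] is orthogonal to every
    [q] supported in a window, in particular to its own restriction. *)
Let adjoint_second (u v : H) :
  adjoint_relation (@H_inner R upsilon) (Trel omega upsilon) (u, v) ->
  {ae upsilon, forall x : borel, L2_rep u.2 x = v.1 x}.
Proof.
move=> adj.
have eqb n b : {ae upsilon, forall x : borel, `|x : R| <= n%:R -> p2 b u x = p1 b v x}.
  pose q x := ind (window R n) x * (p2 b u x - p1 b v x).
  have qE x : q x = if `|x| <= n%:R then p2 b u x - p1 b v x else 0.
    by rewrite /q indE window_norm; case: ifP; rewrite ?mul1r ?mul0r.
  have mI : measurable_fun setT (ind (window R n) : borel -> R) by exact: ind_window_measurable.
  have [mu2 u2] := sp2 b u.
  have mq : measurable_fun setT (q : borel -> R).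
    by apply: measurable_funM => //; exact: measurable_funB.
  have sW : square_int upsilon (fun x => ind (window R n) x * p2 b u x).
    split; first exact: measurable_funM.
    apply: (integ_le _ _ u2); first by apply: measurable_funX; exact: measurable_funM.
    move=> x; rewrite ger0_norm ?sqr_ge0// indE.
    by case: (x \in _); rewrite ?mul1r// mul0r expr0n sqr_ge0.
  have sV : square_int upsilon (fun x => ind (window R n) x * p1 b v x).
    have [M hM] := continuous_bounded_itv (- n%:R) n%:R (@cp1 b v).
    apply: (@window_square_int n _ M); first exact: measurable_funM.
      move=> x xn; rewrite indE window_norm xn mul1r; apply: hM; rewrite -ler_norml//.
    by move=> x; rewrite indE window_norm ltNge => /negbTE ->; rewrite mul0r.
  have sq : square_int upsilon q.
    have := square_intD sW (square_intZ (-1) sV); congr square_int.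
    by apply/funext => x; rewrite /q; ring.
  have q0 x : n%:R < `|x| -> q x = 0 by rewrite qE ltNge => /negbTE ->.
  have s0 : smooth (fun _ : R => 0 : R) by move=> j; exact: Ck_cst.
  have := adjoint_tested b adj s0 (fun (x : R) (_ : n%:R < `|x|) => erefl) sq q0.
  have z0 (m : {measure set borel -> \bar R}) (w : R -> R) : \int[m]_x (0 * w x) = 0.
    by apply: Rint_eq0 => x; rewrite mul0r.
  have z1 (m : {measure set borel -> \bar R}) (w : R -> R) : \int[m]_x (w x * 0) = 0.
    by apply: Rint_eq0 => x; rewrite mulr0.
  have z2 : \int[mu]_x (derive1 (p1 b u) x * derive1 (fun=> 0) x) = 0.
    by apply: Rint_eq0 => x; rewrite derive1_cst mulr0.
  rewrite /sobolev_form /omega_int z2 !z0 !z1 mulr0 subrr !addr0 !add0r => uv.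
  have qq x : q x ^+ 2 = p2 b u x * q x - q x * p1 b v x.
    by rewrite qE; case: ifP => _; ring.
  have i1 := square_int_mul (sp2 b u) sq.
  have i2 : integ upsilon (fun x => q x * p1 b v x).
    have := square_int_mul sq sV; congr integ; apply/funext => x.
    by rewrite qE indE window_norm; case: ifP; rewrite ?mul1r// !mul0r.
  have q2 : \int[upsilon]_x (q x ^+ 2) = 0.
    have -> : (fun x : borel => q x ^+ 2) = (fun x => p2 b u x * q x - q x * p1 b v x).
      exact/funext.
    by rewrite RintB// uv subrr.
  have [_ iq2] := sq.
  have q2E : (\int[upsilon]_(x in setT) `|(q x ^+ 2)%:E| = 0)%E.
    have -> : (fun x : borel => `|(q x ^+ 2)%:E|%E) = (fun x => (q x ^+ 2)%:E).
      by apply/funext => x /=; rewrite ger0_norm ?sqr_ge0.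
    have fin : (\int[upsilon]_x (q x ^+ 2)%:E)%E \is a fin_num.
      exact: integrable_fin_num iq2.
    by rewrite -(fineK fin); congr EFin.
  have mq2 : measurable_fun setT (EFin \o (fun x : borel => q x ^+ 2)).
    by apply/measurable_EFinP; exact: measurable_funX.
  have := (ae_eq_integral_abs upsilon measurableT mq2).1 q2E.
  apply: filterS => x /(_ I) /= [] /eqP; rewrite sqrf_eq0 qE => /eqP + xn.
  by rewrite xn => /eqP; rewrite subr_eq0 => /eqP.
have := ae_foralln (fun n => ae_foralln (fun m => eqb n (m == 0%N))).
apply: filterS => x h.
have bx b : p2 b u x = p1 b v x.
  by case: b; [apply: (h (Num.truncn `|x : R|).+1 0%N)|apply: (h (Num.truncn `|x : R|).+1 1%N)];
    exact/ltW/truncnS_gt.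
have := bx false; have := bx true; rewrite /p1 /p2 /=.
by case: (L2_rep _ _) (v.1 x) => a b [c d] /= -> ->.
Qed.

(** The tested identity with [q = 0]. *)
Let adjoint_weak_eq (u v : H) b :
  adjoint_relation (@H_inner R upsilon) (Trel omega upsilon) (u, v) ->
  weak_eq omega upsilon (p1 b u) (p1 b v) (p2 b v).
Proof.
move=> adj n phi sphi phi0.
have sq0 : square_int upsilon (fun=> 0).
  by apply: (@window_square_int 0 _ 0) => // x _; rewrite normr0.
have := adjoint_tested b adj sphi phi0 sq0 (fun x _ => erefl).
rewrite (sobolev_smooth (Hp1 b u) sphi phi0).
have z0 (w : R -> R) : \int[upsilon]_x (0 * w x) = 0.
  by apply: Rint_eq0 => x; rewrite mul0r.
have z1 (w : R -> R) : \int[upsilon]_x (w x * 0) = 0.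
  by apply: Rint_eq0 => x; rewrite mulr0.
rewrite (z1 (p2 b u)) (z0 (p1 b v)) !addr0 => ->.
congr (_ + _); rewrite /omega_int.
by congr (_ - _); apply: eq_Rintegral => x _; rewrite mulrC.
Qed.

Lemma Trel_adjoint :
  Trel omega upsilon = adjoint_relation (@H_inner R upsilon) (Trel omega upsilon).
Proof.
apply/seteqP; split=> [[f g] fg [h k] hk|[u v] adj]; first exact: symmetric.
by apply/Trel_parts; split => [b|]; [exact: adjoint_weak_eq|exact: adjoint_second].
Qed.

End self_adjointness.

Theorem theorem5p1 (R : realType) (omega : signed_borel R)
    (upsilon : {measure set (measurableTypeR R) -> \bar R})
    (upsilon_locally_finite : locally_finite_measure upsilon) :
  self_adjoint_relation (@H_inner R upsilon) (Trel omega upsilon).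
Proof. exact: Trel_adjoint. Qed.
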